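(* Let $A$ and $B$ be Weil algebras, with associated Weil functors $T_A,T_B:\mathcal{M}f\to\mathcal{M}f$ on the category $\mathcal{M}f$ of smooth manifolds modelled on convenient vector spaces. Then: (1) The algebra $A$ is recovered from the functor $T_A$: $T_A(\mathbb R)=A$, with addition $+_A=T_A(+_{\mathbb R})$, multiplication $m_A=T_A(m_{\mathbb R})$, and scalar multiplication $m_t=T_A(m_t):A\to A$ for $t\in\mathbb R$ (where $+_{\mathbb R},m_{\mathbb R}:\mathbb R\times\mathbb R\to\mathbb R$ are addition and multiplication and $m_t:\mathbb R\to\mathbb R$ is multiplication by $t$). (2) The natural transformations $T_A\to T_B$ correspond exactly to the algebra homomorphisms $A\to B$: assigning to a natural transformation $\varphi:T_A\to T_B$ its value $\varphi_{\mathbb R}:T_A(\mathbb R)=A\to T_B(\mathbb R)=B$ is a bijection onto the set of algebra homomorphisms $A\to B$, with inverse $\psi\mapsto T(\psi,\;\cdot\;)$.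
   Context: Convenient calculus. A (Hausdorff, real) locally convex vector space $E$ is convenient if for each smooth curve $\mathbb R\to E$ the Riemann integrals over compact intervals exist in $E$. The $c^\infty$-topology on $E$ is the final topology with respect to all smooth curves $\mathbb R\to E$. A mapping between $c^\infty$-open subsets of convenient vector spaces is smooth if it maps smooth curves to smooth curves. Manifolds. A smooth manifold $M$ is a set with a maximal atlas of charts $u_\alpha:U_\alpha\to u_\alpha(U_\alpha)\subseteq E_\alpha$ (bijections onto $c^\infty$-open subsets of convenient vector spaces, with the $U_\alpha$ covering $M$) whose chart changings $u_{\alpha\beta}=u_\alpha\circ u_\beta^{-1}$ are defined on $c^\infty$-open subsets and smooth. A mapping between manifolds is smooth iff it maps smooth curves to smooth curves. $\mathcal{M}f$ is the category of all such manifolds and smooth mappings. Weil algebras. A Weil algebra is a real commutative unital algebra of the form $A=\mathbb R\cdot1\oplus N$ with $N$ a finite dimensional ideal of nilpotent elements. Algebra homomorphisms are unital. $\pi=\pi_A:A\to A/N=\mathbb R$ is the projection. Weil functor $T_A$. For a convenient vector space $E$ put $T_AE=A\otimes E$; for $U\subseteq E$ $c^\infty$-open put $T_AU=(\pi\otimes E)^{-1}(U)$. For a smooth $f:U\to V$ between $c^\infty$-open subsets $U\subseteq E$, $V\subseteq F$, and a basis of $A$ consisting of $1$ and elements $n_j\in N$, define $T_Af:T_AU\to T_AV$ by $$T_Af\Big(1\otimes x+\sum_j n_j\otimes x_j\Big)=1\otimes f(x)+\sum_{k\ge1}\frac1{k!}\sum_{j_1,\dots,j_k}n_{j_1}\cdots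 n_{j_k}\otimes d^kf(x)(x_{j_1},\dots,x_{j_k}),$$ a finite sum, independent of the basis. For a manifold $M$ with atlas $(U_\alpha,u_\alpha)$, $T_AM$ is the manifold obtained by gluing the sets $T_A(u_\alpha(U_\alpha))$ via the maps $T_A(u_{\alpha\beta})$, and $T_Af$ for smooth $f:M\to M'$ is obtained by applying $T_A$ to local representatives. $T_A$ is a functor respecting finite products, so $T_A(\mathbb R\times\mathbb R)=T_A(\mathbb R)\times T_A(\mathbb R)$. For an algebra homomorphism $\psi:A\to B$ of Weil algebras, $T(\psi,M):T_AM\to T_BM$ is the (natural) map given in charts by restrictions of $\psi\otimes E_\alpha:A\otimes E_\alpha\to B\otimes E_\alpha$. *)

(* Defs.v *)
From HB Require Import structures.
From mathcomp Require Import all_boot all_order all_algebra.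
From mathcomp Require Import all_classical all_reals all_analysis.
From mathcomp Require Import finmap.
From mathcomp Require Import ring lra.
From Stdlib Require Import Relation_Operators.
Import numFieldNormedType.Exports.

Set Implicit Arguments.
Unset Strict Implicit.
Unset Printing Implicit Defensive.
Import Order.TTheory GRing.Theory Num.Theory.
Local Open Scope classical_set_scope.
Local Open Scope ring_scope.

(* Same difference quotient as [derive] and [derivable] of MathComp-Analysis,
   which require normed modules. *)
Definition tquot (R : realType) (E F : tvsType R) (f : E -> F) (v x : E) :
    R -> F :=
  fun h => h^-1 *: (f (h *: v + x) - f x).

Definition tderivable (R : realType) (E F : tvsType R) (f : E -> F)
    (v x : E) : Prop :=
  exists l : F, tquot f v x @ 0^' --> l.

Definition tderive (R : realType) (E F : tvsType R) (f : E -> F) (v : E) :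
    E -> F :=
  fun x => xget 0 [set l : F | tquot f v x @ 0^' --> l].

(* [d^k f (x) (v_1, ..., v_k)], for [vs = [:: v_1; ...; v_k]], as an iterated
   directional derivative. *)
Definition tderives (R : realType) (E F : tvsType R) (f : E -> F)
    (vs : seq E) : E -> F :=
  foldr (fun v g => tderive g v) f vs.

Definition smooth_at (R : realType) (E : tvsType R) (c : R -> E) (t : R) :
    Prop :=
  forall n, tderivable (iter n (fun g => tderive g (1 : R)) c) (1 : R) t.

Definition smooth_curve (R : realType) (E : tvsType R) (c : R -> E) : Prop :=
  forall t, smooth_at c t.

Definition is_riemann_integral (R : realType) (E : tvsType R) (c : R -> E)
    (a b : R) (I : E) : Prop :=
  forall W : set E, nbhs I W -> exists2 d : R, 0 < d &
    forall (n : nat) (x xi : nat -> R), x 0%N = a -> x n = b ->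
      (forall i, (i < n)%N -> x i <= xi i <= x i.+1) ->
      (forall i, (i < n)%N -> x i.+1 - x i < d) ->
      W (\sum_(i < n) (x i.+1 - x i) *: c (xi i)).

Definition convenient (R : realType) (E : tvsType R) : Prop :=
  hausdorff_space E /\
  forall c : R -> E, smooth_curve c ->
    forall a b : R, a <= b -> exists I, is_riemann_integral c a b I.

(* Openness for the final topology with respect to all smooth curves. *)
Definition cinf_open (R : realType) (E : tvsType R) (U : set E) : Prop :=
  forall c : R -> E, smooth_curve c -> open (c @^-1` U).

(* Maps defined on a subset [U] are represented by total functions whose values
   outside of [U] are irrelevant. *)
Definition smooth_on (R : realType) (E F : tvsType R) (U : set E)
    (f : E -> F) : Prop :=
  forall c : R -> E, smooth_curve c -> (forall t, U (c t)) ->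
    smooth_curve (f \o c).

(* Subsets of manifolds and collections of charts are plain predicates, and not
   elements of [set _], whose universe is too small for collections of charts
   over arbitrary model spaces. *)
Record chart (R : realType) (M : Type) := Chart {
  chart_model : tvsType R;
  chart_dom : M -> Prop;
  chart_map : M -> chart_model
}.

Definition chart_cod (R : realType) (M : Type) (u : chart R M) :
    set (chart_model u) :=
  [set x | exists2 p, chart_dom u p & chart_map u p = x].
Arguments chart_cod {R M} u _.

Definition is_chart (R : realType) (M : Type) (u : chart R M) : Prop :=
  [/\ convenient (chart_model u),
      forall p q, chart_dom u p -> chart_dom u q ->
        chart_map u p = chart_map u q -> p = q &
      cinf_open (chart_cod u)].

(* The local representative [v \o f \o u^-1], which is defined on the image
   under [u] of the points of [U] that [f] maps to [V]. *)
Definition local_dom (R : realType) (M N : Type) (u : chart R M) (f : M -> N)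
    (v : chart R N) : set (chart_model u) :=
  [set x | exists2 p, chart_dom u p /\ chart_dom v (f p) & chart_map u p = x].
Arguments local_dom {R M N} u f v _.

Definition local_rep (R : realType) (M N : Type) (u : chart R M) (f : M -> N)
    (v : chart R N) : chart_model u -> chart_model v :=
  fun x => xget 0 [set y | exists p : M,
    [/\ chart_dom u p, chart_dom v (f p), chart_map u p = x &
        y = chart_map v (f p)]].
Arguments local_rep {R M N} u f v _.

(* The chart changing [u \o v^-1]. *)
Definition smooth_change (R : realType) (M : Type) (u v : chart R M) : Prop :=
  cinf_open (local_dom v id u) /\
  smooth_on (local_dom v id u) (local_rep v id u).

Definition chart_compatible (R : realType) (M : Type) (u v : chart R M) :
    Prop :=
  smooth_change u v /\ smooth_change v u.

(* All charts compatible with those of [At]; if [At] is an atlas, this is the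
   maximal atlas containing it. *)
Definition maximal_atlas (R : realType) (M : Type) (At : chart R M -> Prop) :
    chart R M -> Prop :=
  fun w => is_chart w /\ forall u, At u -> chart_compatible u w.

(* A set with a collection of charts, subject to no axiom. *)
Record chartedSet (R : realType) := ChartedSet {
  charted_sort :> Type;
  atlas : chart R charted_sort -> Prop
}.
Arguments atlas {R} c _.

Definition is_manifold (R : realType) (M : chartedSet R) : Prop :=
  [/\ forall u, atlas M u -> is_chart u,
      forall p : M, exists2 u, atlas M u & chart_dom u p,
      forall u v, atlas M u -> atlas M v -> chart_compatible u v &
      forall w, maximal_atlas (atlas M) w -> atlas M w].

Record manifold (R : realType) := Manifold {
  manifold_charted :> chartedSet R;
  manifoldP : is_manifold manifold_charted
}.

Definition msmooth_curve (R : realType) (M : chartedSet R) (c : R -> M) :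
    Prop :=
  forall t : R, exists2 u, atlas M u &
    \forall s \near t, chart_dom u (c s) /\ smooth_at (chart_map u \o c) s.

Definition msmooth (R : realType) (M N : chartedSet R) (f : M -> N) : Prop :=
  forall c : R -> M, msmooth_curve c -> msmooth_curve (f \o c).

Definition id_chart (R : realType) (E : tvsType R) : chart R E :=
  @Chart R E E (fun=> True) id.

Definition vs_charted (R : realType) (E : tvsType R) : chartedSet R :=
  @ChartedSet R E (maximal_atlas (eq (id_chart E))).

Section SmoothCurves.
Context (R : realType).

Lemma tvs_cvgD (E : tvsType R) (T : Type) (F : set_system T) {FF : Filter F}
    (f g : T -> E) (a b : E) :
  f @ F --> a -> g @ F --> b -> (fun x => f x + g x) @ F --> a + b.
Proof.
by move=> fa gb; apply: continuous2_cvg => //; exact: (@add_continuous _ (a, b)).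
Qed.

Lemma tvs_cvgZ (E : tvsType R) (T : Type) (F : set_system T) {FF : Filter F}
    (k : T -> R) (g : T -> E) (a : R) (b : E) :
  k @ F --> a -> g @ F --> b -> (fun x => k x *: g x) @ F --> a *: b.
Proof.
move=> ka gb; apply: continuous2_cvg => //.
exact: (@scale_continuous R E (a, b)).
Qed.

Definition curve_derivative (E : tvsType R) (c : R -> E) (t : R) (l : E) :
    Prop :=
  tquot c (1 : R) t @ 0^' --> l.

Lemma curve_derivativeP (E : tvsType R) (c : R -> E) t l :
  curve_derivative c t l <->
  exists Q : R -> E, [/\ Q @ 0 --> l, Q 0 = l &
    forall h, c (h + t) = c t + h *: Q h].
Proof.
split=> [cl|[Q [Ql Q0 cE]]].
  exists (fun h => if h == 0 then l else tquot c (1 : R) t h); split.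
  - move=> W Wl.
    have hW : nbhs (0 : R) (fun h => h != 0 -> W (tquot c (1 : R) t h)).
      exact: cl Wl.
    apply: filterS hW => h /=; case: eqP => [_ _|_ /(_ isT)//].
    exact: nbhs_singleton.
  - by rewrite eqxx.
  - move=> h; case: eqP => [->|/eqP h0]; first by rewrite add0r scale0r addr0.
    rewrite /tquot scalerA mulfV// scale1r.
    by rewrite [h *: (1 : R)]mulr1 addrCA subrr addr0.
move=> W Wl; suff : nbhs (0 : R) (fun h => h != 0 -> W (tquot c (1 : R) t h)).
  by [].
have hW : nbhs (0 : R) (fun h => W (Q h)) by exact: Ql Wl.
apply: filterS hW => h /= WQ h0; rewrite /tquot [h *: (1 : R)]mulr1 cE.
by rewrite addrAC subrr add0r scalerA mulVf// scale1r.
Qed.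

Lemma curve_derivativeE (E : tvsType R) (c : R -> E) t l :
  hausdorff_space E -> curve_derivative c t l -> tderive c (1 : R) t = l.
Proof.
move=> hE cl; apply: (@cvg_unique _ hE (tquot c (1 : R) t @ 0^')) => //.
by rewrite /tderive; case: xgetP => [y ->//|/(_ l)].
Qed.

Lemma tderive_curve (E : tvsType R) (c : R -> E) t :
  tderivable c (1 : R) t -> curve_derivative c t (tderive c (1 : R) t).
Proof. by move=> [l cl]; rewrite /tderive; case: xgetP => [y ->//|/(_ l)]. Qed.

Lemma curve_derivative_continuous (E : tvsType R) (c : R -> E) t l :
  curve_derivative c t l -> (fun h => c (h + t)) @ 0 --> c t.
Proof.
move=> /curve_derivativeP[Q [Ql Q0 cE]].
rewrite (_ : (fun h => c (h + t)) = fun h => c t + h *: Q h); last exact/funext.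
rewrite -[c t in X in _ --> X]addr0 -(scale0r l).
by apply: tvs_cvgD; [exact: cvg_cst|apply: tvs_cvgZ; [exact: cvg_id|]].
Qed.

Lemma curve_derivative_cst (E : tvsType R) (a : E) t :
  curve_derivative (fun=> a) t 0.
Proof.
apply/curve_derivativeP; exists (fun=> 0); split=> //; first exact: cvg_cst.
by move=> h; rewrite scaler0 addr0.
Qed.

Lemma curve_derivativeD (E : tvsType R) (c d : R -> E) t l m :
  curve_derivative c t l -> curve_derivative d t m ->
  curve_derivative (fun s => c s + d s) t (l + m).
Proof.
move=> /curve_derivativeP[Q [Ql Q0 cE]] /curve_derivativeP[P [Pm P0 dE]].
apply/curve_derivativeP; exists (fun h => Q h + P h).
split; [exact: tvs_cvgD|by rewrite Q0 P0|move=> h].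
by rewrite cE dE scalerDr addrACA.
Qed.

Lemma curve_derivativeZ (E : tvsType R) (g : R -> R) (c : R -> E) t k l :
  curve_derivative g t k -> curve_derivative c t l ->
  curve_derivative (fun s => g s *: c s) t (k *: c t + g t *: l).
Proof.
move=> /[dup] gk /curve_derivativeP[Q [Qk Q0 gE]].
move=> /[dup] cl /curve_derivativeP[P [Pl P0 cE]].
apply/curve_derivativeP; exists (fun h => Q h *: c (h + t) + g t *: P h).
split.
- apply: tvs_cvgD; apply: tvs_cvgZ => //; last exact: cvg_cst.
  exact: curve_derivative_continuous cl.
- by rewrite Q0 P0 add0r.
- move=> h; rewrite gE -[h *: Q h]/(h * Q h) scalerDl.
  have -> : g t *: c (h + t) = g t *: c t + (g t * h) *: P h.
    by rewrite cE scalerDr scalerA.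
  by rewrite scalerDr !scalerA (mulrC h (g t)) -addrA; congr (_ + _); rewrite addrC.
Qed.

Lemma curve_derivative_comp (E : tvsType R) (k : R -> R) (c : R -> E) t m l :
  curve_derivative k t m -> curve_derivative c (k t) l ->
  curve_derivative (c \o k) t (m *: l).
Proof.
move=> /curve_derivativeP[Q [Qm Q0 kE]] /curve_derivativeP[P [Pl P0 cE]].
apply/curve_derivativeP; exists (fun h => Q h *: P (h * Q h)); split.
- apply: tvs_cvgZ => //; apply: (@cvg_comp _ _ _ (fun h => h * Q h) P _ (nbhs 0)) => //.
  have : (fun h : R => h * Q h) @ 0 --> 0 * m by apply: cvgM => //; exact: cvg_id.
  by rewrite mul0r.
- by rewrite mul0r Q0 P0.
- by move=> h; rewrite /= kE addrC cE -[h *: Q h]/(h * Q h) scalerA.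
Qed.

Fixpoint ndiff (E : tvsType R) (n : nat) (c : R -> E) : Prop :=
  if n is n'.+1 then
    (forall t, tderivable c (1 : R) t) /\ ndiff n' (tderive c (1 : R))
  else True.

Lemma smooth_curveP (E : tvsType R) (c : R -> E) :
  smooth_curve c <-> forall n, ndiff n c.
Proof.
split=> [sc n|sc t n].
  elim: n c sc => //= n IH c sc; split=> [t|]; first exact: (sc t 0%N).
  by apply: IH => t m; have := sc t m.+1; rewrite iterSr.
elim: n c sc => [|n IH] c sc; first by case: (sc 1%N) => /(_ t).
by rewrite iterSr; apply: IH => m; case: (sc m.+1).
Qed.

Lemma ndiffW (E : tvsType R) n (c : R -> E) : ndiff n.+1 c -> ndiff n c.
Proof.
elim: n c => [//|n IH] c [dc hc]; split => //; exact: IH.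
Qed.

Lemma ndiffS (E : tvsType R) (hE : hausdorff_space E) n (c c' : R -> E) :
  (forall t, curve_derivative c t (c' t)) -> ndiff n c' -> ndiff n.+1 c.
Proof.
move=> cc' nc'; split=> [t|]; first by exists (c' t); exact: cc'.
rewrite (_ : tderive c (1 : R) = c')//; apply/funext => t.
exact: curve_derivativeE (cc' t).
Qed.

Lemma ndiff_cst (E : tvsType R) (hE : hausdorff_space E) n (a : E) :
  ndiff n (fun _ : R => a).
Proof.
elim: n a => // n IH a; apply: (ndiffS hE) (IH 0) => t.
exact: curve_derivative_cst.
Qed.

Lemma ndiffD (E : tvsType R) (hE : hausdorff_space E) n (c d : R -> E) :
  ndiff n c -> ndiff n d -> ndiff n (fun s => c s + d s).
Proof.
elim: n c d => // n IH c d [dc hc] [dd hd].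
apply: (ndiffS hE) (IH _ _ hc hd) => t.
by apply: curve_derivativeD; exact: tderive_curve.
Qed.

Lemma ndiffZ (E : tvsType R) (hE : hausdorff_space E) n (g : R -> R)
    (c : R -> E) :
  ndiff n g -> ndiff n c -> ndiff n (fun s => g s *: c s).
Proof.
elim: n g c => // n IH g c hg hc.
apply: (ndiffS hE (c' := fun t => tderive g (1 : R) t *: c t +
                                  g t *: tderive c (1 : R) t)) => [t|].
  case: hg hc => dg _ [dc _].
  by apply: curve_derivativeZ; exact: tderive_curve.
apply: (ndiffD hE); apply: IH; first by case: hg.
- exact: ndiffW.
- exact: ndiffW.
- by case: hc.
Qed.

Lemma ndiff_comp (E : tvsType R) (hE : hausdorff_space E) n (k : R -> R)
    (c : R -> E) :
  ndiff n k -> ndiff n c -> ndiff n (c \o k).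
Proof.
elim: n c => // n IH c hk hc.
apply: (ndiffS hE (c' := fun t => tderive k (1 : R) t *:
                                  (tderive c (1 : R) \o k) t)) => [t|].
  case: hk hc => dk _ [dc _].
  by apply: curve_derivative_comp; exact: tderive_curve.
by apply: (ndiffZ hE); [case: hk|apply: IH; [exact: ndiffW|case: hc]].
Qed.

Lemma smooth_curve_comp (E : tvsType R) (hE : hausdorff_space E) (k : R -> R)
    (c : R -> E) :
  smooth_curve k -> smooth_curve c -> smooth_curve (c \o k).
Proof.
by move=> /smooth_curveP hk /smooth_curveP hc; apply/smooth_curveP => n;
  apply: ndiff_comp.
Qed.

Lemma curve_derivative_real (f : R -> R) (t l : R) :
  is_derive t (1 : R) f l <-> curve_derivative f t l.
Proof.
split=> [[df dfl]|dl]; first by rewrite -dfl; exact: df.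
split; first by apply/cvg_ex; exists l.
exact: (cvg_lim (@Rhausdorff R)).
Qed.

Lemma smooth_sin (a b d : R) :
  smooth_curve (fun s : R => a + b * sin s + d * cos s).
Proof.
apply/smooth_curveP => n; elim: n a b d => // n IH a b d.
apply: (ndiffS (@Rhausdorff R)) (IH 0 (- d) b) => t.
apply/curve_derivative_real.
by apply: is_derive_eq; rewrite /GRing.scale /=; ring.
Qed.

(* A set of parameters is open if its pullbacks along the smooth
   reparametrizations with values in a given open set [O] are. *)
Lemma open_reparam (O P : set R) : open O ->
  (forall k : R -> R, smooth_curve k -> (forall s, O (k s)) ->
     open (k @^-1` P)) ->
  open (O `&` P).
Proof.
move=> oO h; rewrite openE => t0 [Ot Pt].
have /nbhs_ballP[e /= e0 eO] : nbhs t0 O by exact: open_nbhs_nbhs.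
pose r := e / 2; have r0 : 0 < r by rewrite /r divr_gt0.
pose k s := t0 + r * sin s + 0 * cos s.
have kO s : O (k s).
  apply: eO; rewrite /ball /= /k mul0r addr0 opprD addNKr normrN normrM.
  rewrite gtr0_norm// (le_lt_trans (y := r * 1))//.
    by rewrite ler_pM2l// ler_norml sin_geN1 sin_le1.
  by rewrite mulr1 /r ltr_pdivrMr// ltr_pMr// ltr1n.
have k0 : k 0 = t0 by rewrite /k sin0 mulr0 mul0r !addr0.
have := h k (smooth_sin _ _ _) kO; rewrite openE => /(_ 0).
rewrite /= k0 => /(_ Pt); rewrite /interior => nP.
pose j t := asin ((t - t0) / r).
have cj : j @ t0 --> (0 : R).
  have a0 : asin (0 : R) = 0.
    by rewrite -[X in asin X]sin0 sinK// in_itv/= oppr_le0 divr_ge0// pi_ge0.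
  have ca : {for (0 : R), continuous (@asin R)}.
    by apply: continuous_asin; rewrite oppr_lt0 ltr01.
  have c0 : (fun t : R => (t - t0) / r) @ t0 --> (0 : R).
    have : (fun t : R => (t - t0) / r) @ t0 --> (t0 - t0) / r.
      by apply: cvgMr_tmp; apply: cvgB; [exact: cvg_id|exact: cvg_cst].
    by rewrite subrr mul0r.
  by have := cvg_comp _ _ c0 ca; rewrite a0.
have nPj : nbhs t0 (fun t => P (k (j t))) by exact: cj nP.
apply: filterS (filterI nPj (nbhsx_ballx t0 r r0)) => t [Pk tr].
have kj : k (j t) = t.
  rewrite /k /j asinK ?mul0r ?addr0; first by rewrite mulrCA mulfV ?gt_eqF// mulr1 addrC subrK.
  rewrite in_itv/= -ler_norml normrM normfV (gtr0_norm r0) ler_pdivrMr// mul1r.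
  by move: tr; rewrite /ball /= distrC => /ltW.
split; last by move: Pk; rewrite kj.
by apply: eO; apply: lt_le_trans tr _; rewrite /r ler_pdivrMr// ler_pMr// ler1n.
Qed.

Section Reparam.
Context (M : Type) (u v w : chart R M).

Lemma local_repE (N : Type) (a : chart R M) (f : M -> N) (b : chart R N) p :
  is_chart a -> chart_dom a p -> chart_dom b (f p) ->
  local_rep a f b (chart_map a p) = chart_map b (f p).
Proof.
move=> [_ inj _] ap bp; rewrite /local_rep; case: xgetP => [y -> [q [aq _ qE ->]]|].
  by rewrite (inj q p).
by move=> /(_ (chart_map b (f p))); case; exists p.
Qed.

(* Compatibility through a chart [v] whose domain is the whole space. *)
Lemma smooth_change_trans :
  (forall p, chart_dom v p) -> is_chart u -> is_chart v -> is_chart w ->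
  smooth_change v w -> smooth_change u v -> smooth_change u w.
Proof.
move=> vT cu cv cw [ovw svw] [ouv suv].
have vwE x : chart_cod w x -> exists p, [/\ chart_dom w p, chart_map w p = x &
    local_rep w id v x = chart_map v p].
  by move=> [p wp <-]; exists p; split => //; rewrite local_repE.
have codE x : chart_cod w x <-> local_dom w id v x.
  by split=> [[p wp <-]|[p [wp _] <-]]; exists p.
have step c : smooth_curve c -> (forall t, chart_cod w (c t)) ->
    smooth_curve (local_rep w id v \o c).
  by move=> sc hc; apply: svw => // t; apply/codE.
have domE x : chart_cod w x ->
    local_dom w id u x <-> local_dom v id u (local_rep w id v x).
  move=> /vwE[p [wp px ->]]; split=> [[q [wq uq] qx]|[q [vq uq] qx]].
    have [_ inj _] := cw; have <- : q = p by apply: inj => //; rewrite qx px.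
    by exists q.
  have [_ inj _] := cv; have qp : q = p by apply: inj.
  by exists p => //; split=> //; rewrite -qp.
split.
- move=> c sc.
  have -> : c @^-1` local_dom w id u =
      (c @^-1` chart_cod w) `&` (c @^-1` local_dom w id u).
    by rewrite eqEsubset; split=> t //=; [move=> [p [wp up] <-]; split; exists p|case].
  apply: open_reparam => [|k sk hk]; first by case: cw => _ _; apply.
  have [[hE _] _ _] := cw.
  have sck : smooth_curve (c \o k) by exact: smooth_curve_comp.
  have -> : k @^-1` (c @^-1` local_dom w id u) =
      (local_rep w id v \o (c \o k)) @^-1` local_dom v id u.
    by rewrite eqEsubset; split=> s /= /(domE _ (hk s)).
  by apply: ouv; exact: step.
- move=> c sc hc.
  have cw' t : chart_cod w (c t) by have [p [wp _] <-] := hc t; exists p.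
  have -> : local_rep w id u \o c =
      local_rep v id u \o (local_rep w id v \o c).
    apply/funext => t /=; have [p [wp up] <-] := hc t.
    by rewrite !local_repE.
  by apply: suv; [exact: step|move=> t; exact/domE].
Qed.
End Reparam.

Lemma id_chart_is_chart (E : tvsType R) (hE : convenient E) :
  is_chart (id_chart E).
Proof.
split=> // c sc.
rewrite (_ : _ @^-1` _ = setT); first exact: openT.
by rewrite eqEsubset; split=> // t _; exists (c t).
Qed.

Lemma id_chart_change (E : tvsType R) (hE : convenient E) :
  smooth_change (id_chart E) (id_chart E).
Proof.
have ic := id_chart_is_chart hE; split.
  move=> c sc; rewrite (_ : _ @^-1` _ = setT); first exact: openT.
  by rewrite eqEsubset; split=> // t _; exists (c t).
move=> c sc _; rewrite (_ : _ \o c = c)//; apply/funext => t /=.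
by have := local_repE (f := id) (b := id_chart E) ic (p := c t) I I.
Qed.

Lemma id_chart_atlas (E : tvsType R) (hE : convenient E) :
  atlas (vs_charted E) (id_chart E).
Proof.
split; first exact: id_chart_is_chart.
by move=> _ <-; split; exact: id_chart_change.
Qed.

Lemma vs_manifold_subproof (E : tvsType R) (hE : convenient E) :
  is_manifold (vs_charted E).
Proof.
have ic := id_chart_is_chart hE.
split.
- by move=> u [].
- by move=> p; exists (id_chart E) => //; exact: id_chart_atlas.
- move=> u v [cu /(_ _ erefl)[iu ui]] [cv /(_ _ erefl)[iv vi]].
  by split; apply: (@smooth_change_trans _ _ (id_chart E)).
- move=> w [cw hw]; split=> // _ <-; apply: hw; exact: id_chart_atlas.
Qed.

Lemma hausdorff_prod (E F : tvsType R) :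
  hausdorff_space E -> hausdorff_space F -> hausdorff_space (E * F)%type.
Proof.
move=> hE hF [x y] [x' y'] h; congr (_, _).
  apply: hE => A B hA hB.
  have nA : nbhs (x, y) [set p | A p.1] by apply: (@cvg_fst _ _ (nbhs x) (nbhs y)) hA.
  have nB : nbhs (x', y') [set p | B p.1] by apply: (@cvg_fst _ _ (nbhs x') (nbhs y')) hB.
  by have [[z t] [/= Az Bz]] := h _ _ nA nB; exists z.
apply: hF => A B hA hB.
have nA : nbhs (x, y) [set p | A p.2] by apply: (@cvg_snd _ _ (nbhs x) (nbhs y)) hA.
have nB : nbhs (x', y') [set p | B p.2] by apply: (@cvg_snd _ _ (nbhs x') (nbhs y')) hB.
by have [[z t] [/= Az Bz]] := h _ _ nA nB; exists t.
Qed.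

Lemma ndiff_prod (E F : tvsType R) n (c : R -> E * F) :
  hausdorff_space E -> hausdorff_space F ->
  ndiff n c -> ndiff n (fst \o c) /\ ndiff n (snd \o c).
Proof.
move=> hE hF; elim: n c => // n IH c [dc /IH[h1 h2]].
have dP t : curve_derivative (fst \o c) t (tderive c (1 : R) t).1 /\
            curve_derivative (snd \o c) t (tderive c (1 : R) t).2.
  have /curve_derivativeP[Q [Ql Q0 cE]] := tderive_curve (dc t).
  split; apply/curve_derivativeP.
    exists (fst \o Q); split=> /=; [|by rewrite Q0|by move=> h; rewrite cE].
    exact: cvg_comp Ql (@cvg_fst _ _ (nbhs _.1) (nbhs _.2) _).
  exists (snd \o Q); split=> /=; [|by rewrite Q0|by move=> h; rewrite cE].
  exact: cvg_comp Ql (@cvg_snd _ _ (nbhs _.1) (nbhs _.2) _).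
by split; [apply: (ndiffS hE) h1|apply: (ndiffS hF) h2] => t; case: (dP t).
Qed.

Lemma convenient_prod (E F : tvsType R) :
  convenient E -> convenient F -> convenient (E * F)%type.
Proof.
move=> [hE cE] [hF cF]; split; first exact: hausdorff_prod.
move=> c /smooth_curveP sc a b ab.
have [|I1 h1] := cE (fst \o c) _ a b ab.
  by apply/smooth_curveP => n; have [] := ndiff_prod hE hF (sc n).
have [|I2 h2] := cF (snd \o c) _ a b ab.
  by apply/smooth_curveP => n; have [] := ndiff_prod hE hF (sc n).
exists (I1, I2) => W [[W1 W2] /= [n1 n2] sW].
have [d1 d10 H1] := h1 _ n1; have [d2 d20 H2] := h2 _ n2.
exists (Num.min d1 d2); first by rewrite lt_min d10.
move=> n x xi xa xb xxi xd; apply: sW; split=> /=.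
  rewrite (big_morph fst (id1 := 0) (op1 := +%R))//.
  by apply: H1 => // i /xd; rewrite lt_min => /andP[].
rewrite (big_morph snd (id1 := 0) (op1 := +%R))//.
by apply: H2 => // i /xd; rewrite lt_min => /andP[].
Qed.

Lemma smooth_curve_real (c : R -> R) : smooth_curve c ->
  exists c' : R -> R, (forall t, is_derive t (1 : R) c (c' t)) /\ continuous c'.
Proof.
move=> sc; exists (tderive c (1 : R)); split=> t.
  exact/curve_derivative_real/tderive_curve/(sc t 0%N).
have /tderive_curve/curve_derivative_real[dc _] := sc t 1%N.
by apply: differentiable_continuous; exact/derivable1_diffP.
Qed.

Lemma primitive_real (c : R -> R) (a b : R) : continuous c ->
  exists F : R -> R,
    forall x, a < x < b -> is_derive x (1 : R) F (c x).
Proof.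
move=> cc; exists (fun x => \int[lebesgue_measure]_(t in `[a, x]) c t)%R.
move=> x /andP[ax xb].
have [|dF FE] := @continuous_FTC1_closed R c a x b xb _ ax (cc x).
  apply: continuous_compact_integrable; first exact: segment_compact.
  exact: continuous_subspaceT.
by split; rewrite // -derive1E.
Qed.

Lemma convenient_R : convenient (R : tvsType R).
Proof.
split; first exact: Rhausdorff.
move=> c sc a b ab; have [c' [dc cc']] := smooth_curve_real sc.
have cc : continuous c.
  move=> t; apply: differentiable_continuous; apply/derivable1_diffP.
  by case: (dc t).
have [F dF] := primitive_real (a - 1) (b + 1) cc.
have [M M0 cM] : exists2 M, 0 < M & forall t, a <= t <= b -> `|c' t| <= M.
  have [|t0 _ ht0] := @EVT_max R (fun t => `|c' t|) a b ab.
    apply: continuous_subspaceT => t; apply: cvg_norm; exact: cc'.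
  exists (`|c' t0| + 1); first by rewrite ltr_wpDl.
  by move=> t tab; rewrite (le_trans (ht0 t _)) ?in_itv// lerDl.
have lip s t : a <= s -> s <= t -> t <= b -> `|c t - c s| <= M * (t - s).
  move=> sa st tb.
  have ccst : {within `[s, t], continuous c} by exact: continuous_subspaceT.
  have [z + ->] := MVT_segment st (fun z _ => dc z) ccst.
  rewrite in_itv/= => /andP[sz zt]; rewrite normrM (@ger0_norm _ (t - s)) ?subr_ge0//.
  by rewrite ler_wpM2r ?subr_ge0// cM// (le_trans sa sz) (le_trans zt tb).
exists (F b - F a) => W /nbhs_ballP[e /= e0 eW].
pose L := M * (b - a) + 1.
have L0 : 0 < L by rewrite ltr_wpDl// mulr_ge0 ?subr_ge0// ltW.
exists (e / L); first exact: divr_gt0.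
move=> n x xi xa xb xxi xd; apply: eW.
have step i : (i < n)%N -> x i <= x i.+1.
  by move=> /xxi /andP[]; exact: le_trans.
have xlo i : (i <= n)%N -> a <= x i.
  elim: i => [|i IH] h; first by rewrite xa.
  by apply: le_trans (step _ h); exact/IH/ltnW.
have xhi i : (i <= n)%N -> x i <= b.
  move=> h; rewrite -xb -(subKn h); elim: (n - i)%N (leq_subr i n) => [|k IH] hk.
    by rewrite subn0.
  apply: le_trans (IH (ltnW hk)); rewrite -(subnSK hk); apply: step.
  by rewrite subnSK// leq_subr.
have key i : (i < n)%N -> `|(F (x i.+1) - F (x i)) - (x i.+1 - x i) * c (xi i)|
    <= e / L * M * (x i.+1 - x i).
  move=> hi; have xii := step i hi; have lo := xlo i (ltnW hi).
  have hi' := xhi i.+1 hi; have /andP[l1 l2] := xxi i hi.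
  have dFin z : x i <= z <= x i.+1 -> is_derive z (1 : R) F (c z).
    move=> /andP[z1 z2]; apply: dF; rewrite (lt_le_trans (y := a)) ?(le_trans lo z1)//=.
      by rewrite (le_lt_trans (y := b)) ?(le_trans z2 hi')// ltrDl.
    by rewrite ltrBlDr ltrDl.
  have dFoo z : z \in `]x i, x i.+1[ -> is_derive z (1 : R) F (c z).
    by rewrite in_itv/= => /andP[z1 z2]; apply: dFin; rewrite !ltW.
  have cF : {within `[x i, x i.+1], continuous F}.
    apply: derivable_within_continuous => z; rewrite in_itv/= => zx.
    by case: (dFin z zx).
  have [z + ->] := MVT_segment xii dFoo cF.
  rewrite in_itv/= => /andP[z1 z2].
  rewrite [c z * _]mulrC -mulrBr normrM (@ger0_norm _ (x i.+1 - x i)) ?subr_ge0//.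
  rewrite [leRHS]mulrC ler_wpM2l ?subr_ge0//.
  have : `|c z - c (xi i)| <= M * (x i.+1 - x i).
    have [h|/ltW h] := leP (xi i) z.
      apply: le_trans (lip (xi i) z _ h _) _; rewrite ?(le_trans lo l1)// ?(le_trans z2 hi')//.
      by rewrite ler_wpM2l ?(ltW M0)//; lra.
    rewrite distrC; apply: le_trans (lip z (xi i) _ h _) _; rewrite ?(le_trans lo z1)// ?(le_trans l2 hi')//.
    by rewrite ler_wpM2l ?(ltW M0)//; lra.
  move=> /le_trans; apply; rewrite mulrC ler_wpM2r ?(ltW M0)// ltW//; exact: xd.
rewrite /ball /=.
have -> : F b - F a = \sum_(i < n) (F (x i.+1) - F (x i)).
  by rewrite -(big_mkord xpredT (fun i => F (x i.+1) - F (x i))) telescope_sumr// xa xb.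
have -> : \sum_(i < n) (x i.+1 - x i) *: c (xi i) =
    \sum_(i < n) (x i.+1 - x i) * c (xi i) by [].
rewrite -sumrB; apply: le_lt_trans (ler_norm_sum _ _ _) _.
apply: (@le_lt_trans _ _ (\sum_(i < n) e / L * M * (x i.+1 - x i))).
  by apply: ler_sum => i _; exact: key.
rewrite -mulr_sumr -(big_mkord xpredT (fun i => x i.+1 - x i)) telescope_sumr// xa xb.
rewrite -mulrA mulrAC ltr_pdivrMr// ltr_pM2l// /L; lra.
Qed.
End SmoothCurves.

Definition vs_manifold (R : realType) (E : tvsType R) (hE : convenient E) :
    manifold R :=
  Manifold (vs_manifold_subproof hE).

Definition line (R : realType) : manifold R := vs_manifold (convenient_R R).

Definition plane (R : realType) : manifold R :=
  vs_manifold (convenient_prod (convenient_R R) (convenient_R R)).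

Definition plane_fst (R : realType) : plane R -> line R := fun z : R * R => z.1.
Definition plane_snd (R : realType) : plane R -> line R := fun z : R * R => z.2.
Definition line_add (R : realType) : plane R -> line R :=
  fun z : R * R => z.1 + z.2.
Definition line_mul (R : realType) : plane R -> line R :=
  fun z : R * R => z.1 * z.2.
Definition line_scale (R : realType) (t : R) : line R -> line R :=
  fun x : R => t * x.

HB.mixin Record isWeilAlgebra (R : fieldType) A
    & GRing.ComAlgebra R A & Vector R A := {
  weil_nil : {vspace A};
  weil_nil_ideal : forall a n : A, n \in weil_nil -> a * n \in weil_nil;
  weil_nil_nilpotent : forall n : A, n \in weil_nil -> exists k, n ^+ k = 0;
  weil_nil_sum : (<[1%R : A]> + weil_nil)%VS = fullv;
  weil_nil_cap : (<[1%R : A]> :&: weil_nil)%VS = 0%VS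
}.

#[short(type="weilAlgType")]
HB.structure Definition WeilAlgebra (R : fieldType) :=
  {A of isWeilAlgebra R A & GRing.ComAlgebra R A & Vector R A}.

Section WeilTensor.
Context (R : realType).
Implicit Types (A B : weilAlgType R) (E F : tvsType R).

Definition weil_dim A : nat := \dim (weil_nil : {vspace A}).

Definition weil_gen A (j : 'I_(weil_dim A)) : A := (vbasis weil_nil)`_j.

(* The basis [1, n_0, ..., n_(d-1)] of [A], where the [n_j] are a basis of the
   ideal of nilpotent elements. *)
Definition weil_basis A : (weil_dim A).+1.-tuple A :=
  [tuple of 1 :: vbasis weil_nil].

Definition weil_pi A (a : A) : R := coord (weil_basis A) ord0 a.

(* [A \otimes E], as the space of coefficients in [E] with respect to
   [weil_basis A], with the product topology. *)
Definition weil_tensor A E := {ptws 'I_(weil_dim A).+1 -> E}.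

HB.instance Definition _ A E := Uniform.on (weil_tensor A E).
HB.instance Definition _ A E := GRing.Lmodule.on (weil_tensor A E).

Lemma weil_tensor_cvg A E (T : Type) (F : set_system T) {FF : Filter F}
    (f : T -> weil_tensor A E) (l : weil_tensor A E) :
  (forall i, (fun x => f x i) @ F --> l i) -> f @ F --> l.
Proof.
move=> h; apply/cvg_sup => i; apply/cvg_image.
  rewrite eqEsubset; split => y //= _.
  by exists (fun _ => y).
move=> Q /= /h hQ; exists (fun w : weil_tensor A E => Q (w i)) => //.
rewrite eqEsubset; split=> [y [w Qw <-]//|y Qy].
by exists (fun _ => y).
Qed.

Lemma weil_tensor_nbhs A E (w : weil_tensor A E) (U : set (weil_tensor A E)) :
  nbhs w U -> exists2 V : 'I_(weil_dim A).+1 -> set E,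
    (forall i, nbhs (w i) (V i)) & [set x | forall i, V i (x i)] `<=` U.
Proof.
pose D := [set V : 'I_(weil_dim A).+1 -> set E | forall i, nbhs (w i) (V i)].
pose B (V : 'I_(weil_dim A).+1 -> set E) := [set x : weil_tensor A E | forall i, V i (x i)].
have FF : Filter (filter_from D B).
  apply: filter_from_filter.
    by exists (fun _ => setT) => i; exact: filterT.
  move=> V V' hV hV'; exists (fun i => V i `&` V' i).
    by move=> i; apply: filterI; [exact: hV|exact: hV'].
  by move=> x h; split=> i; case: (h i).
have : id @ filter_from D B --> w.
  apply: weil_tensor_cvg => i Q hQ.
  exists (fun j => if j == i then Q else setT).
    by move=> j; case: eqP => [->//|_]; exact: filterT.
  by move=> x /(_ i); rewrite eqxx.
by move=> h /h [V hV sV]; exists V.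
Qed.

Lemma weil_tensor_nbhs_prod A E (w : weil_tensor A E)
    (V : 'I_(weil_dim A).+1 -> set E) :
  (forall i, nbhs (w i) (V i)) ->
  nbhs w [set x : weil_tensor A E | forall i, V i (x i)].
Proof.
move=> h.
have -> : [set x : weil_tensor A E | forall i, V i (x i)] =
    \bigcap_(i in [set` [fset k | k in 'I_(weil_dim A).+1]%fset]) [set x : weil_tensor A E | V i (x i)].
  by rewrite eqEsubset; split=> x hx i; [by move=> _; exact: hx|apply: hx; rewrite /= !inE].
apply: filter_bigI => i _.
have := @proj_continuous _ (fun=> E) i w (V i) (h i).
by [].
Qed.

Lemma weil_tensor_add_continuous A E :
  continuous (fun x : weil_tensor A E * weil_tensor A E => x.1 + x.2).
Proof.
move=> x; apply: weil_tensor_cvg => i.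
have pc := @proj_continuous _ (fun=> E) i.
apply: (@continuous_comp _ _ _ (fun y : weil_tensor A E * weil_tensor A E => (y.1 i, y.2 i)) (fun z : E * E => z.1 + z.2)).
  apply: cvg_pair.
    apply: (@continuous_comp _ _ _ fst (fun y : weil_tensor A E => y i)); [exact: cvg_fst|exact: pc].
  apply: (@continuous_comp _ _ _ snd (fun y : weil_tensor A E => y i)); [exact: cvg_snd|exact: pc].
exact: add_continuous.
Qed.

Lemma weil_tensor_scale_continuous A E :
  continuous (fun z : R^o * weil_tensor A E => z.1 *: z.2).
Proof.
move=> x; apply: weil_tensor_cvg => i.
have pc := @proj_continuous _ (fun=> E) i.
apply: (@continuous_comp _ _ _ (fun y : R^o * weil_tensor A E => (y.1, y.2 i)) (fun z : R^o * E => z.1 *: z.2)).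
  apply: (@cvg_pair _ _ _ _ (nbhs (x.1 : R^o)) (nbhs (x.2 i))); first exact: cvg_fst.
  apply: (@continuous_comp _ _ _ snd (fun y : weil_tensor A E => y i)); [exact: cvg_snd|exact: pc].
exact: scale_continuous.
Qed.

Lemma weil_tensor_locally_convex A E :
  exists2 B : set_system (weil_tensor A E),
    (forall b, b \in B -> convex_set b) & basis B.
Proof.
have [C Cconv [Copen Cbasis]] := @locally_convex R E.
pose P (V : 'I_(weil_dim A).+1 -> set E) := [set x : weil_tensor A E | forall i, V i (x i)].
exists [set b | exists2 V, (forall i, C (V i)) & b = P V].
  move=> b /set_mem[V CV ->] x y l /set_mem hx /set_mem hy; apply/mem_set => i.
  by apply/set_mem/(Cconv (V i) (mem_set (CV i)) (x i) (y i) l); apply: mem_set;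
    [exact: hx|exact: hy].
split.
  move=> b [V CV ->]; rewrite openE => x hx.
  apply: weil_tensor_nbhs_prod => i; apply: open_nbhs_nbhs; split; last exact: hx.
  exact: Copen.
move=> x U /weil_tensor_nbhs[V hV sU].
have /choice[W hW] : forall i, exists W : set E, [/\ C W, W (x i) & W `<=` V i].
  by move=> i; have [W [CW Wx] WV] := Cbasis _ _ (hV i); exists W.
exists (P W).
  split; first by exists W => // i; case: (hW i).
  by move=> i; case: (hW i).
by move=> y hy; apply: sU => i; case: (hW i) => _ _; apply.
Qed.
HB.instance Definition _ A E :=
  PreTopologicalNmodule_isTopologicalNmodule.Build (weil_tensor A E)
    (@weil_tensor_add_continuous A E).
HB.instance Definition _ A E :=
  TopologicalNmodule_isTopologicalLmodule.Build R (weil_tensor A E)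
    (@weil_tensor_scale_continuous A E).
HB.instance Definition _ A E :=
  Uniform_isTvs.Build R (weil_tensor A E) (@weil_tensor_locally_convex A E).

Definition tensor A E (a : A) (y : E) : weil_tensor A E :=
  fun i => coord (weil_basis A) i a *: y.

Definition tensor_map A B (psi : A -> B) E (w : weil_tensor A E) :
    weil_tensor B E :=
  \sum_(i < (weil_dim A).+1) tensor (psi (weil_basis A)`_i) (w i).

(* [pi \otimes E], with values in [E] identified with [R \otimes E]. *)
Definition tensor_pi A E (w : weil_tensor A E) : E :=
  \sum_(i < (weil_dim A).+1) weil_pi (weil_basis A)`_i *: w i.

(* [T_A f] for a map [f] between open subsets. A product of more than
   [dim N] elements of the nilpotent ideal [N] vanishes, so that the sum over
   all [k >= 1] stops at [k = weil_dim A]. *)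
Definition weil_map A E F (f : E -> F) (w : weil_tensor A E) :
    weil_tensor A F :=
  tensor (1 : A) (f (w ord0)) +
  \sum_(1 <= k < (weil_dim A).+1) (k`!%:R)^-1 *:
    \sum_(j : k.-tuple 'I_(weil_dim A))
      tensor (\prod_(i <- j) weil_gen i)
        (tderives f [seq w (lift ord0 i) | i <- j] (w ord0)).

Lemma weil_basis_free A : free (weil_basis A).
Proof.
rewrite /= free_cons (basis_free (vbasisP _)) andbT (span_basis (vbasisP _)).
apply/negP => n1.
have : (1 : A) \in (<[1%R : A]> :&: weil_nil)%VS by rewrite memv_cap memv_line.
by rewrite weil_nil_cap memv0 oner_eq0.
Qed.

Lemma weil_basis_full A : (<<weil_basis A>> = fullv)%VS.
Proof. by rewrite /= span_cons (span_basis (vbasisP _)) weil_nil_sum. Qed.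

Lemma weil_pi_basis A (i : 'I_(weil_dim A).+1) :
  weil_pi (weil_basis A)`_i = (i == ord0)%:R.
Proof. by rewrite /weil_pi coord_free ?weil_basis_free// eq_sym. Qed.

Lemma weil_piD A : {morph @weil_pi A : a b / a + b}.
Proof. by move=> a b; rewrite /weil_pi linearD. Qed.

Lemma weil_piZ A t (a : A) : weil_pi (t *: a) = t * weil_pi a.
Proof. by rewrite /weil_pi linearZ. Qed.

Lemma weil_pi1 A : weil_pi (1 : A) = 1.
Proof. by have := weil_pi_basis (ord0 : 'I_(weil_dim A).+1). Qed.

Lemma weil_pi_nil A (n : A) : n \in weil_nil -> weil_pi n = 0.
Proof.
move=> /coord_vbasis ->; rewrite /weil_pi linear_sum big1// => j _.
rewrite linearZ /= (_ : (vbasis weil_nil)`_j = (weil_basis A)`_(lift ord0 j))//.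
by rewrite (coord_free _ _ (weil_basis_free A)) /= mulr0.
Qed.

Lemma weil_decomp A (a : A) :
  exists2 n, n \in weil_nil & a = weil_pi a *: 1 + n.
Proof.
have : a \in (<[1%R : A]> + weil_nil)%VS by rewrite weil_nil_sum memvf.
move=> /memv_addP[_ /vlineP[t ->] [n nN ->]]; exists n => //.
by rewrite weil_piD weil_piZ weil_pi1 (weil_pi_nil nN) addr0 mulr1.
Qed.

Lemma weil_piM A : {morph @weil_pi A : a b / a * b}.
Proof.
move=> a b; have [n nN ->] := weil_decomp a; have [m mN ->] := weil_decomp b.
move: (weil_pi a) (weil_pi b) => s t.
rewrite mulrDr mulrDl -!scalerAl !mul1r -!scalerAr mulr1 scalerA -addrA.
rewrite !weil_piD !weil_piZ !weil_pi1 !(weil_pi_nil nN) (weil_pi_nil mN).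
rewrite (weil_pi_nil (weil_nil_ideal _ _ mN)) !(mulr0, addr0, mulr1).
by rewrite mulrC.
Qed.

Lemma weil_pi_nilpotent A (a : A) k : a ^+ k = 0 -> weil_pi a = 0.
Proof.
have weil_piX : weil_pi (a ^+ k) = weil_pi a ^+ k.
  by elim: k => [|k IH]; rewrite ?expr0 ?weil_pi1// !exprS weil_piM IH.
move=> ak0; move: weil_piX; rewrite ak0 weil_pi_nil ?mem0v// => /esym/eqP.
by rewrite expf_eq0 => /andP[_ /eqP].
Qed.

Lemma weil_pi_morph A B (psi : {lrmorphism A -> B}) (a : A) :
  weil_pi (psi a) = weil_pi a.
Proof.
have [n nN {1}->] := weil_decomp a.
have [k nk] := weil_nil_nilpotent _ nN.
have pn0 : weil_pi (psi n) = 0.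
  by apply: (@weil_pi_nilpotent _ _ k); rewrite -rmorphXn nk rmorph0.
have -> : psi (weil_pi a *: 1 + n) = weil_pi a *: 1 + psi n.
  by rewrite linearD linearZ (rmorph1 psi).
by rewrite weil_piD weil_piZ weil_pi1 mulr1 pn0 addr0.
Qed.

Lemma weil_tensor_sumE A E (I : Type) (r : seq I) (P : pred I)
    (F : I -> weil_tensor A E) i :
  (\sum_(k <- r | P k) F k) i = \sum_(k <- r | P k) F k i.
Proof.
exact: (big_morph (fun w : weil_tensor A E => w i) (id1 := 0) (op1 := +%R)).
Qed.

Lemma tensor_piE A E (w : weil_tensor A E) : tensor_pi w = w ord0.
Proof.
rewrite /tensor_pi (bigD1 ord0)//= big1 ?addr0 => [|i /negbTE i0].
  by rewrite (weil_pi_basis ord0) scale1r.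
by rewrite weil_pi_basis i0 scale0r.
Qed.

Lemma weil_gen_prod A k (j : k.+1.-tuple 'I_(weil_dim A)) :
  \prod_(i <- j) weil_gen i \in weil_nil.
Proof.
case: j => -[//|i s] _ /=; rewrite big_cons mulrC weil_nil_ideal//.
by rewrite vbasis_mem// mem_nth// size_tuple.
Qed.

Lemma tensor_pi_weil_map A E F (f : E -> F) (w : weil_tensor A E) :
  tensor_pi (weil_map f w) = f (tensor_pi w).
Proof.
rewrite !tensor_piE /weil_map.
rewrite -[LHS]/(_ ord0 + _ ord0) weil_tensor_sumE big_nat_cond big1 => [|k].
  by rewrite addr0 -[LHS]/(weil_pi 1 *: _) weil_pi1 scale1r.
rewrite andbT => /andP[k0 _]; rewrite -[LHS]/(_ *: _ ord0).
rewrite weil_tensor_sumE big1 ?scaler0// => j _.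
rewrite -[LHS]/(weil_pi _ *: _) weil_pi_nil ?scale0r//.
by case: k k0 j => // k _ j; exact: weil_gen_prod.
Qed.

Lemma tensor_pi_map A B (psi : {lrmorphism A -> B}) E (w : weil_tensor A E) :
  tensor_pi (tensor_map psi w) = tensor_pi w.
Proof.
rewrite tensor_piE /tensor_map weil_tensor_sumE; apply: eq_bigr => i _.
by rewrite -[LHS]/(weil_pi _ *: _) weil_pi_morph.
Qed.

End WeilTensor.

Section WeilFunctor.
Context (R : realType).
Implicit Types (A B : weilAlgType R) (M N : chartedSet R).

(* The disjoint union of the sets [T_A (u (U))], for the charts [(U, u)]. *)
Record weil_point A M := WeilPoint {
  wp_chart : chart R M;
  wp_atlas : atlas M wp_chart;
  wp_vec : weil_tensor A (chart_model wp_chart);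
  wp_dom : chart_cod wp_chart (tensor_pi wp_vec)
}.

Definition weil_glue A M (p q : weil_point A M) : Prop :=
  local_dom (wp_chart q) id (wp_chart p) (tensor_pi (wp_vec q)) /\
  wp_vec p = weil_map (local_rep (wp_chart q) id (wp_chart p)) (wp_vec q).

(* The points of [T_A M] are the classes of the equivalence relation generated
   by the gluing maps [T_A (u_alpha \o u_beta^-1)]. *)
Definition weil_class A M (p : weil_point A M) : weil_point A M -> Prop :=
  clos_refl_sym_trans _ (@weil_glue A M) p.

Definition weil_carrier A M : Type :=
  {S : weil_point A M -> Prop | exists p, S = weil_class p}.

Definition weil_in A M (p : weil_point A M) : weil_carrier A M :=
  exist _ (weil_class p) (ex_intro _ p erefl).

(* The chart [T_A u : T_A U -> T_A (u (U))] of [T_A M]. *)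
Definition weil_chart A M (u : chart R M) (hu : atlas M u) :
    chart R (weil_carrier A M) :=
  @Chart R (weil_carrier A M) (weil_tensor A (chart_model u))
    (fun p => exists w h, p = weil_in (@WeilPoint A M u hu w h))
    (fun p => xget 0 [set w | exists h, p = weil_in (@WeilPoint A M u hu w h)]).

(* [T_A M], as a set with charts: the axioms of a manifold are not needed to
   speak of smooth maps between such sets. *)
Definition weil_functor A M : chartedSet R :=
  @ChartedSet R (weil_carrier A M)
    (maximal_atlas (fun u => exists v (hv : atlas M v), u = weil_chart A hv)).

(* [T_A f] sends the class of a point of [T_A (u (U))] to the class of its image
   under [T_A (v \o f \o u^-1)], for any chart [v] around the image of its base
   point. *)
Definition weil_fmap_rel A M N (f : M -> N)
    (p : weil_functor A M) (q : weil_functor A N) : Prop :=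
  exists x y, [/\ p = weil_in x, q = weil_in y,
    local_dom (wp_chart x) f (wp_chart y) (tensor_pi (wp_vec x)) &
    wp_vec y = weil_map (local_rep (wp_chart x) f (wp_chart y)) (wp_vec x)].

Lemma weil_in_ex A M (p : weil_carrier A M) : exists x, p = weil_in x.
Proof. by case: p => S [x Sx]; exists x; apply: eq_exist. Qed.

Lemma weil_fmap_rel_ex A M (N : manifold R) (f : M -> N)
    (p : weil_functor A M) : exists q, weil_fmap_rel f p q.
Proof.
have [x ->] := weil_in_ex p; have [m um mx] := wp_dom x.
have [_ /(_ (f m))[v hv vm] _ _] := manifoldP N.
have h : chart_cod v
    (tensor_pi (weil_map (local_rep (wp_chart x) f v) (wp_vec x))).
  rewrite tensor_pi_weil_map /local_rep; case: xgetP => [y -> [q [_ vq _ ->]]|].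
    by exists (f q).
  by move=> /(_ (chart_map v (f m))); case; exists m.
exists (weil_in (WeilPoint hv h)), x, (WeilPoint hv h); split => //.
by exists m.
Qed.

Definition weil_fmap A M (N : manifold R) (f : M -> N) (p : weil_functor A M) :
    weil_functor A N :=
  projT1 (cid (weil_fmap_rel_ex f p)).

Lemma weil_point_map_subproof A B (psi : {lrmorphism A -> B}) M
    (p : weil_point A M) :
  chart_cod (wp_chart p) (tensor_pi (tensor_map psi (wp_vec p))).
Proof. by rewrite tensor_pi_map; exact: wp_dom. Qed.

Definition weil_point_map A B (psi : {lrmorphism A -> B}) M
    (p : weil_point A M) : weil_point B M :=
  WeilPoint (wp_atlas p) (weil_point_map_subproof psi p).

(* [T (psi, M)], induced by [psi \otimes E] in each chart. *)
Definition weil_trans A B (psi : {lrmorphism A -> B}) M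
    (p : weil_functor A M) : weil_functor B M :=
  weil_in (weil_point_map psi (projT1 (cid (svalP p)))).

Definition weil_natural A B
    (phi : forall M : manifold R, weil_functor A M -> weil_functor B M) :
    Prop :=
  (forall M : manifold R, msmooth (@phi M)) /\
  (forall (M N : manifold R) (f : M -> N), msmooth f ->
     forall p : weil_functor A M,
       phi N (weil_fmap f p) = weil_fmap f (phi M p)).

Lemma id_chart_codT (E : tvsType R) (x : E) : chart_cod (id_chart E) x.
Proof. by exists x. Qed.

(* The identification [A = A \otimes R = T_A (R)]. *)
Definition weil_line A (a : A) : weil_functor A (line R) :=
  weil_in (@WeilPoint A (line R) (id_chart (R : tvsType R))
    (id_chart_atlas (convenient_R R)) (tensor a (1 : R)) (id_chart_codT _)).

Definition weil_unline A (p : weil_functor A (line R)) : A :=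
  xget 0 [set a | weil_line a = p].

(* The value [phi_R : A -> B] of a natural transformation. *)
Definition weil_at_line A B
    (phi : forall M : manifold R, weil_functor A M -> weil_functor B M)
    (a : A) : B :=
  weil_unline (phi (line R) (weil_line a)).

End WeilFunctor.

(* Main.v *)
Require Import Defs.
From HB Require Import structures.
From mathcomp Require Import all_boot all_order all_algebra.
From mathcomp Require Import all_classical all_reals all_analysis.
From mathcomp Require Import ring lra.
From Stdlib Require Import Relation_Operators.
Import numFieldNormedType.Exports.
Set Implicit Arguments.
Unset Strict Implicit.
Unset Printing Implicit Defensive.
Import Order.TTheory GRing.Theory Num.Theory.
Local Open Scope classical_set_scope.
Local Open Scope ring_scope.

(* The value [weil_at_line phi] is a homomorphism because [phi] commutes with
   [T_A] of the addition, the multiplication, the multiplications by scalars and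
   a constant map, and [T_A (R * R) = T_A R * T_A R]. It determines [phi]: a
   point [\sum_i n_i \otimes x_i] of [T_A M], in a chart, is the image under
   [T_A gamma] of the point [\sum_j n_j \otimes delta_j] of [T_A (R^d)], where
   [gamma] is the map [r |-> x_0 + \sum_j r_j x_j], with the coordinates [r_j]
   cut off so as to stay in the chart, and a point of [T_A (R^d)] is determined
   by its images under the coordinate functions.

   That [T_A] is a functor and [psi \otimes E] natural rests on the chain rule
   for smooth maps, which is developed from curves alone. A map [H] of two
   variables that is smooth along all smooth curves of the plane has locally
   bounded derivatives with respect to the first variable, since otherwise a
   single smooth curve would run through a sequence of counterexamples; finite
   differences then show that these derivatives depend smoothly on the second
   variable. For the equality [T (f \o g) = T f \o T g] at
   [w = 1 \otimes x + n], one differentiates the difference of the two sides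
   along [t |-> 1 \otimes x + t n]: the derivative is a combination of similar
   differences multiplied by elements of the nilpotent ideal, and therefore
   vanishes by downward induction on the number of nilpotent factors. *)

(** * Linear identities in modules *)

(** Smoothness is tested by curves only, and a smooth map need not be continuous for the locally
    convex topology, so remainder estimates for [f] on neighbourhoods in [E] are out of reach. Every
    statement about [f] is therefore pulled back to a map of the line or the plane, whose values are
    measured by continuous seminorms. A c-infinity-open set contains small boxes around its points,
    again by a smooth curve through counterexamples, and cutoff functions extend such a local
    pullback to the whole plane without changing its germ at the origin. Linearity and symmetry of
    directional derivatives and the chain rule then become facts about plane maps, mostly about
    their diagonals.

    Functoriality alone does not carry the induction: differentiating [f \o g] produces terms in
    which [f] is already differentiated along fields of vectors [h_i]. The induction is therefore
    stated for all these terms at once, and compares them with the iterated derivatives of [T f].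
    That those derivatives have the same shape as [T f] depends on the Taylor sum being cut exactly
    where the products of nilpotent elements vanish. *)

Section LmodReflection.
Context (R : comNzRingType) (V : lmodType R).

(** Reified module terms over a list of atoms. Two terms agree as soon as every atom has the same
    coefficient in both, so that an identity in a module becomes finitely many identities in the
    ring of scalars. *)
Inductive lin_expr :=
| LinVar of nat
| LinZero
| LinAdd of lin_expr & lin_expr
| LinOpp of lin_expr
| LinScale of R & lin_expr.

Fixpoint lin_eval (env : seq V) (e : lin_expr) : V :=
  match e with
  | LinVar n => nth 0 env n
  | LinZero => 0
  | LinAdd a b => lin_eval env a + lin_eval env b
  | LinOpp a => - lin_eval env a
  | LinScale k a => k *: lin_eval env a
  end.

Fixpoint lin_coef (e : lin_expr) (n : nat) : R :=
  match e with
  | LinVar m => if eqn m n then 1 else 0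
  | LinZero => 0
  | LinAdd a b => lin_coef a n + lin_coef b n
  | LinOpp a => - lin_coef a n
  | LinScale k a => k * lin_coef a n
  end.

Lemma lin_evalE env e :
  lin_eval env e = \sum_(n < size env) lin_coef e n *: nth 0 env n.
Proof.
elim: e => /= [m||a -> b ->|a ->|k a ->].
- have [mlt|mge] := ltnP m (size env).
    rewrite (bigD1 (Ordinal mlt))//= eqnE eqxx scale1r big1 ?addr0// => i /eqP iN.
    case: eqP => [e|_]; last by rewrite scale0r.
    by case: iN; apply: val_inj.
  rewrite nth_default// big1// => i _; rewrite eqnE.
  case: eqP => [e|_]; last by rewrite scale0r.
  by move: (ltn_ord i); rewrite -e ltnNge mge.
- by rewrite big1// => i _; rewrite scale0r.
- by rewrite -big_split; apply: eq_bigr => i _; rewrite scalerDl.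
- by rewrite -sumrN; apply: eq_bigr => i _; rewrite scaleNr.
- by rewrite scaler_sumr; apply: eq_bigr => i _; rewrite scalerA.
Qed.

Fixpoint lin_check (a b : lin_expr) (n : nat) : Prop :=
  if n is n'.+1 then lin_coef a n' = lin_coef b n' /\ lin_check a b n' else True.

Lemma lin_eq env a b : lin_check a b (size env) -> lin_eval env a = lin_eval env b.
Proof.
move=> h; rewrite !lin_evalE; apply: eq_bigr => i _; congr (_ *: _).
elim: (size env) h (i : nat) (ltn_ord i) => //= n IH [e /IH h] j.
by rewrite ltnS leq_eqVlt => /orP[/eqP->//|/h].
Qed.
End LmodReflection.

Ltac lin_index x env :=
  lazymatch env with
  | nil => fail
  | x :: _ => constr:(O)
  | _ :: ?env' => let n := lin_index x env' in constr:(S n)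
  end.

Ltac lin_mem x env :=
  lazymatch env with
  | nil => constr:(false)
  | x :: _ => constr:(true)
  | _ :: ?env' => lin_mem x env'
  end.

Ltac lin_atoms t env :=
  lazymatch t with
  | @Algebra.add _ ?a ?b => let e := lin_atoms a env in lin_atoms b e
  | @Algebra.opp _ ?a => lin_atoms a env
  | @GRing.scale _ _ _ ?a => lin_atoms a env
  | @Algebra.zero _ => env
  | _ => lazymatch lin_mem t env with true => env | false => constr:(t :: env) end
  end.

Ltac lin_quote R t env :=
  lazymatch t with
  | @Algebra.add _ ?a ?b =>
      let x := lin_quote R a env in let y := lin_quote R b env in constr:(@LinAdd R x y)
  | @Algebra.opp _ ?a => let x := lin_quote R a env in constr:(@LinOpp R x)
  | @GRing.scale _ _ ?k ?a => let x := lin_quote R a env in constr:(@LinScale R k x)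
  | @Algebra.zero _ => constr:(@LinZero R)
  | _ => let n := lin_index t env in constr:(@LinVar R n)
  end.

(** Coefficient identities that [ring] does not prove, for instance those with inverses, are left as
    goals. *)
Ltac lmod_ring R V :=
  lazymatch goal with
  | |- ?a = ?b =>
    let e0 := constr:(@nil V) in
    let e1 := lin_atoms a e0 in
    let env := lin_atoms b e1 in
    let x := lin_quote R a env in
    let y := lin_quote R b env in
    change (@lin_eval R V env x = @lin_eval R V env y);
    apply: lin_eq; cbn [lin_check size lin_coef eqn];
    repeat (split; [try by ring|]); try exact: Logic.I
  end.

(** * Continuous seminorms *)

Section Seminorms.
Context (R : realType).
Implicit Types (E F : tvsType R).

(** By homogeneity, continuity amounts to the unit ball being a neighbourhood of 0. *)
Definition continuous_seminorm E (p : E -> R) : Prop :=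
  [/\ forall x y, p (x + y) <= p x + p y,
      forall r x, p (r *: x) = `|r| * p x &
      nbhs 0 [set x | p x < 1]].

Section SeminormTheory.
Context E (p : E -> R) (sp : continuous_seminorm p).

Lemma seminormD x y : p (x + y) <= p x + p y.
Proof. by case: sp. Qed.

Lemma seminormZ r x : p (r *: x) = `|r| * p x.
Proof. by case: sp. Qed.

Lemma seminorm0 : p 0 = 0.
Proof. by rewrite -(scale0r 0) seminormZ normr0 mul0r. Qed.

Lemma seminormN x : p (- x) = p x.
Proof. by rewrite -scaleN1r seminormZ normrN normr1 mul1r. Qed.

Lemma seminormB x y : p (x - y) = p (y - x).
Proof. by rewrite -seminormN opprB. Qed.

Lemma seminorm_ge0 x : 0 <= p x.
Proof.
have := seminormD x (- x); rewrite subrr seminorm0 seminormN -mulr2n.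
by rewrite pmulrn_lge0.
Qed.

Lemma seminorm_sum (I : Type) (r : seq I) (P : pred I) (f : I -> E) :
  p (\sum_(i <- r | P i) f i) <= \sum_(i <- r | P i) p (f i).
Proof.
apply: (big_rec2 (fun x y => p x <= y)); first by rewrite seminorm0.
by move=> i y x _ h; apply: le_trans (seminormD _ _) _; rewrite lerD2l.
Qed.

Lemma seminorm_tri x y z : p (x - z) <= p (x - y) + p (y - z).
Proof. by have := seminormD (x - y) (y - z); rewrite addrA subrK. Qed.

Lemma seminorm_nbhs e : 0 < e -> nbhs 0 [set x | p x < e].
Proof.
move=> e0; have [_ _ n1] := sp.
have := @nbhs0Z R E _ e (lt0r_neq0 e0) n1; apply: filterS.
move=> _ [y /= y1 <-]; rewrite seminormZ gtr0_norm//.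
by rewrite -[ltRHS]mulr1 ltr_pM2l.
Qed.

Lemma seminorm_cvg (T : Type) (G : set_system T) {FG : Filter G} (f : T -> E) l :
  f @ G --> l -> forall e, 0 < e -> \forall t \near G, p (f t - l) < e.
Proof.
move=> fl e e0; have h : (fun t => f t - l) @ G --> (0 : E).
  by rewrite -(subrr l); apply: tvs_cvgD => //; exact: cvg_cst.
exact: (h _ (seminorm_nbhs e0)).
Qed.
End SeminormTheory.

Lemma convex_setE E (C : set E) x y (l : R) :
  convex_set C -> 0 <= l <= 1 -> C x -> C y -> C (l *: x + (1 - l) *: y).
Proof.
move=> cC /andP[l0 l1] Cx Cy.
have := cC x y (Itv01 l0 l1) (mem_set Cx) (mem_set Cy).
by move/set_mem.
Qed.

(** The seminorm is the Minkowski functional of the intersection [V] of a convex neighbourhood [C]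
    with [- C]: convexity gives subadditivity, and the symmetry of [V] gives the absolute value in
    homogeneity. *)
Lemma gauge_seminorm E (W : set E) :
  nbhs 0 W -> exists2 p : E -> R, continuous_seminorm p & [set x | p x < 1] `<=` W.
Proof.
have [B Bc [Bo Bb]] := @locally_convex R E.
move=> /(Bb 0)[C [BC C0] CW].
have cC : convex_set C by apply: Bc; exact: mem_set.
have Cn : nbhs 0 C by apply: open_nbhs_nbhs; split=> //; exact: Bo.
pose V := [set x : E | C x /\ C (- x)].
have Vc x y (l : R) : 0 <= l <= 1 -> V x -> V y -> V (l *: x + (1 - l) *: y).
  move=> hl [Cx Cx'] [Cy Cy']; split; first exact: convex_setE.
  by rewrite opprD -!scalerN; exact: convex_setE.
have VN x : V x -> V (- x) by move=> [Cx Cx']; split=> //; rewrite opprK.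
have Vn : nbhs 0 V.
  apply: filterI => //; have := @opp_continuous E 0; rewrite /continuous_at oppr0.
  exact.
have V0 : V 0 by exact: nbhs_singleton.
pose S x := [set r : R | 0 < r /\ V (r^-1 *: x)].
have Sup x r s : r <= s -> S x r -> S x s.
  move=> rs [r0 Vr]; have s0 : 0 < s by exact: lt_le_trans rs.
  split=> //; have -> : s^-1 *: x = (r / s) *: (r^-1 *: x) + (1 - r / s) *: 0.
    rewrite scaler0 addr0 scalerA mulrAC mulfV ?mul1r//.
    exact: lt0r_neq0.
  by apply: Vc => //; rewrite (divr_ge0 (ltW r0) (ltW s0))/= ler_pdivrMr// mul1r.
have Sne x : S x !=set0.
  have : (fun r : R => r *: x) @ 0 --> (0 : E).
    by rewrite -(scale0r x); apply: tvs_cvgZ; [exact: cvg_id|exact: cvg_cst].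
  move=> /(_ _ Vn) /nbhs_ballP[e /= e0 he]; exists (e / 2)^-1; split.
    by rewrite invr_gt0 divr_gt0.
  rewrite invrK; apply: he; rewrite /ball /= sub0r normrN gtr0_norm ?divr_gt0//.
  by rewrite ltr_pdivrMr// ltr_pMr// ltr1n.
have Slb x : lbound (S x) 0 by move=> r [/ltW].
have hS x : has_inf (S x) by split=> //; exists 0; exact: Slb.
pose p x := inf (S x).
have pge0 x : 0 <= p x by apply: lb_le_inf => //; exact: Slb.
have ple x r : S x r -> p x <= r by move=> h; apply: ge_inf => //; exists 0; exact: Slb.
have pap x e : 0 < e -> exists2 r, S x r & r < p x + e.
  by move=> e0; exact: inf_adherent.
have pZ r x : r != 0 -> p (r *: x) <= `|r| * p x.
  move=> r0; apply/ler_addgt0Pr => e e0.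
  have [|s [s0 Vs] hs] := pap x (e / `|r|); first by rewrite divr_gt0 ?normr_gt0.
  apply: (le_trans (y := `|r| * s)).
    apply: ple; split; first by rewrite mulr_gt0 ?normr_gt0.
    rewrite invfM scalerA mulrAC.
    have [r1|r1] := ltrP 0 r.
      by rewrite gtr0_norm// mulVf// mul1r.
    rewrite ler0_norm// invrN mulNr mulVf// mulN1r scaleNr; exact: VN.
  rewrite -(@ler_pM2l _ `|r|^-1) ?invr_gt0 ?normr_gt0//.
  rewrite mulrA mulVf ?normr_eq0// mul1r mulrDr mulrA mulVf ?normr_eq0// mul1r.
  by rewrite [_ * e]mulrC ltW.
have p0 : p 0 = 0.
  apply/eqP; rewrite eq_le pge0 andbT; apply/ler_addgt0Pr => e e0; rewrite add0r.
  by apply: ple; split=> //; rewrite scaler0.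
exists p; last first.
  move=> x /= px; have [|r Sr] := pap x (1 - p x); first by rewrite subr_gt0.
  rewrite addrC subrK => r1; apply: CW.
  by have [_] := Sup x r 1 (ltW r1) Sr; rewrite invr1 scale1r => -[].
split.
- move=> x y; apply/ler_addgt0Pr => e e0.
  have e2 : 0 < e / 2 by rewrite divr_gt0.
  have [r [r0 Vr] hr] := pap x (e / 2) e2; have [s [s0 Vs] hs] := pap y (e / 2) e2.
  apply: (le_trans (y := r + s)); last by lra.
  apply: ple; split; first exact: addr_gt0.
  have rs0 : r + s != 0 by rewrite gt_eqF// addr_gt0.
  have -> : (r + s)^-1 *: (x + y) =
      (r / (r + s)) *: (r^-1 *: x) + (1 - r / (r + s)) *: (s^-1 *: y).
    rewrite scalerDr !scalerA; congr (_ *: _ + _ *: _).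
      by field; rewrite rs0 gt_eqF.
    by field; rewrite rs0 gt_eqF.
  by apply: Vc => //; rewrite (divr_ge0 (ltW r0) (ltW (addr_gt0 r0 s0)))/= ler_pdivrMr ?addr_gt0// mul1r lerDl ltW.
- move=> r x; have [->|r0] := eqVneq r 0; first by rewrite scale0r p0 normr0 mul0r.
  (* The converse inequality is [pZ] for the scalar [r^-1] and the vector [r *: x]. *)
  apply/eqP; rewrite eq_le pZ//=.
  have := pZ r^-1 (r *: x); rewrite invr_eq0 => /(_ r0).
  rewrite scalerA mulVf// scale1r normfV -(@ler_pM2l _ `|r|) ?normr_gt0//.
  by rewrite mulrA mulfV ?normr_eq0// mul1r.
- have : ( *:%R 2 : E -> E) @ 0 --> (0 : E).
    by rewrite -{2}(scaler0 E (2 : R)); apply: tvs_cvgZ; [exact: cvg_cst|exact: cvg_id].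
  move=> /(_ _ Vn) hV.
  have {}hV : nbhs (0 : E) [set x | V (2 *: x)] by exact: hV.
  apply: filterS hV => x V2.
  apply: (@le_lt_trans _ _ (2^-1)); last by rewrite invf_lt1// ltr1n.
  by apply: ple; split; rewrite ?invr_gt0// invrK.
Qed.

Lemma cvg_seminorm E (T : Type) (G : set_system T) {FG : Filter G} (f : T -> E) l :
  (forall p, continuous_seminorm p ->
     forall e, 0 < e -> \forall t \near G, p (f t - l) < e) ->
  f @ G --> l.
Proof.
move=> h W Wl.
have /gauge_seminorm[p sp pW] : nbhs 0 [set x | W (l + x)].
  have : (fun x => l + x) @ 0 --> l + 0 by apply: tvs_cvgD; [exact: cvg_cst|exact: cvg_id].
  by rewrite addr0 => /(_ _ Wl).
apply: filterS (h p sp 1 ltr01) => t /pW /=.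
by rewrite addrC subrK.
Qed.

Lemma seminorm_eq0 E (x : E) : hausdorff_space E ->
  (forall p, continuous_seminorm p -> p x = 0) -> x = 0.
Proof.
move=> hE h; apply: hE => A B hA hB.
have /gauge_seminorm[p sp pB] := hB.
by exists x; split; [exact: nbhs_singleton|apply: pB; rewrite /= h].
Qed.
End Seminorms.

(** * Mean value inequality and Taylor expansion of curves *)

Section MeanValue.
Context (R : realType).
Implicit Types (E F : tvsType R).

Lemma curve_derivative_seminorm E (p : E -> R) (c : R -> E) t l :
  continuous_seminorm p -> curve_derivative c t l ->
  forall e, 0 < e -> \forall h \near 0, p (c (h + t) - c t - h *: l) <= e * `|h|.
Proof.
move=> sp /curve_derivativeP[Q [Ql Q0 cE]] e e0.
apply: filterS (seminorm_cvg sp Ql e0) => h he.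
rewrite cE [c t + _]addrC addrK -scalerBr (seminormZ sp) mulrC.
by rewrite ler_wpM2r// ltW.
Qed.

(** The set of [s] at which the bound with slope [M + e] holds contains its supremum [s0], and the
    derivative at [s0] would extend it to the right of [s0] if [s0 < b]. The slack [e] absorbs the
    error term of the derivative. *)
Lemma mean_value_seminorm E (p : E -> R) (c c' : R -> E) a b M :
  continuous_seminorm p -> a <= b ->
  (forall s, a <= s <= b -> curve_derivative c s (c' s)) ->
  (forall s, a <= s <= b -> p (c' s) <= M) ->
  p (c b - c a) <= M * (b - a).
Proof.
move=> sp ab dc cM.
have ba0 : 0 <= b - a by rewrite subr_ge0.
suff key e : 0 < e -> p (c b - c a) <= (M + e) * (b - a).
  apply/ler_addgt0Pr => e e0.
  have h1 : 0 < b - a + 1 by lra.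
  apply: le_trans (key (e / (b - a + 1)) _) _; first by rewrite divr_gt0.
  rewrite mulrDl lerD2l mulrAC ler_pdivrMr// ler_pM2l//; lra.
move=> e0.
pose g s := p (c s - c a) - (M + e) * (s - a).
pose S := [set s | a <= s <= b /\ g s <= 0].
have Sa : S a by split; rewrite ?lexx// /g !subrr (seminorm0 sp) mulr0 subrr.
have hS : has_sup S by split; [exists a|exists b => s [/andP[]]].
pose s0 := sup S.
have s0a : a <= s0 by apply: ub_le_sup => //; case: hS.
have s0b : s0 <= b by apply: ge_sup; [exists a|move=> s [/andP[]]].
have s0ab : a <= s0 <= b by rewrite s0a.
have near_s0 e1 : 0 < e1 -> exists2 d : R, 0 < d &
    forall h, `|h| < d -> p (c (h + s0) - c s0) <= (M + e1) * `|h|.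
  move=> e10; have /nbhs_ballP[d /= d0 hd] := curve_derivative_seminorm sp (dc _ s0ab) e10.
  exists d => // h hh; have := hd h; rewrite /ball /= sub0r normrN => /(_ hh) h1.
  have -> : c (h + s0) - c s0 = (c (h + s0) - c s0 - h *: c' s0) + h *: c' s0 by rewrite subrK.
  apply: le_trans (seminormD sp _ _) _; rewrite (seminormZ sp) addrC mulrDl [_ * p _]mulrC.
  by apply: lerD => //; rewrite ler_wpM2r// cM.
have Ss0 : g s0 <= 0.
  apply/ler_addgt0Pr => e1 e10; rewrite add0r.
  have [d d0 hd] := near_s0 e e0.
  pose K := `|M + e| + 1; have K0 : 0 < K by rewrite ltr_wpDl.
  pose d' := Num.min d (e1 / (2 * K)).
  have d'0 : 0 < d' by rewrite lt_min d0 divr_gt0// mulr_gt0.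
  have [s [sab gs] hs] := @sup_adherent _ S _ d'0 hS.
  have ss0 : s <= s0 by apply: ub_le_sup; [case: hS|].
  have hsd : `|s - s0| < d' by rewrite ler0_norm ?subr_le0//; move: hs; rewrite -/s0; lra.
  have h1 : `|s - s0| <= e1 / (2 * K) by rewrite ltW// (lt_le_trans hsd)// ge_min lexx orbT.
  have := hd (s - s0); rewrite subrK (lt_le_trans hsd) ?ge_min ?lexx// => /(_ isT) h2.
  have h3 : (M + e) * `|s - s0| <= e1 / 2.
    apply: (@le_trans _ _ (K * `|s - s0|)).
      rewrite ler_wpM2r// /K; have := ler_norm (M + e); lra.
    apply: (@le_trans _ _ (K * (e1 / (2 * K)))); first by rewrite ler_pM2l.
    by rewrite le_eqVlt; apply/orP; left; apply/eqP; field; rewrite gt_eqF.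
  have h4 : (M + e) * (s - s0) <= e1 / 2.
    apply: (@le_trans _ _ (K * `|s - s0|)); last first.
      apply: (@le_trans _ _ (K * (e1 / (2 * K)))); first by rewrite ler_pM2l.
      by rewrite le_eqVlt; apply/orP; left; apply/eqP; field; rewrite gt_eqF.
    apply: le_trans (ler_norm _) _; rewrite normrM ler_wpM2r// /K.
    by rewrite lerDl ler01.
  have h5 := seminorm_tri sp (c s0) (c s) (c a).
  rewrite (seminormB sp) in h2.
  move: gs; rewrite /g => gs; lra.
have [s0bE|s0bN] := eqVneq s0 b.
  by move: Ss0; rewrite s0bE /g subr_le0.
have s0lt : s0 < b by rewrite lt_neqAle s0bN.
have [d d0 hd] := near_s0 e e0.
pose h := Num.min (d / 2) (b - s0).
have h0 : 0 < h by rewrite lt_min divr_gt0//= subr_gt0.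
have hlt : `|h| < d.
  by rewrite gtr0_norm// gt_min ltr_pdivrMr// ltr_pMr// ltr1n.
have hb : h <= b - s0 by rewrite ge_min lexx orbT.
suff : S (h + s0).
  have [_ ub] := hS; move/(ub_le_sup ub); rewrite -/s0; lra.
split; first by apply/andP; split; lra.
have := hd h hlt; rewrite gtr0_norm// => h2.
have := seminorm_tri sp (c (h + s0)) (c s0) (c a).
move: Ss0; rewrite /g; lra.
Qed.

Lemma mean_value_zero E (p : E -> R) (c c' : R -> E) M s :
  continuous_seminorm p ->
  (forall r, `|r| <= `|s| -> curve_derivative c r (c' r)) ->
  (forall r, `|r| <= `|s| -> p (c' r) <= M) ->
  p (c s - c 0) <= M * `|s|.
Proof.
move=> sp dc cM; have [s0|s0] := leP 0 s.
  rewrite ger0_norm//; have := @mean_value_seminorm E p c c' 0 s M sp s0.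
  rewrite subr0; apply => r /andP[r0 rs]; [apply: dc|apply: cM]; by rewrite !ger0_norm.
rewrite ltr0_norm// (seminormB sp).
have := @mean_value_seminorm E p c c' s 0 M sp (ltW s0).
by rewrite sub0r; apply => r /andP[r0 rs]; [apply: dc|apply: cM]; rewrite !ler0_norm ?lerN2// ltW.
Qed.

Definition dern E (n : nat) (c : R -> E) : R -> E :=
  iter n (fun g => tderive g (1 : R)) c.

Lemma smooth_dern E (c : R -> E) n t :
  smooth_curve c -> curve_derivative (dern n c) t (dern n.+1 c t).
Proof. by move=> sc; exact/tderive_curve/(sc t n). Qed.
Arguments smooth_dern {E c} n t _.

Lemma dernD E (c : R -> E) n m : dern (n + m) c = dern n (dern m c).
Proof. by rewrite /dern iterD. Qed.

Lemma smooth_curve_dern E (c : R -> E) n : smooth_curve c -> smooth_curve (dern n c).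
Proof. by move=> sc t m; rewrite -[iter _ _ _]dernD; exact: sc. Qed.

Lemma curve_derivative_near E (c d : R -> E) (t : R) l :
  (\forall s \near t, c s = d s) -> curve_derivative c t l -> curve_derivative d t l.
Proof.
move=> cd /curve_derivativeP[Q [Ql Q0 cE]] W Wl.
have h1 : \forall h \near 0, c (h + t) = d (h + t).
  have : (fun h : R => h + t) @ 0 --> t.
    by rewrite -{2}(add0r t); apply: cvgD; [exact: cvg_id|exact: cvg_cst].
  by move=> /(_ _ cd).
have h2 : \forall h \near 0, W (Q h) by exact: Ql.
have ct : c t = d t by exact: nbhs_singleton cd.
rewrite /tquot; apply: filterS (filterI h1 h2) => h [e Wh] h0 /=.
rewrite [h *: _]mulr1 -e -ct cE [c t + _]addrC addrK scalerA mulVf//.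
by rewrite scale1r.
Qed.

Lemma tderive_near E (c d : R -> E) (t : R) :
  (\forall s \near t, c s = d s) -> tderive c (1 : R) t = tderive d (1 : R) t.
Proof.
move=> cd; rewrite /tderive; congr (xget 0 _).
have dc : \forall s \near t, d s = c s by apply: filterS cd.
by rewrite eqEsubset; split=> l; exact: curve_derivative_near.
Qed.

Lemma near_nearby (P : R -> Prop) (t : R) :
  (\forall s \near t, P s) -> \forall s \near t, \forall r \near s, P r.
Proof. by move=> h; exact: nbhs_interior. Qed.

Lemma dern_near E (c d : R -> E) n (t : R) :
  (\forall s \near t, c s = d s) -> \forall s \near t, dern n c s = dern n d s.
Proof.
elim: n t => // n IH t cd; apply: filterS (near_nearby cd) => s /IH h.
exact: tderive_near.
Qed.

Lemma dern_near_eq E (c d : R -> E) n (t : R) :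
  (\forall s \near t, c s = d s) -> dern n c t = dern n d t.
Proof. by move=> /(dern_near n)/nbhs_singleton. Qed.

Lemma smooth_at_near E (c d : R -> E) (t : R) :
  (\forall s \near t, c s = d s) -> smooth_at c t -> smooth_at d t.
Proof.
move=> cd sc n; have [l cl] := sc n; exists l.
exact: (curve_derivative_near (dern_near n cd) cl).
Qed.

Lemma curve_derivative_continuous_at E (c : R -> E) (t : R) l :
  curve_derivative c t l -> c @ t --> c t.
Proof.
move=> /curve_derivative_continuous h.
have h2 : (fun s => s - t) @ t --> (0 : R).
  by rewrite -(subrr t); apply: cvgB; [exact: cvg_id|exact: cvg_cst].
have := cvg_comp _ _ h2 h.
by rewrite (_ : _ \o _ = c)//; apply/funext => s /=; rewrite subrK.
Qed.

Lemma smooth_curve_continuous E (c : R -> E) (t : R) :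
  smooth_curve c -> c @ t --> c t.
Proof.
move=> sc; have h : curve_derivative c t _ := smooth_dern 0 t sc.
exact: curve_derivative_continuous_at h.
Qed.

Definition mono (n : nat) (s : R) : R := s ^+ n / n`!%:R.

Lemma mono0 n : mono n 0 = (n == 0)%N%:R.
Proof. by rewrite /mono expr0n; case: n => [|n] /=; rewrite ?divr1 ?fact0 ?invr1 ?mulr1 ?mul0r. Qed.

Lemma curve_derivativeZl E (g : R -> R) (v : E) t k :
  curve_derivative g t k -> curve_derivative (fun s => g s *: v) t (k *: v).
Proof.
move=> gk; have := curve_derivativeZ gk (curve_derivative_cst v t).
by rewrite scaler0 addr0.
Qed.

Lemma mono_derivative n (t : R) : curve_derivative (mono n.+1) t (mono n t).
Proof.
have dX : is_derive t (1 : R) (fun s : R => s ^+ n.+1) (n.+1%:R * t ^+ n).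
  by split; [exact: exprn_derivable|rewrite exp_derive /GRing.scale /= mulr1].
have := @curve_derivativeZl R _ (n.+1`!%:R^-1 : R) _ _ ((curve_derivative_real _ _ _).1 dX).
rewrite (_ : _ *: _ = mono n t)// /mono /GRing.scale /= factS natrM; field.
by rewrite nat1r !pnatr_eq0 -!lt0n fact_gt0.
Qed.

Lemma curve_derivativeZr E (c : R -> E) (a : R) t l :
  curve_derivative c t l -> curve_derivative (fun s => a *: c s) t (a *: l).
Proof.
move=> gk; have := curve_derivativeZ (curve_derivative_cst (a : R) t) gk.
by rewrite scale0r add0r.
Qed.

Lemma curve_derivativeN E (c : R -> E) t l :
  curve_derivative c t l -> curve_derivative (fun s => - c s) t (- l).
Proof.
move=> /(@curve_derivativeZr _ _ (-1)); rewrite scaleN1r.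
by rewrite (_ : (fun s => -1 *: c s) = fun s => - c s)//; apply/funext => s; rewrite scaleN1r.
Qed.

Lemma curve_derivativeB E (c d : R -> E) t l m :
  curve_derivative c t l -> curve_derivative d t m ->
  curve_derivative (fun s => c s - d s) t (l - m).
Proof. by move=> cl dm; apply: curve_derivativeD => //; exact: curve_derivativeN. Qed.

Lemma curve_derivative_sum E (I : Type) (r : seq I) (P : pred I)
    (c : I -> R -> E) t (l : I -> E) :
  (forall i, P i -> curve_derivative (c i) t (l i)) ->
  curve_derivative (fun s => \sum_(i <- r | P i) c i s) t (\sum_(i <- r | P i) l i).
Proof.
move=> h; elim: r => [|i r IH].
  rewrite big_nil (_ : (fun s => _) = fun=> 0); first exact: curve_derivative_cst.
  by apply/funext => s; rewrite big_nil.
rewrite big_cons (_ : (fun s => _) = fun s =>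
    if P i then c i s + \sum_(j <- r | P j) c j s else \sum_(j <- r | P j) c j s).
  by case: ifPn => Pi //; apply: curve_derivativeD => //; exact: h.
by apply/funext => s; rewrite big_cons.
Qed.

Definition taylor E (m : nat) (c : R -> E) (s : R) : E :=
  \sum_(j < m) mono j s *: dern j c 0.

(** The remainder of order [m.+1] vanishes at 0 and its derivative is the remainder of order [m] of
    the derived curve, so each use of the mean value inequality gains one factor [|s|]. The factor
    [1 / m!] is given away. *)
Lemma taylor_seminorm E (p : E -> R) (c : R -> E) m C d :
  continuous_seminorm p -> smooth_curve c ->
  (forall s, `|s| <= d -> p (dern m c s) <= C) ->
  forall s, `|s| <= d -> p (c s - taylor m c s) <= C * `|s| ^+ m.
Proof.
move=> sp; elim: m c => [|m IH] c sc hC s sd.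
  by rewrite /taylor big_ord0 subr0 mulr1; exact: hC.
pose c1 := dern 1 c; have sc1 : smooth_curve c1 by exact: smooth_curve_dern.
have C0 : 0 <= C.
  by apply: le_trans (seminorm_ge0 sp _) (hC 0 _); rewrite normr0 (le_trans _ sd).
have := @mean_value_zero E p (fun r => c r - taylor m.+1 c r)
  (fun r => c1 r - taylor m c1 r) (C * `|s| ^+ m) s sp.
rewrite -mulrA -exprSr (_ : c 0 - taylor m.+1 c 0 = 0); last first.
  rewrite /taylor big_ord_recl mono0 scale1r big1 ?addr0 ?subrr// => i _.
  by rewrite mono0 scale0r.
rewrite subr0; apply => r rs.
  apply: curve_derivativeB; first exact: (smooth_dern 0 r sc).
  rewrite /taylor (_ : (fun s => _) = fun s => c 0 + \sum_(i < m) mono i.+1 s *: dern i.+1 c 0).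
    rewrite -[X in curve_derivative _ _ X]add0r; apply: curve_derivativeD.
      exact: curve_derivative_cst.
    apply: (curve_derivative_sum (c := fun (i : 'I_m) s => mono i.+1 s *: dern i.+1 c 0)) => i _.
    rewrite -[dern i c1]dernD addn1.
    by apply: curve_derivativeZl; exact: mono_derivative.
  apply/funext => u; rewrite big_ord_recl /mono expr0 fact0 divr1 scale1r; congr (_ + _).
have h : p (c1 r - taylor m c1 r) <= C * `|r| ^+ m.
  apply: IH => //; last exact: le_trans sd.
  by move=> u ud; rewrite -[dern m c1]dernD addn1; exact: hC.
by apply: le_trans h _; rewrite ler_wpM2l// lerXn2r// nnegrE.
Qed.

Lemma smooth_local_bound E (p : E -> R) (c : R -> E) :
  continuous_seminorm p -> smooth_curve c -> forall m,
  exists2 d : R, 0 < d & exists C : R, 0 <= C /\ forall s, `|s| <= d -> p (dern m c s) <= C.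
Proof.
move=> sp sc m; have h : dern m c @ 0 --> dern m c 0.
  exact/smooth_curve_continuous/smooth_curve_dern.
have /nbhs_ballP[e /= e0 he] : \forall s \near (0 : R), p (dern m c s - dern m c 0) < 1.
  exact: (seminorm_cvg sp h ltr01).
exists (e / 2); first by rewrite divr_gt0.
exists (p (dern m c 0) + 1); split; first by rewrite addr_ge0// (seminorm_ge0 sp).
move=> s se; have := he s; rewrite /ball /= sub0r normrN => /(_ _)/ltW h1.
rewrite -[dern m c s](subrK (dern m c 0)) addrC.
rewrite addrC; apply: le_trans (seminormD sp _ _) _; rewrite addrC lerD2l; apply: h1.
by rewrite (le_lt_trans se)// ltr_pdivrMr// ltr_pMr// ltr1n.
Qed.

Lemma taylor_peano E (p : E -> R) (c : R -> E) m :
  continuous_seminorm p -> smooth_curve c ->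
  exists2 d : R, 0 < d & exists2 C : R, 0 <= C &
    forall s, `|s| <= d -> p (c s - taylor m c s) <= C * `|s| ^+ m.
Proof.
move=> sp sc; have [d d0 [C [C0 hC]]] := smooth_local_bound sp sc m.
by exists d => //; exists C => //; exact: taylor_seminorm.
Qed.
End MeanValue.
Arguments smooth_dern {R E c} n t _.

(** * Cutoff functions *)

Section Bump.
Context (R : realType).

(* [psi 0] is [exp (- 1 / x)] for [x > 0], and the derivatives of the [psi k] are
   combinations of such functions. *)
Definition psi (k : nat) (x : R) : R :=
  if 0 < x then x^-1 ^+ k * expR (- x^-1) else 0.

(** This is the [k]-th power of [y / k <= expR (y / k)]. *)
Lemma expR_pow_le (k : nat) (y : R) : 0 <= y -> y ^+ k <= k%:R ^+ k * expR y.
Proof.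
move=> y0; case: k => [|k]; first by rewrite !expr0 mul1r (le_trans _ (expR_ge1Dx _))// lerDl.
have -> : expR y = expR (y / k.+1%:R) ^+ k.+1.
  by rewrite -expRM_natl mulrCA mulfV ?mulr1// pnatr_eq0.
rewrite -exprMn lerXn2r ?nnegrE ?mulr_ge0 ?expR_ge0//.
have := expR_ge1Dx (y / k.+1%:R) => h.
rewrite mulrC -ler_pdivrMr ?ltr0n//; apply: le_trans h; rewrite lerDr//.
Qed.

(** The difference quotient of [psi k] at 0 is [psi k.+1], so a linear bound for every [k] makes the
    derivative at 0 vanish. *)
Lemma psi_bound k (h : R) : `|psi k h| <= k.+1%:R ^+ k.+1 * `|h|.
Proof.
rewrite /psi; case: ifPn => [h0|_]; last by rewrite normr0 mulr_ge0.
rewrite (gtr0_norm h0) ger0_norm; last by rewrite mulr_ge0 ?expR_ge0// exprn_ge0// invr_ge0 ltW.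
have := @expR_pow_le k.+1 h^-1; rewrite invr_ge0 => /(_ (ltW h0)).
rewrite expRN exprSr => h1.
rewrite ler_pdivrMr ?expR_gt0//.
rewrite -(@ler_pM2r _ h^-1) ?invr_gt0//; apply: le_trans h1 _.
by rewrite le_eqVlt; apply/orP; left; apply/eqP; field; rewrite gt_eqF.
Qed.

Lemma psi_derivative k (x : R) :
  curve_derivative (psi k) x ((- k%:R) * psi k.+1 x + psi k.+2 x).
Proof.
have [x0|x0|x0] := ltrgt0P x.
- apply: (@curve_derivative_near _ _ (fun s => s^-1 ^+ k * expR (- s^-1))).
    have : nbhs x [set s : R | 0 < s] by apply: open_nbhs_nbhs; split => //; exact: open_gt.
    by apply: filterS => s /= s0; rewrite /psi s0.
  have xN : x != 0 by rewrite gt_eqF.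
  have dV : is_derive x (1 : R) (fun s : R => s^-1) (- x ^- 2).
    by apply: is_derive_eq; [apply: is_deriveV|rewrite /GRing.scale /= mulr1].
  have dX : is_derive (x^-1) (1 : R) (fun s : R => s ^+ k * expR (- s))
      (k%:R * x^-1 ^+ k.-1 * expR (- x^-1) - x^-1 ^+ k * expR (- x^-1)).
    have d1 : is_derive (x^-1) (1 : R) (fun s : R => s ^+ k) (k%:R * x^-1 ^+ k.-1).
      by split; [exact: exprn_derivable|rewrite exp_derive /GRing.scale /= mulr1].
    have d2 : is_derive (x^-1) (1 : R) (fun s : R => expR (- s)) (- expR (- x^-1)).
      by apply: is_derive_eq; rewrite /GRing.scale /= mulrN1.
    apply: is_derive_eq; rewrite /GRing.scale /=; ring.
  have := curve_derivative_comp ((curve_derivative_real _ _ _).1 dV) ((curve_derivative_real _ _ _).1 dX).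
  rewrite (_ : _ *: _ = - k%:R * psi k.+1 x + psi k.+2 x)//.
  rewrite /psi x0 /GRing.scale /= -exprVn.
  case: k {dX} => [|k]; first by ring.
  by rewrite !exprS; ring.
- apply: (@curve_derivative_near _ _ (fun s => 0)).
    have : nbhs x [set s : R | s < 0] by apply: open_nbhs_nbhs; split => //; exact: open_lt.
    by apply: filterS => s /= s0; rewrite /psi ltNge (ltW s0).
  by rewrite /psi !ltNge !(ltW x0) /= mulr0 addr0; exact: curve_derivative_cst.
- rewrite x0 (_ : _ + _ = 0); last by rewrite /psi ltxx mulr0 addr0.
  apply: cvg_seminorm => p sp e e0.
  pose K : R := k.+2%:R ^+ k.+2 * (p 1 + 1).
  have K0 : 0 < K by rewrite mulr_gt0// ?exprn_gt0// ltr_wpDl// (seminorm_ge0 sp).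
  have hn : nbhs (0 : R) (ball (0 : R) (e / K)) by apply: nbhsx_ballx; rewrite divr_gt0.
  suff : nbhs (0 : R) [set h : R | h != 0 -> p (tquot (psi k) 1 0 h - 0) < e] by [].
  apply: filterS hn => h; rewrite /ball /= sub0r normrN => hh hN.
  rewrite subr0 /tquot addr0 [h *: _]mulr1 (_ : psi k 0 = 0) ?subr0; last by rewrite /psi ltxx.
  have -> : h^-1 *: psi k h = psi k.+1 h *: (1 : R).
    by rewrite /psi /GRing.scale /= mulr1; case: ifP => _; rewrite ?mulr0// exprS mulrA.
  rewrite (seminormZ sp); apply: (@le_lt_trans _ _ (k.+2%:R ^+ k.+2 * `|h| * (p 1 + 1))).
    apply: ler_pM => //; [exact: (seminorm_ge0 sp)|exact: psi_bound|by rewrite lerDl].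
  by move: hh; rewrite ltr_pdivlMr// mulrAC mulrC.
Qed.

Lemma smooth_psi k : smooth_curve (psi k).
Proof.
apply/smooth_curveP => n; elim: n k => // n IH k.
apply: (ndiffS (@Rhausdorff R) (@psi_derivative k)).
apply: (ndiffD (@Rhausdorff R) _ (IH _)).
exact: (ndiffZ (@Rhausdorff R) (ndiff_cst (@Rhausdorff R) n (- k%:R : R)) (IH k.+1)).
Qed.

(** A smooth step from 1 on [x <= 0] to 0 on [x >= 1]: the inner [psi 0] vanishes on the left and
    exceeds [psi 0 1] on the right. The denominator is constant, so that smoothness only involves
    composition. *)
Definition step (x : R) : R := psi 0 (psi 0 1 - psi 0 x) / psi 0 (psi 0 1).

Lemma psi0_gt0 x : 0 < x -> 0 < psi 0 x.
Proof. by move=> x0; rewrite /psi x0 expr0 mul1r expR_gt0. Qed.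

Lemma psi0_le0 x : x <= 0 -> psi 0 x = 0.
Proof. by rewrite /psi ltNge => ->. Qed.

Lemma step1 x : x <= 0 -> step x = 1.
Proof.
move=> x0; rewrite /step (psi0_le0 x0) subr0 mulfV//.
by rewrite gt_eqF// psi0_gt0// psi0_gt0.
Qed.

Lemma step0 x : 1 <= x -> step x = 0.
Proof.
move=> x1; rewrite /step psi0_le0 ?mul0r// subr_le0.
rewrite /psi ltr01 (lt_le_trans ltr01 x1) !expr0 !mul1r ler_expR lerN2.
by rewrite lef_pV2 ?posrE// (lt_le_trans ltr01 x1).
Qed.

Lemma psi0_ge0 x : 0 <= psi 0 x.
Proof. by rewrite /psi; case: ifP => // _; rewrite mulr_ge0 ?expR_ge0. Qed.

Lemma psi0_le x y : x <= y -> psi 0 x <= psi 0 y.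
Proof.
move=> xy; have [x0|x0] := leP x 0; first by rewrite (psi0_le0 x0) psi0_ge0.
have y0 := lt_le_trans x0 xy.
by rewrite /psi x0 y0 !expr0 !mul1r ler_expR lerN2 lef_pV2 ?posrE.
Qed.

Lemma step_ge0 x : 0 <= step x.
Proof. by rewrite divr_ge0 ?psi0_ge0. Qed.

Lemma step_le1 x : step x <= 1.
Proof.
have p1 : 0 < psi 0 (psi 0 1) by rewrite psi0_gt0// psi0_gt0.
by rewrite /step ler_pdivrMr// mul1r psi0_le// gerBl psi0_ge0.
Qed.

Let hR := @Rhausdorff R.

Lemma smooth_cst (E : tvsType R) (a : E) : hausdorff_space E -> smooth_curve (fun _ : R => a).
Proof. by move=> hE; apply/smooth_curveP => n; exact: ndiff_cst. Qed.

Lemma smoothD (E : tvsType R) (c d : R -> E) : hausdorff_space E ->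
  smooth_curve c -> smooth_curve d -> smooth_curve (fun s => c s + d s).
Proof.
by move=> hE /smooth_curveP hc /smooth_curveP hd; apply/smooth_curveP => n; exact: ndiffD.
Qed.

Lemma smoothZ (E : tvsType R) (g : R -> R) (c : R -> E) : hausdorff_space E ->
  smooth_curve g -> smooth_curve c -> smooth_curve (fun s => g s *: c s).
Proof.
by move=> hE /smooth_curveP hc /smooth_curveP hd; apply/smooth_curveP => n; exact: ndiffZ.
Qed.

Lemma smoothM (f g : R -> R) :
  smooth_curve f -> smooth_curve g -> smooth_curve (fun s => f s * g s).
Proof. exact: smoothZ. Qed.

Lemma smoothN (E : tvsType R) (c : R -> E) : hausdorff_space E ->
  smooth_curve c -> smooth_curve (fun s => - c s).
Proof.
move=> hE sc; rewrite (_ : (fun s => _) = fun s => (-1 : R) *: c s).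
  by apply: smoothZ => //; exact: smooth_cst.
by apply/funext => s; rewrite scaleN1r.
Qed.

Lemma smoothB (E : tvsType R) (c d : R -> E) : hausdorff_space E ->
  smooth_curve c -> smooth_curve d -> smooth_curve (fun s => c s - d s).
Proof. by move=> hE sc sd; apply: smoothD => //; exact: smoothN. Qed.

Lemma smooth_sum (E : tvsType R) (I : Type) (r : seq I) (P : pred I)
    (c : I -> R -> E) : hausdorff_space E ->
  (forall i, P i -> smooth_curve (c i)) ->
  smooth_curve (fun s => \sum_(i <- r | P i) c i s).
Proof.
move=> hE h; elim: r => [|i r IH].
  rewrite (_ : (fun s => _) = fun=> 0); first exact: smooth_cst.
  by apply/funext => s; rewrite big_nil.
rewrite (_ : (fun s => _) = fun s =>
    if P i then c i s + \sum_(j <- r | P j) c j s else \sum_(j <- r | P j) c j s).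
  by case Pi: (P i) => //; apply: smoothD => //; exact: h.
by apply/funext => s; rewrite big_cons.
Qed.

Lemma smooth_derivative (E : tvsType R) (c c' : R -> E) : hausdorff_space E ->
  (forall t, curve_derivative c t (c' t)) -> smooth_curve c' -> smooth_curve c.
Proof.
move=> hE h /smooth_curveP sc; apply/smooth_curveP => n; apply: ndiffW.
exact: (ndiffS hE h (sc n)).
Qed.

Lemma curve_derivative_id (t : R) : curve_derivative (id : R -> R) t 1.
Proof. by apply/curve_derivative_real; exact: is_derive_id. Qed.

Lemma smooth_id : smooth_curve (fun s : R => s).
Proof. exact: (smooth_derivative hR curve_derivative_id (smooth_cst (1 : R) hR)). Qed.

Lemma smooth_affine (a b : R) : smooth_curve (fun s : R => a + b * s).
Proof.
apply: smoothD => //; first exact: smooth_cst.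
by apply: smoothM; [exact: smooth_cst|exact: smooth_id].
Qed.

Lemma smooth_step : smooth_curve step.
Proof.
apply: smoothM; last exact: smooth_cst.
apply: (smooth_curve_comp hR (k := fun x => psi 0 1 - psi 0 x)); last exact: smooth_psi.
by apply: smoothB => //; [exact: smooth_cst|exact: smooth_psi].
Qed.

(** The argument of [step] is at most 0 exactly for [|x| <= 1/2], and at least 1 once
    [x ^+ 2 >= 1/2], in particular for [|x| >= 3/4]. *)
Definition bump (x : R) : R := step (4 * (x * x) - 1).

Lemma smooth_bump : smooth_curve bump.
Proof.
apply: (smooth_curve_comp hR (k := fun x => 4 * (x * x) - 1)); last exact: smooth_step.
apply: smoothB => //; last exact: smooth_cst.
apply: smoothM; first exact: smooth_cst.
by apply: smoothM; exact: smooth_id.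
Qed.

Lemma bump1 x : `|x| <= 2^-1 -> bump x = 1.
Proof.
move=> hx; apply: step1; rewrite -[x * x]ger0_norm; last by rewrite -expr2 sqr_ge0.
rewrite normrM; have := normr_ge0 x; nra.
Qed.

Lemma bump0 x : 3 / 4 <= `|x| -> bump x = 0.
Proof.
move=> hx; apply: step0; rewrite -[x * x]ger0_norm; last by rewrite -expr2 sqr_ge0.
rewrite normrM; have := normr_ge0 x; nra.
Qed.

(** A reparametrization with the germ of the identity at 0 and values in the interval from [- d] to
    [d]. It extends locally defined curves and plane maps without changing their germ. *)
Definition cutoff (d t : R) : R := t * bump (t / d).

Lemma smooth_cutoff d : smooth_curve (cutoff d).
Proof.
apply: smoothM; first exact: smooth_id.
apply: (smooth_curve_comp hR (k := fun t => t / d)); last exact: smooth_bump.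
by apply: smoothM; [exact: smooth_id|exact: smooth_cst].
Qed.

Lemma cutoff_id d t : 0 < d -> `|t| <= d / 2 -> cutoff d t = t.
Proof.
move=> d0 td; rewrite /cutoff bump1 ?mulr1// normrM normfV (gtr0_norm d0).
by rewrite ler_pdivrMr// mulrC.
Qed.

Lemma cutoff_lt d t : 0 < d -> `|cutoff d t| < d.
Proof.
move=> d0; rewrite /cutoff; have [h|h] := leP (3 / 4) `|t / d|.
  by rewrite bump0// mulr0 normr0.
rewrite normrM [`|bump _|]ger0_norm; last exact: step_ge0.
apply: (@le_lt_trans _ _ `|t|).
  by rewrite -[leRHS]mulr1 ler_wpM2l// step_le1.
by move: h; rewrite normrM normfV (gtr0_norm d0) ltr_pdivrMr//; nra.
Qed.

Lemma cutoff_near d : 0 < d -> \forall t \near (0 : R), cutoff d t = t.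
Proof.
move=> d0; have : nbhs (0 : R) (ball (0 : R) (d / 2)).
  by apply: nbhsx_ballx; rewrite divr_gt0.
by apply: filterS => t; rewrite /ball /= sub0r normrN => /ltW; exact: cutoff_id.
Qed.

Lemma cutoff0 d : cutoff d 0 = 0.
Proof. by rewrite /cutoff mul0r. Qed.
End Bump.

(** * Interpolation by smooth curves *)

Section Interpolation.
Context (R : realType).

Lemma curve_derivativeI (E : tvsType R) (c : R -> E) (t : R) (l : E) :
  (forall p, continuous_seminorm p -> forall e : R, 0 < e ->
     \forall h \near (0 : R), p (c (h + t) - c t - h *: l) <= e * `|h|) ->
  curve_derivative c t l.
Proof.
move=> H; apply: cvg_seminorm => p sp e e0.
suff : nbhs (0 : R) [set h : R | h != 0 -> p (tquot c 1 t h - l) < e] by [].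
have e2 : 0 < e / 2 by rewrite divr_gt0.
apply: filterS (H p sp _ e2) => h hh hN.
have -> : tquot c 1 t h - l = h^-1 *: (c (h + t) - c t - h *: l).
  by rewrite /tquot [h *: (1 : R)]mulr1 [RHS]scalerBr scalerA mulVf// scale1r.
rewrite (seminormZ sp) normfV mulrC ltr_pdivrMr ?normr_gt0//.
by apply: le_lt_trans hh _; rewrite ltr_pM2r ?normr_gt0// ltr_pdivrMr// ltr_pMr// ltr1n.
Qed.

Lemma curve_derivative_quadratic (E : tvsType R) (c : R -> E) (t : R) (l : E) :
  (forall p, continuous_seminorm p -> exists2 d : R, 0 < d & exists K : R,
     forall h, `|h| <= d -> p (c (h + t) - c t - h *: l) <= K * `|h| ^+ 2) ->
  curve_derivative c t l.
Proof.
move=> H; apply: curve_derivativeI => p sp e e0; have [d d0 [K hK]] := H p sp.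
pose K' := `|K| + 1; have K'0 : 0 < K' by rewrite ltr_wpDl.
have hn : nbhs (0 : R) (ball (0 : R) (Num.min d (e / K'))).
  by apply: nbhsx_ballx; rewrite lt_min d0 divr_gt0.
apply: filterS hn => h; rewrite /ball /= sub0r normrN lt_min => /andP[hd he].
apply: le_trans (hK h (ltW hd)) _; rewrite expr2 mulrA ler_wpM2r//.
apply: (@le_trans _ _ (K' * `|h|)).
  by rewrite ler_wpM2r// /K'; have := ler_norm K; lra.
by rewrite mulrC -ler_pdivlMr// ltW.
Qed.

Lemma curve_derivative_quadratic_real (c : R -> R) (t l K : R) :
  (forall h, `|c (h + t) - c t - h * l| <= K * `|h| ^+ 2) ->
  curve_derivative c t l.
Proof.
move=> H; apply: curve_derivative_quadratic => p sp; exists 1 => //.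
exists (K * p 1) => h _.
have -> : c (h + t) - c t - h *: l = (c (h + t) - c t - h * l) *: (1 : R).
  by rewrite [RHS]mulr1.
by rewrite (seminormZ sp) mulrAC ler_wpM2r ?(seminorm_ge0 sp).
Qed.

Lemma norm_seminorm : continuous_seminorm (fun x : R => `|x|).
Proof.
split; [exact: ler_normD|by move=> r x; rewrite normrM|].
have : nbhs (0 : R) (ball (0 : R) 1) by apply: nbhsx_ballx.
by apply: filterS => x; rewrite /ball /= sub0r normrN.
Qed.

(** The support lies between 13/16 and 19/16. Its dilates by powers of 2 are disjoint because twice
    13/16 exceeds 19/16; the radius 3/16 is that of the support of [bump (4 * (x - 1))]. *)
Definition dyadic_support (chi : R -> R) : Prop :=
  forall x, 3 / 16 < `|x - 1| -> chi x = 0.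

(** Decay faster than any power of [2 ^- n]: each derivative of [chi (2 ^+ n * s)] costs a factor
    [2 ^+ n]. *)
Definition rapid (a : nat -> R) : Prop :=
  forall k : nat, exists C : R, forall n, `|a n| * (2 ^+ n) ^+ k <= C.

(* The functions [fun s => chi (2 ^+ n * s)] have disjoint supports, so that
   [dyadic_sum chi a s] is the sum of all the [a n * chi (2 ^+ n * s)]. *)
Definition dyadic_index (s : R) : nat :=
  xget 0%N [set n : nat | `|2 ^+ n * s - 1| <= 3 / 16].

Definition dyadic_sum (chi : R -> R) (a : nat -> R) (s : R) : R :=
  a (dyadic_index s) * chi (2 ^+ dyadic_index s * s).

Lemma dyadic_uniq (s : R) n m :
  `|2 ^+ n * s - 1| <= 3 / 16 -> `|2 ^+ m * s - 1| <= 3 / 16 -> n = m.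
Proof.
wlog nm : n m / (n <= m)%N => [h hn hm|].
  by case/orP: (leq_total n m) => nm; [exact: h|apply/esym/h].
rewrite !ler_norml => /andP[n1 n2] /andP[m1 m2].
apply/eqP; rewrite eqn_leq nm /= leqNgt; apply/negP => ltnm.
have : 2 * (2 ^+ n * s) <= 2 ^+ m * s.
  rewrite mulrA -exprS ler_wpM2r//; last by rewrite ler_weXn2l// ler1n.
  have : 0 <= 2 ^+ n * s by lra.
  by rewrite pmulr_rge0// exprn_gt0.
lra.
Qed.

Lemma dyadic_indexE (s : R) n : `|2 ^+ n * s - 1| <= 3 / 16 -> dyadic_index s = n.
Proof.
move=> hn; apply: (@dyadic_uniq s) => //; rewrite /dyadic_index.
by case: xgetP => [m -> //|/(_ n)].
Qed.

Lemma dyadic_off (s : R) n chi :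
  dyadic_support chi -> n != dyadic_index s -> chi (2 ^+ n * s) = 0.
Proof.
move=> hc nN; apply: hc; rewrite ltNge; apply/negP => /dyadic_indexE e.
by rewrite e eqxx in nN.
Qed.

Lemma smooth_bounded (chi : R -> R) : smooth_curve chi -> dyadic_support chi ->
  exists B : R, forall x, `|chi x| <= B.
Proof.
move=> sc hc.
have cc : continuous (fun x : R => `|chi x|).
  by move=> x; apply: cvg_norm; exact: smooth_curve_continuous.
have [x0 _ hx0] := @EVT_max R (fun x => `|chi x|) 0 2 (ler0n _ _) (continuous_subspaceT cc).
exists `|chi x0| => x; have [h|h] := leP `|x - 1| (3 / 16); last by rewrite hc// normr0.
by apply: hx0; rewrite in_itv/=; move: h; rewrite ler_norml => /andP[]; lra.
Qed.

Lemma dyadic_support_derive chi : dyadic_support chi -> dyadic_support (dern 1 chi).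
Proof.
move=> hc x hx; rewrite (@dern_near_eq _ _ _ (fun=> 0)).
  by apply: (curve_derivativeE (@Rhausdorff R)); exact: curve_derivative_cst.
have : nbhs x [set y : R | 3 / 16 < `|y - 1|].
  apply: open_nbhs_nbhs; split => //.
  have -> : [set y : R | 3 / 16 < `|y - 1|] = (fun y : R => `|y - 1|) @^-1` [set z | 3 / 16 < z] by [].
  apply: open_comp; last exact: open_gt.
  by move=> y _; apply: cvg_norm; apply: cvgB; [exact: cvg_id|exact: cvg_cst].
by apply: filterS => y /hc.
Qed.

Lemma taylor2_bound (chi : R -> R) (B : R) : smooth_curve chi -> (forall x, `|dern 2 chi x| <= B) ->
  forall x u, `|chi (u + x) - chi x - u * dern 1 chi x| <= B * `|u| ^+ 2.
Proof.
move=> sc hB x u; pose c s := chi (x + 1 * s).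
have sk : smooth_curve (fun s : R => x + 1 * s) by exact: smooth_affine.
have sc' : smooth_curve c by exact: (smooth_curve_comp (@Rhausdorff R) sk sc).
have dc n s : dern n c s = dern n chi (x + 1 * s).
  elim: n s => // n IH s; rewrite [dern n.+1 c]/(tderive (dern n c) 1) (_ : dern n c = fun s => dern n chi (x + 1 * s)); last exact/funext.
  apply: (curve_derivativeE (@Rhausdorff R)).
  have d1 : curve_derivative (fun s : R => x + 1 * s) s 1.
    by apply/curve_derivative_real; apply: is_derive_eq; rewrite /GRing.scale /=; ring.
  by have := curve_derivative_comp d1 (smooth_dern n (x + 1 * s) sc); rewrite scale1r.
have := @taylor_seminorm _ _ _ c 2 B `|u| norm_seminorm sc' _ u (lexx _).
have -> : c u - taylor 2 c u = chi (u + x) - chi x - u * dern 1 chi x.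
  rewrite /taylor !big_ord_recl big_ord0 !dc /c /mono /= addr0 mul1r expr0 fact0 divr1 scale1r.
  by rewrite mulr0 addr0 expr1 (_ : 1`! = 1%N)// divr1 opprD addrA [x + u]addrC.
by apply => s _; rewrite dc.
Qed.

Lemma rapid_shift a : rapid a -> rapid (fun n => a n * 2 ^+ n).
Proof.
move=> ra k; have [C hC] := ra k.+1; exists C => n.
by rewrite normrM [`|2 ^+ n|]ger0_norm ?exprn_ge0// -mulrA -exprS.
Qed.

(** Each term [a n * chi (2 ^+ n * s)] has a first-order error of at most [C * B * |h| ^+ 2],
    uniformly in [n]. The index may change between [t] and [h + t], in which case two such errors
    add up. *)
Lemma dyadic_sum_derivative (chi : R -> R) a (t : R) :
  smooth_curve chi -> dyadic_support chi -> rapid a ->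
  curve_derivative (dyadic_sum chi a) t
    (dyadic_sum (dern 1 chi) (fun n => a n * 2 ^+ n) t).
Proof.
move=> sc hc ra; have hc1 := dyadic_support_derive hc.
have hc2 : dyadic_support (dern 2 chi) by exact: dyadic_support_derive hc1.
have [B hB] := smooth_bounded (smooth_curve_dern 2 sc) hc2.
have [C hC] := ra 2%N.
have B0 : 0 <= B by apply: le_trans (hB 0).
have key n h : `|a n * (chi (2 ^+ n * (h + t)) - chi (2 ^+ n * t) -
    2 ^+ n * h * dern 1 chi (2 ^+ n * t))| <= C * B * `|h| ^+ 2.
  rewrite [2 ^+ n * (h + t)]mulrDr normrM.
  have := taylor2_bound sc hB (2 ^+ n * t) (2 ^+ n * h) => h1.
  apply: le_trans (ler_wpM2l (normr_ge0 _) h1) _.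
  rewrite normrM exprMn [`|2 ^+ n|]ger0_norm ?exprn_ge0//.
  have -> : `|a n| * (B * ((2 ^+ n) ^+ 2 * `|h| ^+ 2)) =
            (`|a n| * (2 ^+ n) ^+ 2) * (B * `|h| ^+ 2) by ring.
  by rewrite -[leRHS]mulrA ler_wpM2r// mulr_ge0// exprn_ge0.
apply: (@curve_derivative_quadratic_real _ _ _ (C * B + C * B)) => h.
(* Where no index applies, the default 0 gives a term that vanishes as well. *)
rewrite /dyadic_sum; set n := dyadic_index t; set m := dyadic_index (h + t).
have [nm|nm] := eqVneq m n.
  rewrite nm; have := key n h; set X := _ * _; set Y := _ - _ - _.
  have -> : Y = X by rewrite /X /Y; ring.
  move=> h1; apply: le_trans h1 _; rewrite mulrDl lerDl.
  by apply: le_trans (key 0%N h).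
have := key n h; have := key m h.
rewrite (dyadic_off hc nm) (dyadic_off hc1 nm).
rewrite eq_sym in nm; rewrite (dyadic_off hc nm) => h1 h2; rewrite mulrDl.
apply: le_trans (lerD h1 h2); apply: le_trans (ler_normD _ _).
by rewrite le_eqVlt; apply/orP; left; apply/eqP; congr (`| _ |); ring.
Qed.

Lemma smooth_dyadic_sum (chi : R -> R) a :
  smooth_curve chi -> dyadic_support chi -> rapid a -> smooth_curve (dyadic_sum chi a).
Proof.
move=> sc hc ra; apply/smooth_curveP => n; elim: n chi a sc hc ra => // n IH chi a sc hc ra.
apply: (ndiffS (@Rhausdorff R) (fun t => @dyadic_sum_derivative chi a t sc hc ra)).
apply: IH; [exact: smooth_curve_dern|exact: dyadic_support_derive|exact: rapid_shift].
Qed.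

(** The special curve lemma for segments: one smooth curve that coincides near the parameter
    [2 ^- n] with a prescribed affine function, for every [n]. The values [a n] are carried by
    [chi0], the slopes [b n] by [chi1]. *)
Lemma special_curve (a b : nat -> R) : rapid a -> rapid b ->
  exists sigma : R -> R, [/\ smooth_curve sigma, sigma 0 = 0 &
    forall n, \forall r \near (0 : R), sigma (r + (2 ^+ n)^-1) = a n + b n * r].
Proof.
move=> ra rb.
pose chi0 (x : R) := bump (4 * (x - 1)); pose chi1 (x : R) := chi0 x * (x - 1).
have saff : smooth_curve (fun x : R => 4 * (x - 1)).
  have := smooth_affine (-4 : R) 4; congr smooth_curve; apply/funext => x; ring.
have saff' : smooth_curve (fun x : R => x - 1).
  have := smooth_affine (-1 : R) 1; congr smooth_curve; apply/funext => x; ring.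
have s0 : smooth_curve chi0.
  exact: (smooth_curve_comp (@Rhausdorff R) saff (@smooth_bump R)).
have s1 : smooth_curve chi1 by exact: smoothM.
have h0 : dyadic_support chi0.
  by move=> x hx; rewrite /chi0 bump0// normrM ger0_norm//; lra.
have h1 : dyadic_support chi1 by move=> x hx; rewrite /chi1 h0// mul0r.
(* [chi1] is evaluated at [2 ^+ n * s], which multiplies the slope by [2 ^+ n]. *)
pose b' n := b n * (2 ^+ n)^-1.
have rb' : rapid b'.
  move=> k; have [C hC] := rb k; exists C => n; apply: le_trans (hC n).
  rewrite ler_wpM2r ?exprn_ge0 ?exprn_ge0// normrM -[leRHS]mulr1 ler_wpM2l//.
  by rewrite normfV ger0_norm ?exprn_ge0// invf_le1 ?exprn_gt0// exprn_ege1// ler1n.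
exists (fun s => dyadic_sum chi0 a s + dyadic_sum chi1 b' s); split.
- by apply: smoothD; [exact: Rhausdorff|exact: smooth_dyadic_sum|exact: smooth_dyadic_sum].
- rewrite /dyadic_sum mulr0 h0 ?h1 ?mulr0 ?addr0// sub0r normrN normr1.
  1,2: by rewrite ltr_pdivrMr//; lra.
move=> n; have n0 : 0 < (2 ^+ n : R) by rewrite exprn_gt0.
(* The argument of [bump] is [4 * 2 ^+ n * r], which stays below 1/2 in absolute value on this
   ball. *)
have hn : nbhs (0 : R) (ball (0 : R) (8^-1 / 2 ^+ n)).
  by apply: nbhsx_ballx; rewrite divr_gt0.
apply: filterS hn => r; rewrite /ball /= sub0r normrN ltr_pdivlMr// => hr.
have e : 2 ^+ n * (r + (2 ^+ n)^-1) - 1 = 2 ^+ n * r by rewrite mulrDr mulfV ?gt_eqF// addrK.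
have e' : `|2 ^+ n * (r + (2 ^+ n)^-1) - 1| <= 8^-1.
  by rewrite e normrM (gtr0_norm n0) mulrC ltW.
have idx : dyadic_index (r + (2 ^+ n)^-1) = n by apply: dyadic_indexE; lra.
rewrite /dyadic_sum idx /chi1 /chi0 bump1; last by rewrite normrM ger0_norm//; lra.
by rewrite e mulr1 mul1r /b' mulrA divfK ?gt_eqF.
Qed.

(** The weight [(2 ^+ n) ^+ n] dominates [(2 ^+ n) ^+ k] for [n >= k]; the finitely many smaller [n]
    are covered by the constant. *)
Lemma rapid_square (a : nat -> R) : (forall n, `|a n| * (2 ^+ n) ^+ n <= 1) -> rapid a.
Proof.
move=> h k; exists ((2 ^+ k) ^+ k) => n.
have g1 m j : 1 <= ((2 ^+ m) ^+ j : R) by rewrite exprn_ege1// exprn_ege1// ler1n.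
have [kn|nk] := leqP k n.
  apply: le_trans (g1 _ _); apply: le_trans (h n); rewrite ler_wpM2l//.
  by rewrite ler_weXn2l// exprn_ege1// ler1n.
apply: (@le_trans _ _ (1 * (2 ^+ n) ^+ k)).
  rewrite ler_wpM2r ?exprn_ge0 ?exprn_ge0//; apply: le_trans (h n).
  by rewrite -[leLHS]mulr1 ler_wpM2l.
by rewrite mul1r lerXn2r ?nnegrE ?exprn_ge0// ler_weXn2l ?ler1n// ltnW.
Qed.
End Interpolation.

(** * Families of smooth curves *)

Section Plane.
Context (R : realType).
Implicit Types (E F : tvsType R).

Lemma curve_derivative_affine E (u : R -> E) (a b r : R) l :
  curve_derivative u (a + b * r) l ->
  curve_derivative (fun r => u (a + b * r)) r (b *: l).
Proof.
apply: (curve_derivative_comp (k := fun r => a + b * r)).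
by apply/curve_derivative_real; apply: is_derive_eq; rewrite /GRing.scale /=; ring.
Qed.

Lemma dern_affine E (u : R -> E) (a b : R) n r : hausdorff_space E ->
  smooth_curve u -> dern n (fun r => u (a + b * r)) r = b ^+ n *: dern n u (a + b * r).
Proof.
move=> hE su; elim: n r => [|n IH] r; first by rewrite scale1r.
rewrite [LHS]/(tderive (dern n _) 1 r).
rewrite (_ : dern n _ = fun r => b ^+ n *: dern n u (a + b * r)); last exact/funext.
apply: (curve_derivativeE hE); rewrite exprSr -scalerA.
by apply: curve_derivativeZr; apply: curve_derivative_affine; exact: smooth_dern.
Qed.

Lemma smooth_curve_affine E (u : R -> E) (a b : R) : hausdorff_space E ->
  smooth_curve u -> smooth_curve (fun r => u (a + b * r)).
Proof.
by move=> hE su; exact: (smooth_curve_comp hE (smooth_affine a b) su).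
Qed.

Lemma dern_shift E (u : R -> E) (a : R) n r : hausdorff_space E ->
  smooth_curve u -> dern n (fun r => u (r + a)) r = dern n u (r + a).
Proof.
move=> hE su; have := @dern_affine E u a 1 n r hE su.
rewrite expr1n scale1r mul1r addrC => <-; congr (dern n _ r).
by apply/funext => s; rewrite mul1r addrC.
Qed.

(* Smoothness of [H] on the plane in the sense of [smooth_on], stated in terms of
   the two coordinates of a curve. *)
Definition smooth_plane F (H : R -> R -> F) : Prop :=
  forall sg tu : R -> R, smooth_curve sg -> smooth_curve tu ->
    smooth_curve (fun r => H (sg r) (tu r)).

Section PlaneTheory.
Context F (hF : hausdorff_space F).

Lemma smooth_plane_curve (H : R -> R -> F) t :
  smooth_plane H -> smooth_curve (H^~ t).
Proof. by move=> sH; apply: (sH id (fun=> t)); [exact: smooth_id|exact: smooth_cst]. Qed.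

Lemma smooth_plane_swap (H : R -> R -> F) :
  smooth_plane H -> smooth_plane (fun s t => H t s).
Proof. by move=> sH sg tu hs ht; exact: sH. Qed.

(* Otherwise there are points [(s_n, t_n)], converging rapidly to [(0, t0)], at
   which the derivatives grow rapidly. By [special_curve], a smooth curve of the
   plane passes through all of them in the first direction. *)
Lemma plane_local_bound (p : F -> R) (H : R -> R -> F) (t0 : R) k :
  continuous_seminorm p -> smooth_plane H ->
  exists2 d : R, 0 < d & exists C : R, forall s t : R,
    `|s| <= d -> `|t - t0| <= d -> p (dern k (H^~ t) s) <= C.
Proof.
move=> sp sH; apply: contrapT => hN.
pose rho n : R := ((2 ^+ n) ^+ n)^-1.
have e0 n : 0 < (2 ^+ n) ^+ n :> R by rewrite !exprn_gt0.
have rho0 n : 0 < rho n by rewrite invr_gt0.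
(* The curve will cross the [n]-th point with speed [rho n], which multiplies the [k]-th derivative
   by [rho n ^+ k]. The threshold compensates for this, so that the derivative of the composite
   exceeds [n]. *)
have /choice[z hz] : forall n, exists z : R * R, [/\ `|z.1| <= rho n,
    `|z.2 - t0| <= rho n & n%:R / rho n ^+ k < p (dern k (H^~ z.2) z.1)].
  move=> n; apply: contrapT => hn; apply: hN; exists (rho n) => //.
  exists (n%:R / rho n ^+ k) => s t hs ht; rewrite leNgt; apply/negP => h.
  by apply: hn; exists (s, t).
have rap (a : nat -> R) : (forall n, `|a n| <= rho n) -> rapid a.
  by move=> ha; apply: rapid_square => n; rewrite -ler_pdivlMr// div1r; exact: ha.
have [sg [ssg _ hsg]] : exists sg : R -> R, [/\ smooth_curve sg, sg 0 = 0 &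
    forall n, \forall r \near (0 : R), sg (r + (2 ^+ n)^-1) = (z n).1 + rho n * r].
  apply: special_curve; apply: rap => n; first by case: (hz n).
  by rewrite gtr0_norm.
have [tu [stu _ htu]] : exists tu : R -> R, [/\ smooth_curve tu, tu 0 = 0 &
    forall n, \forall r \near (0 : R), tu (r + (2 ^+ n)^-1) = ((z n).2 - t0) + 0 * r].
  apply: special_curve; apply: rap => n; first by case: (hz n).
  by rewrite normr0 ltW.
pose c r := H (sg r) (t0 + tu r).
have sc : smooth_curve c.
  by apply: sH => //; apply: smoothD => //; exact: smooth_cst.
have cE n : dern k c (2 ^+ n)^-1 = rho n ^+ k *: dern k (H^~ (z n).2) (z n).1.
  have := @dern_shift F c (2 ^+ n)^-1 k 0 hF sc; rewrite add0r => <-.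
  have sHz := smooth_plane_curve (z n).2 sH.
  have := @dern_affine F (H^~ (z n).2) (z n).1 (rho n) k 0 hF sHz.
  rewrite mulr0 addr0 => <-; apply: dern_near_eq.
  apply: filterS (filterI (hsg n) (htu n)) => r [h1 h2].
  by rewrite /c h1 h2 mul0r addr0 [t0 + _]addrC subrK.
have [d d0 [C [C0 hC]]] := smooth_local_bound sp sc k.
(* [N > d^-1] puts the parameter [2 ^- N] within the radius [d] of the local bound, and [N > C]
   contradicts that bound. *)
have [N hN'] : exists N : nat, C + d^-1 < N%:R.
  by exists (Num.bound (C + d^-1)); apply: archi_boundP; rewrite addr_ge0// invr_ge0 ltW.
have d'0 : 0 < d^-1 by rewrite invr_gt0.
have := hC (2 ^+ N)^-1; rewrite cE gtr0_norm ?invr_gt0 ?exprn_gt0// => h1.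
have {}h1 : p (rho N ^+ k *: dern k (H^~ (z N).2) (z N).1) <= C.
  apply: h1; rewrite -[d]invrK lef_pV2 ?posrE ?exprn_gt0//.
  apply: (@le_trans _ _ (N%:R)); first lra.
  by rewrite -natrX ler_nat ltnW// ltn_expl.
have [_ _] := hz N; rewrite ltr_pdivrMr ?exprn_gt0//.
move: h1; rewrite (seminormZ sp) gtr0_norm ?exprn_gt0// mulrC; lra.
Qed.

Lemma plane_taylor (p : F -> R) (H : R -> R -> F) (t0 : R) m :
  continuous_seminorm p -> smooth_plane H ->
  exists2 d : R, 0 < d & exists2 C : R, 0 <= C & forall s t : R,
    `|s| <= d -> `|t - t0| <= d -> p (H s t - taylor m (H^~ t) s) <= C * `|s| ^+ m.
Proof.
move=> sp sH; have [d d0 [C hC]] := plane_local_bound t0 m sp sH.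
exists d => //; exists C.
  by apply: le_trans (seminorm_ge0 sp _) (hC 0 t0 _ _); rewrite ?subrr normr0 ltW.
move=> s t hs ht; apply: (taylor_seminorm sp (smooth_plane_curve t sH) _ hs) => r hr.
exact: hC.
Qed.

(** Inverting a Vandermonde matrix at the nodes 0, ..., [N] gives a finite difference that is exact
    for the [k]-th derivative at 0 of polynomials of degree at most [N]. *)
Lemma difference_weights N k : (k <= N)%N ->
  exists al : 'I_N.+1 -> R, forall r : 'I_N.+1,
    \sum_i al i * (i%:R : R) ^+ r = k`!%:R *+ (r == k :> nat).
Proof.
move=> kN; pose V : 'M[R]_N.+1 := Vandermonde N.+1 (\row_(j < N.+1) (j%:R : R)).
have Vu : V \in unitmx.
  rewrite unitmxE det_Vandermonde unitfE prodf_seq_neq0; apply/allP => i _ /=.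
  rewrite prodf_seq_neq0; apply/allP => j _; apply/implyP => ij.
  by rewrite !mxE subr_eq0 eqr_nat gt_eqF.
have kN' : (k < N.+1)%N by [].
pose w : 'cV[R]_N.+1 := invmx V *m (k`!%:R *: delta_mx (Ordinal kN') 0).
exists (fun i => w i 0) => r.
have /matrixP/(_ r 0) : V *m w = k`!%:R *: delta_mx (Ordinal kN') 0.
  by rewrite /w mulKVmx.
rewrite !mxE => h; under eq_bigr do rewrite mulrC.
transitivity (\sum_j V r j * w j 0); first by apply: eq_bigr => j _; rewrite !mxE.
by rewrite h andbT mulr_natr; congr (_ *+ nat_of_bool _); rewrite -val_eqE.
Qed.

(** The weights annihilate every term of the Taylor polynomial except the one of degree [k]; the
    uniform Taylor remainder at the nodes [i * e] bounds the rest. The radius is divided by [N.+1]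
    to keep all nodes within reach. *)
Lemma difference_quotient (p : F -> R) (H : R -> R -> F) (t0 : R) N k
    (al : 'I_N.+1 -> R) :
  (k <= N)%N ->
  (forall r : 'I_N.+1, \sum_i al i * (i%:R : R) ^+ r = k`!%:R *+ (r == k :> nat)) ->
  continuous_seminorm p -> smooth_plane H ->
  exists2 d : R, 0 < d & exists2 C : R, 0 <= C & forall e t : R,
    `|e| <= d -> `|t - t0| <= d ->
    p (\sum_i al i *: H (i%:R * e) t - e ^+ k *: dern k (H^~ t) 0) <= C * `|e| ^+ N.+1.
Proof.
move=> kN hal sp sH; have [d d0 [C C0 hC]] := plane_taylor t0 N.+1 sp sH.
exists (d / N.+1%:R); first by rewrite divr_gt0.
exists (\sum_i `|al i| * C * (N.+1%:R ^+ N.+1)).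
  by apply: sumr_ge0 => i _; rewrite !mulr_ge0// exprn_ge0.
move=> e t he ht.
have tT : `|t - t0| <= d.
  by apply: le_trans ht _; rewrite ler_pdivrMr// ler_peMr ?(ltW d0)// ler1n.
have -> : e ^+ k *: dern k (H^~ t) 0 = \sum_i al i *: taylor N.+1 (H^~ t) (i%:R * e).
  rewrite /taylor; under eq_bigr do rewrite scaler_sumr.
  rewrite exchange_big /=.
  transitivity (\sum_(j < N.+1) (e ^+ j *+ (j == k :> nat)) *: dern j (H^~ t) 0).
    rewrite (bigD1 (Ordinal (kN : (k < N.+1)%N)))//= eqxx mulr1n big1 ?addr0// => j.
    by rewrite -val_eqE /= => /negbTE ->; rewrite mulr0n scale0r.
  apply: eq_bigr => j _; under eq_bigr do rewrite scalerA.
  rewrite -scaler_suml; congr (_ *: _); rewrite /mono.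
  under eq_bigr do rewrite exprMn -mulrA mulrA.
  rewrite -mulr_suml hal; case: eqP => [->|_]; last by rewrite !mulr0n mul0r.
  by rewrite !mulr1n mulrCA mulfV ?mulr1// pnatr_eq0 -lt0n fact_gt0.
rewrite -sumrB; apply: le_trans (seminorm_sum sp _ _ _) _; rewrite mulr_suml.
apply: ler_sum => i _; rewrite -scalerBr (seminormZ sp) -!mulrA ler_wpM2l//.
have ie : `|i%:R * e| <= N.+1%:R * `|e|.
  by rewrite normrM normr_nat ler_wpM2r// ler_nat ltnW.
apply: le_trans (hC _ _ _ tT) _.
  by apply: le_trans ie _; rewrite mulrC -ler_pdivlMr.
by rewrite -exprMn ler_wpM2l// lerXn2r// nnegrE// mulr_ge0.
Qed.

(** The constant term is the limit at 0, hence vanishes; division by [e] then lowers the degree. *)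
Lemma asymptotic_poly_eq0 k (v : nat -> F) :
  (forall p, continuous_seminorm p -> forall eta : R, 0 < eta ->
    exists2 d : R, 0 < d & forall e : R, 0 < e <= d ->
      p (\sum_(j < k.+1) e ^+ j *: v j) <= eta * e ^+ k) ->
  forall j, (j <= k)%N -> v j = 0.
Proof.
elim: k v => [|k IH] v H.
  case=> // _; apply: (seminorm_eq0 hF) => p sp; apply/eqP.
  rewrite eq_le (seminorm_ge0 sp) andbT; apply/ler_addgt0Pr => eta eta0; rewrite add0r.
  have [d d0 /(_ d)] := H p sp eta eta0.
  by rewrite d0 lexx big_ord_recl big_ord0 addr0 !expr0 scale1r mulr1; apply.
have v0 : v 0%N = 0.
  apply: (seminorm_eq0 hF) => p sp; apply/eqP.
  rewrite eq_le (seminorm_ge0 sp) andbT; apply/ler_addgt0Pr => eta eta0; rewrite add0r.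
  have [d d0 hd] := H p sp 1 ltr01.
  pose K : R := 1 + \sum_(j < k.+1) p (v j.+1).
  have K0 : 0 < K by rewrite ltr_wpDr//; apply: sumr_ge0 => j _; exact: (seminorm_ge0 sp).
  pose e := Num.min (Num.min d 1) (eta / K).
  have e0 : 0 < e by rewrite !lt_min d0 ltr01 divr_gt0.
  have ed : e <= d by rewrite !ge_min lexx.
  have e1 : e <= 1 by rewrite !ge_min lexx orbT.
  have eK : e <= eta / K by rewrite ge_min lexx orbT.
  have pow (j : nat) : e ^+ j.+1 <= e.
    by rewrite exprS -[leRHS]mulr1 ler_wpM2l ?(ltW e0)// exprn_ile1// ltW.
  have := hd e; rewrite e0 ed => /(_ isT); rewrite big_ord_recl expr0 scale1r mul1r.
  set S := \sum_(i < _) _ => h1; have {}h1 : p (v 0%N + S) <= e ^+ k.+1 by [].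
  have h2 : p S <= e * \sum_(j < k.+1) p (v j.+1).
    apply: le_trans (seminorm_sum sp _ _ _) _; rewrite mulr_sumr; apply: ler_sum => j _.
    rewrite (seminormZ sp) ger0_norm ?exprn_ge0 ?(ltW e0)//.
    exact: (ler_wpM2r (seminorm_ge0 sp _) (pow j)).
  have -> : v 0%N = (v 0%N + S) - S by rewrite addrK.
  apply: le_trans (seminormD sp _ _) _; rewrite (seminormN sp).
  have := pow k; move: eK; rewrite ler_pdivlMr// /K mulrDr mulr1; lra.
case=> // j jk; apply: (IH (fun i => v i.+1)) => // p sp eta eta0.
have [d d0 hd] := H p sp eta eta0; exists d => // e /[dup] he /andP[e0 _].
have := hd e he; rewrite big_ord_recl v0 scaler0 add0r.
under eq_bigr do rewrite exprS -scalerA.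
rewrite -scaler_sumr (seminormZ sp) gtr0_norm// exprS mulrCA.
by rewrite ler_pM2l.
Qed.

(** For one fixed small [e], the finite difference [S t] is continuous in [t] and approximates
    [e ^+ k] times the derivative, uniformly for [t] near [t0]; the error [eta] splits as 1/4 + 1/2
    + 1/4. *)
Lemma partial_continuous (H : R -> R -> F) k (t0 : R) : smooth_plane H ->
  (fun t => dern k (H^~ t) 0) @ t0 --> dern k (H^~ t0) 0.
Proof.
move=> sH; apply: cvg_seminorm => p sp eta eta0.
have [al hal] := difference_weights (leqnSn k).
have [d d0 [C C0 hC]] := difference_quotient t0 (leqnSn k) hal sp sH.
pose e := Num.min (Num.min d 1) (eta / (4 * (C + 1))).
have C1 : 0 < C + 1 by rewrite ltr_wpDl.
have e0 : 0 < e by rewrite !lt_min d0 ltr01 divr_gt0// mulr_gt0.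
have ed : `|e| <= d by rewrite gtr0_norm// !ge_min lexx.
have e1 : e <= 1 by rewrite !ge_min lexx orbT.
have eC : e <= eta / (4 * (C + 1)) by rewrite ge_min lexx orbT.
have ek0 : 0 < e ^+ k by rewrite exprn_gt0.
pose S t := \sum_i al i *: H (i%:R * e) t.
have sS : smooth_curve S.
  apply: smooth_sum => // i _; apply: smoothZ => //; first exact: smooth_cst.
  by apply: (sH (fun=> i%:R * e) id); [exact: smooth_cst|exact: smooth_id].
have h1 : \forall t \near t0, p (S t - S t0) < e ^+ k * (eta / 2).
  have := @seminorm_cvg _ _ _ sp _ _ _ _ _ (smooth_curve_continuous (t := t0) sS).
  by apply; rewrite mulr_gt0// divr_gt0.
have h2 : \forall t \near t0, `|t - t0| <= d.
  have : nbhs t0 (ball t0 d) by exact: nbhsx_ballx.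
  by apply: filterS => t; rewrite /ball /= distrC => /ltW.
apply: filterS (filterI h1 h2) => t [ht1 ht2].
rewrite -(ltr_pM2l ek0) -{1}[e ^+ k]gtr0_norm// -(seminormZ sp) scalerBr.
have g1 := hC e t ed ht2.
have g2 : p (S t0 - e ^+ k *: dern k (H^~ t0) 0) <= C * `|e| ^+ k.+2.
  by apply: hC => //; rewrite subrr normr0 ltW.
rewrite -/(S t) (seminormB sp) in g1.
have := seminorm_tri sp (e ^+ k *: dern k (H^~ t) 0) (S t) (e ^+ k *: dern k (H^~ t0) 0).
have := seminorm_tri sp (S t) (S t0) (e ^+ k *: dern k (H^~ t0) 0).
have g3 : C * `|e| ^+ k.+2 <= e ^+ k * (eta / 4).
  rewrite gtr0_norm// !exprSr mulrC -!mulrA ler_pM2l//.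
  apply: (@le_trans _ _ (e * (C + 1))).
    rewrite ler_pM2l//; apply: (@le_trans _ _ C); last by rewrite lerDl.
    by rewrite ler_piMl.
  move: eC; rewrite ler_pdivlMr ?mulr_gt0//; lra.
have g4 : e ^+ k * (eta / 2) = e ^+ k * (eta / 4) + e ^+ k * (eta / 4) by field.
have g5 : e ^+ k * eta = 4 * (e ^+ k * (eta / 4)) by field.
lra.
Qed.

(* With weights [al] for the [k]-th derivative, let
   [W0 s t = \sum_i al i *: (H (i s) (t + s) - H (i s) t)]. Then
   [W0 e t = e ^+ k *: (G (t + e) - G t)] up to terms of order [k + 2], where
   [G t] is the [k]-th derivative of [H^~ t], so that the Taylor expansion of
   [W0^~ t] yields the derivative of [G]. *)
Lemma partial_derivative (H : R -> R -> F) k : smooth_plane H ->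
  exists2 W : R -> R -> F, smooth_plane W & forall t,
    curve_derivative (fun t => dern k (H^~ t) 0) t (dern k.+1 (W^~ t) 0).
Proof.
move=> sH; have [al hal] := difference_weights (leqnSn k).
pose W0 (s t : R) := \sum_i al i *: (H (i%:R * s) (t + s) - H (i%:R * s) t).
have sW0 : smooth_plane W0.
  move=> sg tu hs ht; apply: smooth_sum => // i _; apply: smoothZ => //.
    exact: smooth_cst.
  have hi : smooth_curve (fun r => i%:R * sg r).
    by apply: smoothM => //; exact: smooth_cst.
  by apply: smoothB => //; apply: sH => //; apply: smoothD.
(* The derivative of order [k.+1] enters the Taylor expansion of [W0^~ t] divided by [(k.+1)!]. *)
pose W (s t : R) := (k.+1`!%:R)^-1 *: W0 s t.
have sW : smooth_plane W.
  by move=> sg tu hs ht; apply: smoothZ => //; [exact: smooth_cst|exact: sW0].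
have WE t : dern k.+1 (W^~ t) 0 = (k.+1`!%:R)^-1 *: dern k.+1 (W0^~ t) 0.
  have sWt := smooth_plane_curve t sW0.
  have dE n s : dern n (W^~ t) s = (k.+1`!%:R)^-1 *: dern n (W0^~ t) s.
    elim: n s => // n IH s; rewrite [LHS]/(tderive (dern n (W^~ t)) 1 s).
    rewrite (_ : dern n (W^~ t) = fun s => (k.+1`!%:R)^-1 *: dern n (W0^~ t) s); last exact/funext.
    by apply: (curve_derivativeE hF); apply: curve_derivativeZr; exact: smooth_dern.
  exact: dE.
exists W => // t0; rewrite WE; set G := fun t => _.
pose w := W0^~ t0; have sw : smooth_curve w by exact: smooth_plane_curve.
have bd p : continuous_seminorm p -> exists2 d : R, 0 < d & exists2 C : R, 0 <= C &
    forall e : R, `|e| <= d ->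
    p (e ^+ k *: (G (e + t0) - G t0) - taylor k.+2 w e) <= C * `|e| ^+ k.+2.
  move=> sp; have [d1 d10 [C1 C10 h1]] := difference_quotient t0 (leqnSn k) hal sp sH.
  have [d2 d20 [C2 C20 h2]] := taylor_peano k.+2 sp sw.
  exists (Num.min d1 d2); first by rewrite lt_min d10.
  exists (C1 + C1 + C2); first by rewrite !addr_ge0.
  move=> e; rewrite le_min => /andP[e1 e2].
  have g1 := h1 e (e + t0) e1; rewrite addrK in g1; have {}g1 := g1 e1.
  have g2 := h1 e t0 e1; rewrite subrr normr0 in g2; have {}g2 := g2 (ltW d10).
  have g3 := h2 e e2.
  have -> : e ^+ k *: (G (e + t0) - G t0) - taylor k.+2 w e =
      (e ^+ k *: (G (e + t0) - G t0) - w e) + (w e - taylor k.+2 w e).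
    by lmod_ring R F.
  apply: le_trans (seminormD sp _ _) _; rewrite mulrDl; apply: lerD => //.
  have -> : e ^+ k *: (G (e + t0) - G t0) - w e =
     (\sum_i al i *: H (i%:R * e) t0 - e ^+ k *: G t0) -
     (\sum_i al i *: H (i%:R * e) (e + t0) - e ^+ k *: G (e + t0)).
    have -> : w e = \sum_i al i *: H (i%:R * e) (e + t0) -
                    \sum_i al i *: H (i%:R * e) t0.
      by rewrite /w /W0 -sumrB; apply: eq_bigr => i _; rewrite scalerBr [t0 + e]addrC.
    by lmod_ring R F.
  apply: le_trans (seminormD sp _ _) _; rewrite (seminormN sp) mulrDl.
  exact: lerD.
(* By continuity of [G], the left-hand side [e ^+ k *: (G (e + t0) - G t0)] is of smaller order than
   [e ^+ k], so the Taylor coefficients of [w] up to order [k] vanish. *)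
have w0 j : (j <= k)%N -> (j`!%:R : R)^-1 *: dern j w 0 = 0.
  apply: (@asymptotic_poly_eq0 k (fun j => (j`!%:R : R)^-1 *: dern j w 0)) => p sp eta eta0.
  have [d1 d10 [C1 C10 h1]] := bd p sp.
  have e2 : 0 < eta / 2 by rewrite divr_gt0.
  have : \forall e \near (0 : R), p (G (e + t0) - G t0) < eta / 2.
    have hG : G @ t0 --> G t0 by exact: partial_continuous.
    have h : (fun e : R => e + t0) @ 0 --> t0.
      by rewrite -{2}(add0r t0); apply: cvgD; [exact: cvg_id|exact: cvg_cst].
    exact: (seminorm_cvg sp (cvg_comp _ _ h hG) e2).
  move=> /nbhs_ballP[d2 /= d20 h2].
  pose K := C1 + p ((k.+1`!%:R)^-1 *: dern k.+1 w 0) + 1.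
  have K0 : 0 < K by rewrite ltr_wpDl// addr_ge0// (seminorm_ge0 sp).
  exists (Num.min (Num.min d1 (d2 / 2)) (Num.min 1 (eta / 2 / K))).
    by rewrite !lt_min d10 ltr01 !divr_gt0.
  move=> e; rewrite !le_min => /andP[e0 /andP[/andP[ed1 ed2] /andP[e1 eK]]].
  have g1 := h1 e; rewrite gtr0_norm// in g1; have {}g1 := g1 ed1.
  have g2 : p (G (e + t0) - G t0) < eta / 2.
    apply: h2; rewrite /ball /= sub0r normrN gtr0_norm//.
    by apply: le_lt_trans ed2 _; rewrite ltr_pdivrMr// ltr_pMr// ltr1n.
  have ek0 : 0 < e ^+ k by rewrite exprn_gt0.
  have -> : \sum_(j < k.+1) e ^+ j *: ((j`!%:R : R)^-1 *: dern j w 0) =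
      e ^+ k *: (G (e + t0) - G t0) -
      (e ^+ k *: (G (e + t0) - G t0) - taylor k.+2 w e) -
      e ^+ k.+1 *: ((k.+1`!%:R)^-1 *: dern k.+1 w 0).
    have -> : taylor k.+2 w e = \sum_(j < k.+1) e ^+ j *: ((j`!%:R : R)^-1 *: dern j w 0) +
        e ^+ k.+1 *: ((k.+1`!%:R)^-1 *: dern k.+1 w 0).
      rewrite /taylor big_ord_recr; congr (_ + _); last by rewrite scalerA.
      by apply: eq_bigr => i _; rewrite scalerA.
    by lmod_ring R F.
  apply: le_trans (seminormD sp _ _) _; rewrite (seminormN sp).
  apply: le_trans (lerD (seminormD sp _ _) (lexx _)) _; rewrite (seminormN sp).
  rewrite !(seminormZ sp _ (_ - _)) [`|e ^+ k|]gtr0_norm//.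
  rewrite (seminormZ sp (e ^+ k.+1)) gtr0_norm ?exprn_gt0//.
  have q0 : 0 <= p ((k.+1`!%:R)^-1 *: dern k.+1 w 0) by exact: (seminorm_ge0 sp).
  set q := p (_^-1 *: _) in q0 K K0 eK *.
  have g3 : e ^+ k * p (G (e + t0) - G t0) <= e ^+ k * (eta / 2).
    by rewrite ler_pM2l// ltW.
  have g4 : C1 * e ^+ k.+2 + e ^+ k.+1 * q <= e ^+ k * (eta / 2).
    rewrite !exprSr mulrC -!mulrA -mulrDr ler_pM2l//.
    apply: (@le_trans _ _ (e * K)); last by rewrite -ler_pdivlMr.
    rewrite -mulrDr ler_pM2l// /K.
    have : e * C1 <= C1 by rewrite ler_piMl.
    lra.
  rewrite [eta * _]mulrC; have -> : e ^+ k * eta = e ^+ k * (eta / 2) + e ^+ k * (eta / 2) by field.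
  lra.
(* Only the coefficient of order [k.+1] is left; dividing [bd] by [e ^+ k] leaves a quadratic
   error. *)
apply: curve_derivative_quadratic => p sp; have [d1 d10 [C1 C10 h1]] := bd p sp.
exists d1 => //; exists C1 => e ed1.
have [->|eN] := eqVneq e 0.
  by rewrite add0r subrr scale0r subrr (seminorm0 sp) normr0 expr0n mulr0.
have ek0 : 0 < `|e ^+ k| by rewrite normr_gt0 expf_neq0.
rewrite -(ler_pM2l ek0) -(seminormZ sp) scalerBr scalerA -exprSr.
have := h1 e ed1; rewrite /taylor big_ord_recr /= big1 ?add0r => [|j _]; last first.
  by rewrite /mono -scalerA w0 ?scaler0// -ltnS.
rewrite /mono -scalerA => h; apply: le_trans h _.
by rewrite normrX [leRHS]mulrCA -exprD addn2.
Qed.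

(** The derivative is again a partial derivative of a smooth plane map, of order one higher, so that
    differentiation can be iterated. *)
Theorem smooth_partial (H : R -> R -> F) k : smooth_plane H ->
  smooth_curve (fun t => dern k (H^~ t) 0).
Proof.
move=> sH; apply/smooth_curveP => n; elim: n H k sH => // n IH H k sH.
have [W sW hW] := partial_derivative k sH.
exact: (ndiffS hF hW (IH W k.+1 sW)).
Qed.

(** Taylor expansion in the first variable, uniform in the second, gives [H r r - H 0 r = r *: G r]
    up to a quadratic error, where the partial derivative [G] is continuous. *)
Lemma plane_chain0 (H : R -> R -> F) : smooth_plane H ->
  curve_derivative (fun r => H r r) 0
    (dern 1 (H^~ 0) 0 + dern 1 (H 0) 0).
Proof.
move=> sH; rewrite (_ : (fun r => H r r) = fun r => (H r r - H 0 r) + H 0 r); last first.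
  by apply/funext => r; rewrite subrK.
apply: curve_derivativeD; last first.
  by apply: (smooth_dern 0 0); exact: (smooth_plane_curve 0 (smooth_plane_swap sH)).
apply: curve_derivativeI => p sp e e0.
have [d d0 [C C0 hC]] := plane_taylor 0 2 sp sH.
pose G t := dern 1 (H^~ t) 0.
have e2 : 0 < e / 2 by rewrite divr_gt0.
have hG : \forall h \near (0 : R), p (G h - G 0) < e / 2.
  exact: (seminorm_cvg sp (smooth_curve_continuous (smooth_partial 1 sH)) e2).
have C1 : 0 < 2 * (C + 1) by rewrite mulr_gt0// ltr_wpDl.
have hn : nbhs (0 : R) (ball (0 : R) (Num.min d (e / (2 * (C + 1))))).
  by apply: nbhsx_ballx; rewrite lt_min d0 divr_gt0.
apply: filterS (filterI hG hn) => h [h1]; rewrite /ball /= sub0r normrN lt_min => /andP[hd he].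
have := hC h h (ltW hd); rewrite subr0 => /(_ (ltW hd)).
rewrite /taylor !big_ord_recl big_ord0 addr0 /mono /= expr0 fact0 divr1 scale1r expr1 divr1.
rewrite -/(G h) => g1.
rewrite addr0 subrr subr0 -/(G 0).
have -> : H h h - H 0 h - h *: G 0 = (H h h - (H 0 h + h *: G h)) + h *: (G h - G 0).
  by rewrite scalerBr opprD !addrA subrK.
apply: le_trans (seminormD sp _ _) _; rewrite (seminormZ sp).
have g2 : C * `|h| ^+ 2 <= e / 2 * `|h|.
  rewrite expr2 mulrA ler_wpM2r//; move: he; rewrite ltr_pdivlMr//.
  have -> : `|h| * (2 * (C + 1)) = 2 * (C * `|h|) + 2 * `|h| by ring.
  have := normr_ge0 h; lra.
have g3 : `|h| * p (G h - G 0) <= `|h| * (e / 2) by rewrite ler_wpM2l// ltW.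
have -> : e * `|h| = e / 2 * `|h| + `|h| * (e / 2) by field.
lra.
Qed.

Lemma plane_chain (H : R -> R -> F) (t : R) : smooth_plane H ->
  curve_derivative (fun r => H r r) t
    (dern 1 (H^~ t) t + dern 1 (H t) t).
Proof.
move=> sH; pose K a b := H (a + t) (b + t).
have sK : smooth_plane K.
  by move=> a b ha hb; apply: sH; apply: smoothD => //; exact: smooth_cst.
have := plane_chain0 sK.
have -> : dern 1 (K^~ 0) 0 = dern 1 (H^~ t) t.
  have := @dern_shift F (H^~ t) t 1 0 hF (smooth_plane_curve _ sH).
  by rewrite /K !add0r.
have -> : dern 1 (K 0) 0 = dern 1 (H t) t.
  have := @dern_shift F (H t) t 1 0 hF (smooth_plane_curve _ (smooth_plane_swap sH)).
  by rewrite /K !add0r.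
move=> /curve_derivativeP[Q [Ql Q0 hQ]]; apply/curve_derivativeP; exists Q; split => // h.
by have := hQ h; rewrite /K addr0 add0r.
Qed.

(** Expand [H h t] to second order in its first variable at [t = h] and [t = 0]. The first-order
    terms differ by [h *: (G 1 h - G 1 0)], that is [h ^+ 2 *: l] up to smaller order, and the
    second-order terms by a smaller order because [G 2] is continuous. *)
Lemma mixed_difference (H : R -> R -> F) (p : F -> R) :
  smooth_plane H -> continuous_seminorm p -> forall e : R, 0 < e ->
  \forall h \near (0 : R),
    p (H h h - H h 0 - H 0 h + H 0 0 -
       h ^+ 2 *: dern 1 (fun t : R => dern 1 (H^~ t) 0) 0) <= e * `|h| ^+ 2.
Proof.
move=> sH sp e e0; have [d d0 [C C0 hC]] := plane_taylor 0 3 sp sH.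
pose G k t := dern k (H^~ t) 0.
have sG k : smooth_curve (G k) by exact: smooth_partial.
set l := dern 1 (fun t : R => _) 0; have dG : curve_derivative (G 1%N) 0 l by exact: (smooth_dern 0 0 (sG 1%N)).
have e4 : 0 < e / 4 by rewrite divr_gt0.
have h1 := curve_derivative_seminorm sp dG e4.
have h2 : \forall h \near (0 : R), p (G 2%N h - G 2%N 0) < e / 4.
  exact: (seminorm_cvg sp (smooth_curve_continuous (sG 2%N)) e4).
have C1 : 0 < 8 * (C + 1) by rewrite mulr_gt0// ltr_wpDl.
have hn : nbhs (0 : R) (ball (0 : R) (Num.min d (e / (8 * (C + 1))))).
  by apply: nbhsx_ballx; rewrite lt_min d0 divr_gt0.
apply: filterS (filterI h1 (filterI h2 hn)) => h [k1 [k2]].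
rewrite /ball /= sub0r normrN lt_min => /andP[hd he].
have q1 := hC h h (ltW hd); rewrite subr0 in q1; have {}q1 := q1 (ltW hd).
have q2 := hC h 0 (ltW hd); rewrite subr0 normr0 in q2; have {}q2 := q2 (ltW d0).
rewrite addr0 in k1.
have tE t : taylor 3 (H^~ t) h = H 0 t + (h *: G 1%N t + (h ^+ 2 / 2) *: G 2%N t).
  rewrite /taylor !big_ord_recl big_ord0 addr0 /mono /= expr0 fact0 divr1 scale1r.
  by rewrite expr1 divr1.
rewrite !tE in q1 q2.
have -> : H h h - H h 0 - H 0 h + H 0 0 - h ^+ 2 *: l =
   (H h h - (H 0 h + (h *: G 1%N h + (h ^+ 2 / 2) *: G 2%N h))) -
   (H h 0 - (H 0 0 + (h *: G 1%N 0 + (h ^+ 2 / 2) *: G 2%N 0))) +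
   (h *: (G 1%N h - G 1%N 0 - h *: l) + (h ^+ 2 / 2) *: (G 2%N h - G 2%N 0)).
  by lmod_ring R F.
apply: le_trans (seminormD sp _ _) _.
apply: le_trans (lerD (seminormD sp _ _) (seminormD sp _ _)) _.
rewrite (seminormN sp) !(seminormZ sp) normrM normfV normrX.
have n0 := normr_ge0 h.
have r1 : C * `|h| ^+ 3 <= e / 8 * `|h| ^+ 2.
  rewrite exprS mulrA ler_wpM2r ?exprn_ge0//; move: he; rewrite ltr_pdivlMr//.
  have -> : `|h| * (8 * (C + 1)) = 8 * (C * `|h|) + 8 * `|h| by ring.
  clear -n0; lra.
have r2 : `|h| * p (G 1%N h - G 1%N 0 - h *: l) <= e / 4 * `|h| ^+ 2.
  by apply: le_trans (ler_wpM2l n0 k1) _; rewrite expr2 mulrCA.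
have r3 : `|h| ^+ 2 / `|2| * p (G 2%N h - G 2%N 0) <= e / 4 * `|h| ^+ 2.
  rewrite [leRHS]mulrC -mulrA ler_wpM2l ?exprn_ge0//.
  rewrite (gtr0_norm (ltr0n R 2)) //; move: (seminorm_ge0 sp (G 2%N h - G 2%N 0)) k2.
  by move: (p _) => q; clear; lra.
have r4 : 0 <= e * `|h| ^+ 2 by rewrite mulr_ge0 ?exprn_ge0// ltW.
apply: le_trans (lerD (lerD q1 q2) (lerD r2 r3)) _.
apply: le_trans (lerD (lerD r1 r1) (lexx _)) _.
rewrite -!mulrDl ler_wpM2r ?exprn_ge0//; clear -e0; lra.
Qed.

(* Both sides are the limit of
   [(H h h - H h 0 - H 0 h + H 0 0) / h ^+ 2]. *)
Lemma plane_schwarz (H : R -> R -> F) : smooth_plane H ->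
  dern 1 (fun t : R => dern 1 (H^~ t) 0) 0 =
  dern 1 (fun s : R => dern 1 (H s) 0) 0.
Proof.
move=> sH; set a := LHS; set b := RHS; apply/eqP; rewrite -subr_eq0; apply/eqP.
apply: (seminorm_eq0 hF) => p sp; apply/eqP; rewrite eq_le (seminorm_ge0 sp) andbT.
apply/ler_addgt0Pr => e e0; rewrite add0r.
have e2 : 0 < e / 2 by rewrite divr_gt0.
have h1 := mixed_difference sH sp e2.
have h2 := mixed_difference (smooth_plane_swap sH) sp e2.
have hn := @filterI _ _ (nbhs_filter (0 : R)) _ _ h1 h2.
move/nbhs_ballP: hn => [d /= d0 hd].
pose h := d / 2; have h0 : 0 < h by rewrite divr_gt0.
have [] := hd h; first by rewrite /ball /= sub0r normrN gtr0_norm// ltr_pdivrMr// ltr_pMr// ltr1n.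
rewrite -/a -/b gtr0_norm//.
have -> : H h h - H 0 h - H h 0 + H 0 0 = H h h - H h 0 - H 0 h + H 0 0.
  by rewrite (addrAC (H h h)).
set D := _ + H 0 0 => k1 k2.
rewrite -(ler_pM2l (exprn_gt0 2 h0)) -{1}[h ^+ 2]gtr0_norm ?exprn_gt0// -(seminormZ sp) scalerBr.
rewrite (seminormB sp) in k1.
have := seminorm_tri sp (h ^+ 2 *: a) D (h ^+ 2 *: b).
have -> : h ^+ 2 * e = e / 2 * h ^+ 2 + e / 2 * h ^+ 2 by field.
lra.
Qed.
End PlaneTheory.
End Plane.

(** * Smooth maps and their derivatives *)

Section SmoothMaps.
Context (R : realType).
Implicit Types (E F : tvsType R).
Let hR := @Rhausdorff R.

(** Otherwise parameters [z n] tending rapidly to 0 have [X (z n)] outside [U]. A smooth curve takes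
    these values at [2 ^- n] and 0 at 0, whereas the preimage of [U] along it is an open set
    containing 0. *)
Lemma cinf_open_box E (I : finType) (U : set E) (X : (I -> R) -> E) :
  cinf_open U ->
  (forall sg : I -> R -> R, (forall i, smooth_curve (sg i)) ->
    smooth_curve (fun r => X (sg^~ r))) ->
  U (X (fun=> 0)) ->
  exists2 d : R, 0 < d & forall a : I -> R, (forall i, `|a i| <= d) -> U (X a).
Proof.
move=> oU sX U0; apply: contrapT => hN.
pose rho n : R := ((2 ^+ n) ^+ n)^-1.
have rho0 n : 0 < rho n by rewrite invr_gt0 !exprn_gt0.
have /choice[z hz] : forall n, exists z : I -> R, (forall i, `|z i| <= rho n) /\ ~ U (X z).
  move=> n; apply: contrapT => hn; apply: hN; exists (rho n) => // a ha.
  by apply: contrapT => nU; apply: hn; exists a.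
have /choice[sg hsg] : forall i, exists sg : R -> R, [/\ smooth_curve sg, sg 0 = 0 &
    forall n, \forall r \near (0 : R), sg (r + (2 ^+ n)^-1) = z n i + 0 * r].
  move=> i; apply: special_curve; apply: rapid_square => n.
    by rewrite -ler_pdivlMr ?exprn_gt0 ?exprn_gt0// div1r; case: (hz n).
  by rewrite normr0 mul0r.
have sc : smooth_curve (fun r => X (sg^~ r)) by apply: sX => i; case: (hsg i).
have := oU _ sc; rewrite openE => /(_ 0).
have e0 : sg^~ 0 = fun=> 0 by apply/funext => i; case: (hsg i).
rewrite /= e0 => /(_ U0) /nbhs_ballP[d /= d0 hd].
have [N hN'] : exists N : nat, d^-1 < N%:R.
  by exists (Num.bound d^-1); apply: archi_boundP; rewrite invr_ge0 ltW.
have : U (X (sg^~ (2 ^+ N)^-1)).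
  apply: hd; rewrite /ball /= sub0r normrN gtr0_norm ?invr_gt0 ?exprn_gt0//.
  rewrite -[ltRHS]invrK ltf_pV2 ?posrE ?exprn_gt0 ?invr_gt0//.
  by apply: (lt_le_trans hN'); rewrite -natrX ler_nat ltnW// ltn_expl.
have -> : sg^~ (2 ^+ N)^-1 = z N; last by case: (hz N).
apply/funext => i; have [_ _ /(_ N)/nbhs_singleton] := hsg i.
by rewrite add0r mulr0 addr0.
Qed.

(** [smooth_on] tests only curves that stay in [U] at all times. Cutting off both parameters makes a
    plane map that starts in [U] one with all its values in [U], with the same germ at the
    origin. *)
Lemma cinf_open_plane E (U : set E) (X : R -> R -> E) :
  cinf_open U -> smooth_plane X -> U (X 0 0) ->
  exists2 d : R, 0 < d & forall a b, U (X (cutoff d a) (cutoff d b)).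
Proof.
move=> oU sX U0.
have [|d d0 hd] := @cinf_open_box E bool U (fun a => X (a true) (a false)) oU _ U0.
  by move=> sg ssg; apply: sX.
exists d => // a b.
by apply: (hd (fun c => if c then cutoff d a else cutoff d b)) => -[]; rewrite ltW// cutoff_lt.
Qed.

Lemma smooth_curve_comp_local E (k : R -> R) (c : R -> E) : hausdorff_space E ->
  smooth_curve k -> (forall s, smooth_at c (k s)) -> smooth_curve (c \o k).
Proof.
move=> hE sk sc; suff H n m : ndiff n (dern m c \o k).
  by apply/smooth_curveP => n; exact: (H n 0%N).
elim: n m => // n IH m.
apply: (ndiffS hE (c' := fun t => tderive k (1 : R) t *: (dern m.+1 c \o k) t)).
  move=> t; apply: curve_derivative_comp; first exact: (smooth_dern 0 t sk).
  exact/tderive_curve/(sc t m).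
apply: (ndiffZ hE) (IH _); apply: (smooth_curveP _).1.
exact: (smooth_curve_dern 1 sk).
Qed.

Lemma smooth_cutoff_shift (d t : R) : smooth_curve (fun s => t + cutoff d (s - t)).
Proof.
apply: smoothD => //; first exact: smooth_cst.
apply: (smooth_curve_comp hR (k := fun s => s - t)); last exact: smooth_cutoff.
by apply: smoothB => //; [exact: smooth_id|exact: smooth_cst].
Qed.

Lemma near_shift (P : R -> Prop) (t : R) :
  (\forall h \near (0 : R), P h) -> \forall s \near t, P (s - t).
Proof.
have h2 : (fun s => s - t) @ t --> (0 : R).
  by rewrite -(subrr t); apply: cvgB; [exact: cvg_id|exact: cvg_cst].
by move=> /h2.
Qed.

Lemma cutoff_shift_near (d t : R) : 0 < d ->
  \forall s \near t, t + cutoff d (s - t) = s.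
Proof.
move=> d0; apply: filterS (near_shift t (cutoff_near d0)) => s ->.
by rewrite addrC subrK.
Qed.

(** Two cutoffs in this order: the first makes the curve smooth everywhere, and only then does the
    c-infinity-openness of [U] apply, so that the second can keep the curve in [U]. *)
Lemma localize_curve E (U : set E) (c : R -> E) (t : R) : hausdorff_space E ->
  cinf_open U -> (\forall s \near t, smooth_at c s) -> U (c t) ->
  exists c1 : R -> E, [/\ smooth_curve c1, forall s, U (c1 s) &
    \forall s \near t, c s = c1 s].
Proof.
move=> hE oU /nbhs_ballP[d /= d0 hd] Ut.
pose c0 s := c (t + cutoff d (s - t)).
have sc0 : smooth_curve c0.
  apply: (smooth_curve_comp_local hE (smooth_cutoff_shift d t)) => s.
  by apply: hd; rewrite /ball /= opprD addNKr normrN cutoff_lt.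
have := oU c0 sc0; rewrite openE => /(_ t).
rewrite /= /c0 subrr cutoff0 addr0 => /(_ Ut) /nbhs_ballP[e /= e0 he].
exists (fun s => c0 (t + cutoff e (s - t))); split.
- exact: (smooth_curve_comp hE (smooth_cutoff_shift e t) sc0).
- by move=> s; apply: he; rewrite /ball /= opprD addNKr normrN cutoff_lt.
- apply: filterS (filterI (cutoff_shift_near t d0) (cutoff_shift_near t e0)) => s [h1 h2].
  by rewrite h2 /c0 h1.
Qed.

Lemma smooth_on_local E F (U : set E) (f : E -> F) (c : R -> E) (t : R) :
  hausdorff_space E -> cinf_open U -> smooth_on U f ->
  (\forall s \near t, smooth_at c s) -> U (c t) ->
  \forall s \near t, smooth_at (f \o c) s.
Proof.
move=> hE oU sf sc Ut; have [c1 [sc1 Uc1 cc1]] := localize_curve hE oU sc Ut.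
have sfc := sf c1 sc1 Uc1; apply: filterS (near_nearby cc1) => s hs.
by apply: smooth_at_near (sfc s); apply: filterS hs => r /= ->.
Qed.

Lemma tderive_line E F (f : E -> F) v x :
  tderive f v x = dern 1 (fun h : R => f (h *: v + x)) 0.
Proof.
rewrite [RHS]/(tderive _ (1 : R) 0) /tderive; suff -> : tquot (fun h : R => f (h *: v + x)) (1 : R) 0 = tquot f v x by [].
by apply/funext => h; rewrite /tquot [h *: (1 : R)]mulr1 addr0 scale0r add0r.
Qed.

Lemma tderive_eq E F (f g : E -> F) v x :
  (\forall h \near (0 : R), f (h *: v + x) = g (h *: v + x)) ->
  tderive f v x = tderive g v x.
Proof. by move=> h; rewrite [LHS]tderive_line [RHS]tderive_line; exact: dern_near_eq. Qed.

Lemma smooth_line E (v x : E) : hausdorff_space E -> smooth_curve (fun h : R => h *: v + x).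
Proof.
move=> hE; apply: smoothD => //; last exact: smooth_cst.
by apply: smoothZ => //; [exact: smooth_id|exact: smooth_cst].
Qed.

Lemma cinf_open_line E (U : set E) v x : hausdorff_space E -> cinf_open U -> U x ->
  \forall h \near (0 : R), U (h *: v + x).
Proof.
move=> hE oU Ux; have := oU _ (smooth_line v x hE); rewrite openE => /(_ 0).
by rewrite /= scale0r add0r => /(_ Ux).
Qed.

Lemma tderive_eq_on E F (U : set E) (f g : E -> F) v x : hausdorff_space E ->
  cinf_open U -> (forall y, U y -> f y = g y) -> U x -> tderive f v x = tderive g v x.
Proof.
move=> hE oU fg Ux; apply: tderive_eq.
by apply: filterS (cinf_open_line v hE oU Ux) => h /fg.
Qed.

Lemma tderives_eq_on E F (U : set E) (f g : E -> F) vs : hausdorff_space E ->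
  cinf_open U -> (forall y, U y -> f y = g y) ->
  forall x, U x -> tderives f vs x = tderives g vs x.
Proof.
move=> hE oU fg; elim: vs => [|v vs IH] x Ux /=; first exact: fg.
exact: (tderive_eq_on _ hE oU).
Qed.

Fixpoint smooth_curves E (vs : seq (R -> E)) : Prop :=
  if vs is v :: vs' then smooth_curve v /\ smooth_curves vs' else True.

Definition seq_at E (vs : seq (R -> E)) (t : R) : seq E := [seq v t | v <- vs].

Lemma smooth_curves_cst E (vs : seq E) : hausdorff_space E ->
  smooth_curves [seq (fun _ : R => v) | v <- vs].
Proof. by move=> hE; elim: vs => //= v vs IH; split=> //; exact: smooth_cst. Qed.

Lemma seq_at_cst E (vs : seq E) t : seq_at [seq (fun _ : R => v) | v <- vs] t = vs.
Proof. by rewrite /seq_at -map_comp map_id_in. Qed.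

Lemma smooth_curves_cat E (vs ws : seq (R -> E)) :
  smooth_curves vs -> smooth_curves ws -> smooth_curves (vs ++ ws).
Proof. by elim: vs => //= v vs IH [sv /IH h] /h. Qed.

Section OneMap.
Context E F (hE : hausdorff_space E) (hF : hausdorff_space F).
Context (U : set E) (oU : cinf_open U) (f : E -> F) (sf : smooth_on U f).

Lemma smooth_at_shift (G : R -> F) (K : R -> F) (t : R) : smooth_curve K ->
  (\forall h \near (0 : R), K h = G (t + h)) -> smooth_at G t.
Proof.
move=> sK KG; have sK' : smooth_curve (fun s => K (s - t)).
  have := smooth_curve_affine (- t) 1 hF sK; congr smooth_curve.
  by apply/funext => s; rewrite mul1r addrC.
apply: smooth_at_near (sK' t).
by apply: filterS (near_shift t KG) => s ->; rewrite addrC subrK.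
Qed.

(** A directional derivative along moving data is a partial derivative of a plane map, smooth by
    [smooth_partial]. In that plane map the base point depends on both variables and the remaining
    directions on the second only; the separate reparametrization [k] lets the induction hypothesis
    cover this. *)
Lemma smooth_tderives_reparam vs k x : smooth_curves vs -> smooth_curve k ->
  smooth_curve x -> (forall t, U (x t)) ->
  smooth_curve (fun t => tderives f (seq_at vs (k t)) (x t)).
Proof.
elim: vs k x => [|v vs IH] k x /=; first by move=> _ _ sx Ux; exact: sf.
move=> [sv svs] sk sx Ux t0.
pose X s t := x (t0 + t) + s *: v (k (t0 + t)).
have st0 (tu : R -> R) : smooth_curve tu -> smooth_curve (fun r => t0 + tu r).
  by move=> ht; apply: smoothD => //; exact: smooth_cst.
have sX : smooth_plane X.
  move=> sg tu hs ht; apply: smoothD => //.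
    exact: (smooth_curve_comp hE (st0 _ ht) sx).
  apply: smoothZ => //; apply: (smooth_curve_comp hE _ sv).
  exact: (smooth_curve_comp hR (st0 _ ht) sk).
have [|d d0 hd] := cinf_open_plane oU sX; first by rewrite /X scale0r !addr0.
pose H s t := tderives f (seq_at vs (k (t0 + cutoff d t))) (X (cutoff d s) (cutoff d t)).
have sH : smooth_plane H.
  move=> sg tu hs ht.
  have hcs (g : R -> R) : smooth_curve g -> smooth_curve (fun r => cutoff d (g r)).
    by move=> sg'; exact: (smooth_curve_comp hR sg' (@smooth_cutoff R d)).
  apply: (IH (fun r => k (t0 + cutoff d (tu r)))
    (fun r => X (cutoff d (sg r)) (cutoff d (tu r))) svs) => [||r].
  - exact: (smooth_curve_comp hR (st0 _ (hcs _ ht)) sk).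
  - exact: (sX _ _ (hcs _ hs) (hcs _ ht)).
  - exact: hd.
apply: smooth_at_shift (smooth_partial hF 1 sH) _.
apply: filterS (cutoff_near d0) => t ht.
rewrite [RHS]tderive_line; apply: dern_near_eq.
apply: filterS (cutoff_near d0) => s hs.
by rewrite /H hs ht /X [x _ + _]addrC.
Qed.

Lemma smooth_tderives vs x : smooth_curves vs -> smooth_curve x ->
  (forall t, U (x t)) -> smooth_curve (fun t => tderives f (seq_at vs t) (x t)).
Proof.
by move=> svs; exact: (smooth_tderives_reparam svs (@smooth_id R)).
Qed.

Lemma smooth_on_tderives vs : smooth_on U (tderives f vs).
Proof.
move=> c sc Uc; have := smooth_tderives (smooth_curves_cst vs hE) sc Uc.
by congr smooth_curve; apply/funext => t; rewrite /= seq_at_cst.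
Qed.

Lemma smooth_on_line v x : U x ->
  curve_derivative (fun h : R => f (h *: v + x)) 0 (tderive f v x).
Proof.
move=> Ux; rewrite tderive_line; apply: (tderive_curve (c := fun h : R => f (h *: v + x))).
have : smooth_at (f \o (fun h : R => h *: v + x)) 0.
  apply: nbhs_singleton; apply: (smooth_on_local hE oU sf); last by rewrite scale0r add0r.
  exact: (@filterE _ (nbhs (0 : R)) _ _ (smooth_line v x hE)).
by move=> /(_ 0%N).
Qed.

Lemma tderiveZ a v x : U x -> tderive f (a *: v) x = a *: tderive f v x.
Proof.
move=> Ux; rewrite [LHS]tderive_line; apply: (curve_derivativeE hF).
have h := @smooth_on_line v x Ux.
have := @curve_derivative_affine R F (fun h => f (h *: v + x)) 0 a 0 (tderive f v x).
rewrite mulr0 addr0 => /(_ h); congr curve_derivative.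
by apply/funext => s; rewrite add0r scalerA mulrC.
Qed.

Lemma smooth_plane_map (X : R -> R -> E) : smooth_plane X -> (forall s t, U (X s t)) ->
  smooth_plane (fun s t => f (X s t)).
Proof. by move=> sX UX sg tu hs ht; apply: (sf (sX _ _ hs ht)) => r; exact: UX. Qed.

Lemma smooth_plane_cutoff (X : R -> R -> E) d : smooth_plane X ->
  smooth_plane (fun s t => X (cutoff d s) (cutoff d t)).
Proof.
move=> sX sg tu hs ht; apply: sX.
  exact: (smooth_curve_comp hR hs (@smooth_cutoff R d)).
exact: (smooth_curve_comp hR ht (@smooth_cutoff R d)).
Qed.

Lemma smooth_plane_affine (x u v : E) : smooth_plane (fun s t : R => s *: u + (t *: v + x)).
Proof.
move=> sg tu hs ht; apply: smoothD => //; first by apply: smoothZ => //; exact: smooth_cst.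
apply: smoothD => //; last exact: smooth_cst.
by apply: smoothZ => //; exact: smooth_cst.
Qed.

(** The direction [u + v] is the diagonal of the plane map [s *: u + t *: v + x], and [plane_chain0]
    adds up the partial derivatives. *)
Lemma tderiveD u v x : U x -> tderive f (u + v) x = tderive f u x + tderive f v x.
Proof.
move=> Ux; pose X (s t : R) := s *: u + (t *: v + x).
have sX : smooth_plane X by exact: smooth_plane_affine.
have [|d d0 hd] := cinf_open_plane oU sX; first by rewrite /X !scale0r !add0r.
pose H s t := f (X (cutoff d s) (cutoff d t)).
have sH : smooth_plane H by apply: smooth_plane_map => //; exact: smooth_plane_cutoff.
have e1 : dern 1 (H^~ 0) 0 = tderive f u x.
  rewrite [RHS]tderive_line; apply: dern_near_eq.
  by apply: filterS (cutoff_near d0) => s hs; rewrite /H hs cutoff0 /X scale0r add0r.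
have e2 : dern 1 (H 0) 0 = tderive f v x.
  rewrite [RHS]tderive_line; apply: dern_near_eq.
  by apply: filterS (cutoff_near d0) => s hs; rewrite /H hs cutoff0 /X scale0r add0r.
have := plane_chain0 hF sH; rewrite [X in X + _]e1 [X in _ + X]e2 => h.
rewrite [LHS]tderive_line; apply: (curve_derivativeE hF).
apply: curve_derivative_near h.
by apply: filterS (cutoff_near d0) => s hs; rewrite /H hs /X scalerDr addrA.
Qed.

Lemma tderiveC u v x : U x -> tderive (tderive f u) v x = tderive (tderive f v) u x.
Proof.
move=> Ux; pose X (s t : R) := s *: u + (t *: v + x).
have sX : smooth_plane X by exact: smooth_plane_affine.
have [|d d0 hd] := cinf_open_plane oU sX; first by rewrite /X !scale0r !add0r.
pose H s t := f (X (cutoff d s) (cutoff d t)).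
have sH : smooth_plane H by apply: smooth_plane_map => //; exact: smooth_plane_cutoff.
have e := plane_schwarz hF sH.
have e1 : tderive (tderive f u) v x = dern 1 (fun t : R => dern 1 (H^~ t) 0) 0.
  rewrite [LHS]tderive_line; apply: dern_near_eq.
  apply: filterS (cutoff_near d0) => t ht; rewrite [LHS]tderive_line; apply: dern_near_eq.
  by apply: filterS (cutoff_near d0) => s hs; rewrite /H hs ht.
have e2 : tderive (tderive f v) u x = dern 1 (fun s : R => dern 1 (H s) 0) 0.
  rewrite [LHS]tderive_line; apply: dern_near_eq.
  apply: filterS (cutoff_near d0) => s hs; rewrite [LHS]tderive_line; apply: dern_near_eq.
  by apply: filterS (cutoff_near d0) => t ht; rewrite /H hs ht /X addrCA.
by apply: (eq_trans e1); apply: (eq_trans e); apply: esym.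
Qed.
End OneMap.
End SmoothMaps.

(** * Chain rule along curves and product rule for iterated derivatives *)

Section ChainRule.
Context (R : realType).
Implicit Types (E F : tvsType R).

(* The value at [h = 0] is the limit of the quotient. *)
Definition hadamard E (k : nat) (c : R -> E) (h : R) : E :=
  if h == 0 then (k`!%:R : R)^-1 *: dern k c 0
  else (h ^+ k)^-1 *: (c h - taylor k c h).

Lemma hadamard_continuous E k (c : R -> E) : smooth_curve c ->
  hadamard k c @ (0 : R) --> (k`!%:R : R)^-1 *: dern k c 0.
Proof.
move=> sc; apply: cvg_seminorm => p sp e e0.
have [d d0 [C C0 hC]] := taylor_peano k.+1 sp sc.
have C1 : 0 < C + 1 by rewrite ltr_wpDl.
have hn : nbhs (0 : R) (ball (0 : R) (Num.min d (e / (C + 1)))).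
  by apply: nbhsx_ballx; rewrite lt_min d0 divr_gt0.
apply: filterS hn => h; rewrite /ball /= sub0r normrN lt_min => /andP[hd he].
rewrite /hadamard; case: eqP => [_|/eqP hN]; first by rewrite subrr (seminorm0 sp).
have -> : (h ^+ k)^-1 *: (c h - taylor k c h) - (k`!%:R)^-1 *: dern k c 0 =
    (h ^+ k)^-1 *: (c h - taylor k.+1 c h).
  rewrite /taylor [in RHS]big_ord_recr /= [mono k h *: _]/(_ *: _) /mono.
  rewrite opprD addrA [RHS]scalerBr scalerA mulrA mulVf ?mul1r//.
  by rewrite expf_neq0.
rewrite (seminormZ sp) normfV mulrC ltr_pdivrMr ?normr_gt0 ?expf_neq0//.
apply: le_lt_trans (hC h (ltW hd)) _.
rewrite exprS mulrA normrX ltr_pM2r ?exprn_gt0 ?normr_gt0//.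
have : `|h| * (C + 1) < e by rewrite -ltr_pdivlMr.
rewrite mulrDr mulr1 mulrC; have := normr_ge0 h; clear; lra.
Qed.

Lemma taylor_derivative E k (c : R -> E) t :
  curve_derivative (taylor k.+1 c) t (taylor k (dern 1 c) t).
Proof.
rewrite /taylor (_ : (fun s => _) = fun s => dern 0 c 0 + \sum_(i < k) mono i.+1 s *: dern i.+1 c 0).
  rewrite -[X in curve_derivative _ _ X]add0r; apply: curve_derivativeD.
    exact: curve_derivative_cst.
  apply: (curve_derivative_sum (c := fun (i : 'I_k) s => mono i.+1 s *: dern i.+1 c 0)) => i _.
  rewrite -[dern i (dern 1 c)]dernD addn1.
  by apply: curve_derivativeZl; exact: mono_derivative.
by apply/funext => u; rewrite big_ord_recl /mono expr0 fact0 divr1 scale1r.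
Qed.

Lemma taylor0_derivative E (c : R -> E) t : curve_derivative (taylor 0 c) t 0.
Proof.
rewrite (_ : taylor 0 c = fun=> 0); first exact: curve_derivative_cst.
by apply/funext => s; rewrite /taylor big_ord0.
Qed.

Lemma invX_derivative k (t : R) : t != 0 ->
  curve_derivative (fun s : R => (s ^+ k)^-1) t (- k%:R * (t ^+ k.+1)^-1).
Proof.
move=> tN; apply/curve_derivative_real.
have dX : is_derive t (1 : R) (fun s : R => s ^+ k) (k%:R * t ^+ k.-1).
  by split; [exact: exprn_derivable|rewrite exp_derive /GRing.scale /= mulr1].
have tkN : t ^+ k != 0 by rewrite expf_neq0.
apply: (is_derive_eq (@is_deriveV R (fun s : R => s ^+ k) t _ 1 tkN dX)).
rewrite /GRing.scale /=; case: k {dX} tkN => [|k] tkN; first by rewrite !mul0r mulr0 oppr0 mul0r.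
by rewrite /= !exprS; field; rewrite tN expf_neq0.
Qed.

(** These quotients are closed under differentiation, which reduces their smoothness to an
    induction. Away from 0 this is the quotient rule, where the Taylor terms added on the right
    cancel each other. *)
Lemma hadamard_derivative E k (c : R -> E) (t : R) : smooth_curve c ->
  curve_derivative (hadamard k c) t
    (hadamard k (dern 1 c) t + (- k%:R) *: hadamard k.+1 c t).
Proof.
move=> sc; have sc1 := smooth_curve_dern 1 sc.
have [->|tN] := eqVneq t 0.
  have -> : hadamard k (dern 1 c) 0 + - k%:R *: hadamard k.+1 c 0 =
      (k.+1`!%:R : R)^-1 *: dern k.+1 c 0.
    (* At 0 the coefficients combine as [1 / k! - k / (k + 1)! = 1 / (k + 1)!]. *)
    rewrite /hadamard eqxx -[dern k (dern 1 c)]dernD addn1 scalerA -scalerDl; congr (_ *: _).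
    rewrite factS natrM; field.
    by rewrite nat1r !pnatr_eq0 -!lt0n fact_gt0.
  move=> W Wl; suff : nbhs (0 : R) [set h | h != 0 -> W (tquot (hadamard k c) (1 : R) 0 h)] by [].
  have hW : nbhs (0 : R) [set h | W (hadamard k.+1 c h)] by exact: (hadamard_continuous sc Wl).
  apply: filterS hW => h /= Wh hN.
  suff -> : tquot (hadamard k c) (1 : R) 0 h = hadamard k.+1 c h by [].
  rewrite /tquot [h *: (1 : R)]mulr1 addr0 /hadamard eqxx (negbTE hN).
  rewrite /taylor [in RHS]big_ord_recr /= exprS invfM -scalerA; congr (_ *: _).
  rewrite opprD addrA [RHS]scalerBr /mono scalerA mulrA mulVf ?mul1r//.
  by rewrite expf_neq0.
have near_t : \forall s \near t, (s ^+ k)^-1 *: (c s - taylor k c s) = hadamard k c s.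
  have hn : nbhs t (ball t `|t|) by apply: nbhsx_ballx; rewrite normr_gt0.
  apply: filterS hn => s; rewrite /ball /= /hadamard; case: eqP => // ->.
  by rewrite subr0 ltxx.
apply: (curve_derivative_near near_t).
rewrite /hadamard (negbTE tN).
have dc : curve_derivative c t (dern 1 c t) := smooth_dern 0 t sc.
case: k {near_t} => [|k].
  have := curve_derivativeZ (@invX_derivative 0 t tN) (curve_derivativeB dc (@taylor0_derivative E c t)).
  congr curve_derivative.
  by rewrite oppr0 mul0r !scale0r add0r addr0 subr0 /taylor big_ord0 subr0.
have := curve_derivativeZ (@invX_derivative k.+1 t tN) (curve_derivativeB dc (@taylor_derivative E k c t)).
congr curve_derivative.
have t1 : taylor k.+2 c t = taylor k.+1 c t + (t ^+ k.+1 / k.+1`!%:R) *: dern k.+1 c 0.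
  by rewrite /taylor big_ord_recr.
have t2 : taylor k.+1 (dern 1 c) t = taylor k (dern 1 c) t + (t ^+ k / k`!%:R) *: dern k.+1 c 0.
  by rewrite /taylor big_ord_recr /= -[dern k (dern 1 c)]dernD addn1.
rewrite t1 t2; move: (taylor k.+1 c t) (taylor k (dern 1 c) t) => a b.
move: (c t) (dern 1 c t) (dern k.+1 c 0) => x y z.
have kN : (k`!%:R : R) != 0 by rewrite pnatr_eq0 -lt0n fact_gt0.
have k1N : (k.+1%:R : R) != 0 by rewrite pnatr_eq0.
rewrite factS natrM !exprS; move: (k.+1%:R : R) (k`!%:R : R) kN k1N => u w wN uN.
lmod_ring R E.
by field; rewrite ?uN ?wN ?expf_neq0 ?tN.
Qed.

Lemma smooth_hadamard E k (c : R -> E) : hausdorff_space E ->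
  smooth_curve c -> smooth_curve (hadamard k c).
Proof.
move=> hE sc; apply/smooth_curveP => n; elim: n k c sc => // n IH k c sc.
apply: (ndiffS hE (fun t => @hadamard_derivative E k c t sc)).
apply: (ndiffD hE); first by apply: IH; exact: smooth_curve_dern.
by apply: (ndiffZ hE) (IH _ _ sc); exact: ndiff_cst.
Qed.

Lemma hadamard1 E (c : R -> E) h : c h = h *: hadamard 1 c h + c 0.
Proof.
rewrite /hadamard; case: eqP => [->|/eqP hN]; first by rewrite scale0r add0r.
rewrite expr1 scalerA mulfV// scale1r /taylor big_ord_recl big_ord0 addr0.
by rewrite /mono /= expr0 fact0 divr1 scale1r subrK.
Qed.

Section OneMap.
Context E F (hE : hausdorff_space E) (hF : hausdorff_space F).
Context (U : set E) (oU : cinf_open U) (f : E -> F) (sf : smooth_on U f).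

(** Write [x (h + t) = h *: q h + x t] with [q] smooth. Then [f \o x] is near [t] the diagonal of
    [f (a *: q b + x t)]; at the origin its derivative in [b] vanishes, and its derivative in [a] is
    the directional derivative along [q 0], the velocity of [x]. *)
Lemma chain_rule x (t : R) : smooth_curve x -> U (x t) ->
  curve_derivative (f \o x) t (tderive f (dern 1 x t) (x t)).
Proof.
move=> sx Ux; pose y h := x (h + t).
have sy : smooth_curve y.
  have := smooth_curve_affine t 1 hE sx; congr smooth_curve.
  by apply/funext => s; rewrite mul1r addrC.
have y1 : dern 1 y 0 = dern 1 x t by have := @dern_shift R E x t 1 0 hE sx; rewrite add0r.
pose q := hadamard 1 y; have sq : smooth_curve q by exact: smooth_hadamard.
have q0 : q 0 = dern 1 x t by rewrite /q /hadamard eqxx invr1 scale1r.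
have xt : y 0 = x t by rewrite /y add0r.
pose X (a b : R) := a *: q b + x t.
have sX : smooth_plane X.
  move=> sg tu hs ht; apply: smoothD => //; last exact: smooth_cst.
  by apply: smoothZ => //; exact: (smooth_curve_comp hE ht sq).
have [|d d0 hd] := cinf_open_plane oU sX; first by rewrite /X scale0r add0r.
pose H s r := f (X (cutoff d s) (cutoff d r)).
have sH : smooth_plane H.
  by apply: (smooth_plane_map sf) => //; exact: smooth_plane_cutoff.
have e1 : dern 1 (H^~ 0) 0 = tderive f (dern 1 x t) (x t).
  rewrite [RHS]tderive_line; apply: dern_near_eq.
  by apply: filterS (cutoff_near d0) => s hs; rewrite /H hs cutoff0 /X q0.
have e2 : dern 1 (H 0) 0 = 0.
  rewrite (_ : H 0 = fun=> f (x t)).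
    by apply: (curve_derivativeE hF); exact: curve_derivative_cst.
  by apply/funext => s; rewrite /H cutoff0 /X scale0r add0r.
have := plane_chain0 hF sH; rewrite [X in X + _]e1 [X in _ + X]e2 addr0 => h.
have h2 : curve_derivative (f \o y) 0 (tderive f (dern 1 x t) (x t)).
  apply: curve_derivative_near h.
  by apply: filterS (cutoff_near d0) => s hs; rewrite /H hs /X /= [y s]hadamard1 xt.
move: h2 => /curve_derivativeP[Q [Ql Q0 hQ]]; apply/curve_derivativeP; exists Q; split => // h'.
by have := hQ h'; rewrite /= xt /y addr0.
Qed.
End OneMap.

Lemma tderive_linear E F (L : E -> F) v x : hausdorff_space F ->
  (forall (a : R) u w, L (a *: u + w) = a *: L u + L w) -> tderive L v x = L v.
Proof.
move=> hF hL; rewrite tderive_line; apply: (curve_derivativeE hF).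
have := curve_derivativeD (curve_derivativeZl (v := L v) (@curve_derivative_id R 0))
  (curve_derivative_cst (L x) (0 : R)).
rewrite scale1r addr0; congr curve_derivative.
by apply/funext => h; rewrite hL.
Qed.

(* The sum over [i] of [Phi] at [l] with the [i]-th entry replaced by that of
   [l']. *)
Fixpoint leibniz (T : Type) (V : zmodType) (Phi : seq T -> V) (l l' : seq T) : V :=
  match l, l' with
  | v :: s, v' :: s' => Phi (v' :: s) + leibniz (fun r => Phi (v :: r)) s s'
  | _, _ => 0
  end.

Section Multilinear.
Context E F (hE : hausdorff_space E) (hF : hausdorff_space F).
Context (U : set E) (oU : cinf_open U) (f : E -> F) (sf : smooth_on U f).

Lemma tderives_linear s1 s2 (a : R) u v x : U x ->
  tderives f (s1 ++ (a *: u + v) :: s2) x =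
  a *: tderives f (s1 ++ u :: s2) x + tderives f (s1 ++ v :: s2) x.
Proof.
elim: s1 x => [|w s1 IH] x Ux /=.
  have sg := smooth_on_tderives hE hF oU sf s2.
  by rewrite (tderiveD hE hF oU sg)// (tderiveZ hE hF oU sg).
rewrite (tderive_eq_on _ hE oU IH Ux) [LHS]tderive_line; apply: (curve_derivativeE hF).
have sg s := smooth_on_tderives hE hF oU sf s.
by apply: curve_derivativeD; [apply: curve_derivativeZr|];
  exact: (smooth_on_line hE oU (sg _)).
Qed.

Lemma tderives_move s1 v s2 x : U x ->
  tderives f (s1 ++ v :: s2) x = tderives f (v :: s1 ++ s2) x.
Proof.
elim: s1 x => [//|w s1 IH] x Ux /=.
rewrite (tderive_eq_on _ hE oU IH Ux) /=.
exact: (tderiveC hE hF oU (smooth_on_tderives hE hF oU sf _)).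
Qed.

(** Let the first vector vary independently of the others. One partial derivative gives the first
    term of [leibniz]; the other is the induction hypothesis with that vector frozen at the end of
    [s1]. *)
Lemma tderives_leibniz s1 vs (t : R) y : smooth_curves vs -> U y ->
  curve_derivative (fun a => tderives f (s1 ++ seq_at vs a) y) t
    (leibniz (fun l => tderives f (s1 ++ l) y) (seq_at vs t)
      (seq_at [seq dern 1 v | v <- vs] t)).
Proof.
move=> svs Uy; elim: vs s1 svs => [|v vs IH] s1 /=; first by move=> _; exact: curve_derivative_cst.
move=> [sv svs]; pose K a b := tderives f (s1 ++ v a :: seq_at vs b) y.
have sK : smooth_plane K.
  move=> sg tu hs ht.
  have hsv : smooth_curves ([seq (fun _ : R => w) | w <- s1] ++ (v \o sg) :: [seq w \o tu | w <- vs]).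
    apply: smooth_curves_cat; first exact: smooth_curves_cst.
    split; first exact: (smooth_curve_comp hE hs sv).
    elim: {IH K} vs svs => //= w vs IH [sw /IH h]; split => //.
    exact: (smooth_curve_comp hE ht sw).
  have := smooth_tderives hE hF oU sf hsv (smooth_cst y hE) (fun=> Uy).
  congr smooth_curve; apply/funext => r.
  by rewrite /K /seq_at map_cat -map_comp map_id_in//= -map_comp.
have e1 : dern 1 (K^~ t) t = tderives f (s1 ++ dern 1 v t :: seq_at vs t) y.
  apply: (curve_derivativeE hF).
  pose L w := tderives f (s1 ++ w :: seq_at vs t) y.
  have sL : smooth_on setT L.
    move=> c sc _.
    have hsv : smooth_curves ([seq (fun _ : R => w) | w <- s1] ++ c ::
        [seq (fun _ : R => w) | w <- seq_at vs t]).
      apply: smooth_curves_cat; first exact: smooth_curves_cst.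
      by split => //; exact: smooth_curves_cst.
    have := smooth_tderives hE hF oU sf hsv (smooth_cst y hE) (fun=> Uy).
    congr smooth_curve; apply/funext => r.
    by rewrite /L /= /seq_at map_cat -map_comp map_id_in//= -map_comp map_id_in.
  have oT : cinf_open (setT : set E) by move=> c _; rewrite preimage_setT; exact: openT.
  have := chain_rule hE hF oT sL (t := t) sv I.
  by rewrite (tderive_linear _ _ hF)// => a u w; exact: tderives_linear.
have e2 : dern 1 (K t) t = leibniz (fun l => tderives f (s1 ++ v t :: l) y) (seq_at vs t)
      (seq_at [seq dern 1 v | v <- vs] t).
  apply: (curve_derivativeE hF).
  have := IH (rcons s1 (v t)) svs; rewrite /K.
  under [X in leibniz X]funext do rewrite cat_rcons.
  by congr curve_derivative; apply/funext => r; rewrite cat_rcons.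
have := @plane_chain R F hF K t sK.
by rewrite [X in X + _]e1 [X in _ + X]e2.
Qed.

(** The diagonal of the plane map in which base point and directions vary independently. *)
Theorem product_rule vs x (t : R) : smooth_curves vs -> smooth_curve x ->
  (forall s, U (x s)) ->
  curve_derivative (fun t => tderives f (seq_at vs t) (x t)) t
    (tderives f (dern 1 x t :: seq_at vs t) (x t) +
     leibniz (fun l => tderives f l (x t)) (seq_at vs t)
       (seq_at [seq dern 1 v | v <- vs] t)).
Proof.
move=> svs sx Ux; pose H a b := tderives f (seq_at vs b) (x a).
have sH : smooth_plane H.
  move=> sg tu hs ht.
  apply: (smooth_tderives_reparam hE hF oU sf svs ht) => [|r]; last exact: Ux.
  exact: (smooth_curve_comp hE hs sx).
have e1 : dern 1 (H^~ t) t = tderives f (dern 1 x t :: seq_at vs t) (x t).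
  apply: (curve_derivativeE hF).
  exact: (chain_rule hE hF oU (smooth_on_tderives hE hF oU sf _) sx (Ux t)).
have e2 : dern 1 (H t) t = leibniz (fun l => tderives f l (x t)) (seq_at vs t)
       (seq_at [seq dern 1 v | v <- vs] t).
  by apply: (curve_derivativeE hF); exact: (@tderives_leibniz [::] vs t (x t) svs (Ux t)).
by have := @plane_chain R F hF H t sH; rewrite [X in X + _]e1 [X in _ + X]e2.
Qed.
End Multilinear.
End ChainRule.

(** * Tensor products with Weil algebras *)

Section WeilAlgebra.
Context (R : realType).
Implicit Types (A B : weilAlgType R) (E F G : tvsType R).

Lemma tensorE A E (a : A) (y : E) i : tensor a y i = coord (weil_basis A) i a *: y.
Proof. by []. Qed.

Lemma weil_tensor_eq A E (w z : weil_tensor A E) : (forall i, w i = z i) -> w = z.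
Proof. by move=> h; apply/funext. Qed.

Lemma tensorDl A E (a b : A) (y : E) : tensor (a + b) y = tensor a y + tensor b y.
Proof. by apply: weil_tensor_eq => i; rewrite !tensorE linearD scalerDl. Qed.

Lemma tensorZl A E (k : R) (a : A) (y : E) : tensor (k *: a) y = k *: tensor a y.
Proof. by apply: weil_tensor_eq => i; rewrite !tensorE linearZ /= -scalerA. Qed.

Lemma tensor0l A E (y : E) : tensor (0 : A) y = 0.
Proof. by apply: weil_tensor_eq => i; rewrite !tensorE linear0 scale0r. Qed.

Lemma tensor_suml A E (I : Type) (r : seq I) (P : pred I) (a : I -> A) (y : E) :
  tensor (\sum_(i <- r | P i) a i) y = \sum_(i <- r | P i) tensor (a i) y.
Proof. by apply: (big_morph (fun a => tensor a y)) => [u v|]; [exact: tensorDl|exact: tensor0l]. Qed.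

Lemma tensorDr A E (a : A) (y z : E) : tensor a (y + z) = tensor a y + tensor a z.
Proof. by apply: weil_tensor_eq => i; rewrite !tensorE scalerDr. Qed.

Lemma tensorZr A E (k : R) (a : A) (y : E) : tensor a (k *: y) = k *: tensor a y.
Proof. by apply: weil_tensor_eq => i; rewrite !tensorE scalerA mulrC -scalerA. Qed.

Lemma tensor0r A E (a : A) : tensor a (0 : E) = 0.
Proof. by apply: weil_tensor_eq => i; rewrite !tensorE scaler0. Qed.

Lemma weil_coord A (a : A) : a = \sum_i coord (weil_basis A) i a *: (weil_basis A)`_i.
Proof. by apply: coord_span; rewrite weil_basis_full memvf. Qed.

Lemma tensor_basis A E (w : weil_tensor A E) :
  w = \sum_(i < (weil_dim A).+1) tensor (weil_basis A)`_i (w i).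
Proof.
apply: weil_tensor_eq => i; rewrite weil_tensor_sumE (bigD1 i)//= big1 => [|k ki].
  by rewrite addr0 tensorE coord_free ?weil_basis_free// eqxx scale1r.
by rewrite tensorE coord_free ?weil_basis_free// (negbTE ki) scale0r.
Qed.

Lemma tensor_mapE A B (psi : A -> B) E (w : weil_tensor A E) i :
  tensor_map psi w i = \sum_(k < (weil_dim A).+1) coord (weil_basis B) i (psi (weil_basis A)`_k) *: w k.
Proof. by rewrite /tensor_map weil_tensor_sumE. Qed.

Lemma tensor_map_linear A B (psi : A -> B) E (k : R) (w z : weil_tensor A E) :
  tensor_map psi (k *: w + z) = k *: tensor_map psi w + tensor_map psi z.
Proof.
rewrite /tensor_map scaler_sumr -big_split; apply: eq_bigr => i _.
by rewrite -[(k *: w + z) i]/(k *: w i + z i) tensorDr tensorZr.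
Qed.

Lemma tensor_mapD A B (psi : A -> B) E (w z : weil_tensor A E) :
  tensor_map psi (w + z) = tensor_map psi w + tensor_map psi z.
Proof. by have := tensor_map_linear psi 1 w z; rewrite !scale1r. Qed.

Lemma tensor_map0 A B (psi : A -> B) E : tensor_map psi (0 : weil_tensor A E) = 0.
Proof. by apply: (addIr (tensor_map psi (0 : weil_tensor A E))); rewrite -tensor_mapD addr0 add0r. Qed.

Lemma tensor_mapZ A B (psi : A -> B) E k (w : weil_tensor A E) :
  tensor_map psi (k *: w) = k *: tensor_map psi w.
Proof. by have := tensor_map_linear psi k w 0; rewrite tensor_map0 !addr0. Qed.

Lemma tensor_mapB A B (psi : A -> B) E (w z : weil_tensor A E) :
  tensor_map psi (w - z) = tensor_map psi w - tensor_map psi z.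
Proof. by rewrite -scaleN1r tensor_mapD tensor_mapZ scaleN1r. Qed.

Lemma tensor_map_sum A B (psi : A -> B) E (I : Type) (r : seq I) (P : pred I)
    (w : I -> weil_tensor A E) :
  tensor_map psi (\sum_(i <- r | P i) w i) = \sum_(i <- r | P i) tensor_map psi (w i).
Proof. by apply: (big_morph (@tensor_map R A B psi E)) => [u v|]; [exact: tensor_mapD|exact: tensor_map0]. Qed.

Lemma tensor_map_tensor A B (psi : {linear A -> B}) E (a : A) (y : E) :
  tensor_map psi (tensor a y) = tensor (psi a) y.
Proof.
rewrite {2}(weil_coord a) linear_sum tensor_suml; apply: eq_bigr => i _.
by rewrite linearZ /= tensorZl -tensorZr.
Qed.

(** The [A]-module structure of [A \otimes E]. *)
Definition wmul A E (a : A) (w : weil_tensor A E) : weil_tensor A E :=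
  tensor_map (fun b => a * b) w.

Lemma wmulE A E (a : A) (w : weil_tensor A E) :
  wmul a w = \sum_(i < (weil_dim A).+1) tensor (a * (weil_basis A)`_i) (w i).
Proof. by []. Qed.

Lemma wmul_sum A E (a : A) (I : Type) (r : seq I) (P : pred I) (w : I -> weil_tensor A E) :
  wmul a (\sum_(i <- r | P i) w i) = \sum_(i <- r | P i) wmul a (w i).
Proof. exact: tensor_map_sum. Qed.

Lemma wmul_tensor A E (a b : A) (y : E) : wmul a (tensor b y) = tensor (a * b) y.
Proof. exact: (tensor_map_tensor (a \*o idfun)). Qed.

Lemma wmulDl A E (a b : A) (w : weil_tensor A E) : wmul (a + b) w = wmul a w + wmul b w.
Proof. by rewrite -big_split; apply: eq_bigr => i _; rewrite mulrDl tensorDl. Qed.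

Lemma wmulZl A E k (a : A) (w : weil_tensor A E) : wmul (k *: a) w = k *: wmul a w.
Proof. by rewrite /wmul /tensor_map scaler_sumr; apply: eq_bigr => i _; rewrite -scalerAl tensorZl. Qed.

Lemma wmul0l A E (w : weil_tensor A E) : wmul 0 w = 0.
Proof. by rewrite -(scale0r (1 : A)) wmulZl scale0r. Qed.

Lemma wmul_suml A E (I : Type) (r : seq I) (P : pred I) (a : I -> A) (w : weil_tensor A E) :
  wmul (\sum_(i <- r | P i) a i) w = \sum_(i <- r | P i) wmul (a i) w.
Proof. by apply: (big_morph (fun a => wmul a w)) => [u v|]; [exact: wmulDl|exact: wmul0l]. Qed.

Lemma wmulA A E (a b : A) (w : weil_tensor A E) : wmul a (wmul b w) = wmul (a * b) w.
Proof.
rewrite [wmul b w]wmulE wmul_sum; apply: eq_bigr => i _.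
by rewrite wmul_tensor mulrA.
Qed.

Lemma wmul1 A E (w : weil_tensor A E) : wmul 1 w = w.
Proof. by rewrite [RHS]tensor_basis; apply: eq_bigr => i _; rewrite mul1r. Qed.

Lemma wmulC A E (a b : A) (w : weil_tensor A E) : wmul a (wmul b w) = wmul b (wmul a w).
Proof. by rewrite !wmulA mulrC. Qed.

Lemma tensor_map_wmul A B (psi : {lrmorphism A -> B}) E (a : A) (w : weil_tensor A E) :
  tensor_map psi (wmul a w) = wmul (psi a) (tensor_map psi w).
Proof.
rewrite wmulE tensor_map_sum [tensor_map psi w]/tensor_map wmul_sum.
apply: eq_bigr => i _.
by rewrite (tensor_map_tensor psi) wmul_tensor rmorphM.
Qed.

Lemma weil_gen_nil A (j : 'I_(weil_dim A)) : weil_gen j \in weil_nil.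
Proof. by rewrite vbasis_mem// mem_nth// size_tuple. Qed.

Lemma weil_nil_sub1_inj A (a n : A) : n \in weil_nil -> a * n = a -> a = 0.
Proof.
move=> nN an; have [k nk] := weil_nil_nilpotent _ nN.
have h m : a * n ^+ m = a.
  by elim: m => [|m IH]; rewrite ?mulr1// exprS mulrA an IH.
by rewrite -(h k) nk mulr0.
Qed.

(* If the product does not vanish, its partial products are linearly independent
   elements of the nilpotent ideal. *)
Lemma weil_nil_prod0 A (s : seq A) :
  {in s, forall n, n \in weil_nil} -> (weil_dim A < size s)%N -> \prod_(n <- s) n = 0.
Proof.
move=> sN hs; apply/eqP; apply: contraTT hs => pN; rewrite -leqNgt.
(* The partial products [a n_1], [a n_1 n_2], and so on. Combinations of those after the first are
   [a n_1 m] with [m] in the ideal, and [a n_1 = a n_1 m] would force [a n_1 = 0] by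
   [weil_nil_sub1_inj]. *)
pose P (b : A) := fix P (s : seq A) (a : A) : seq A :=
  if s is n :: s' then a * n :: P s' (a * n) else [::].
have sizeP t a : size (P 1 t a) = size t by elim: t a => //= n t IH a; rewrite IH.
have spanP t a : {in t, forall n, n \in weil_nil} ->
    forall x, x \in <<P 1 t a>>%VS -> exists2 n, n \in weil_nil & x = a * n.
  elim: t a => /= [|n t IH] a tN x.
    by rewrite span_nil memv0 => /eqP ->; exists 0; rewrite ?mem0v ?mulr0.
  rewrite span_cons => /memv_addP[_ /vlineP[k ->] [y yP ->]].
  have [|m mN ->] := IH (a * n) _ y yP; first by move=> z zt; apply: tN; rewrite inE zt orbT.
  have nN : n \in weil_nil by apply: tN; rewrite mem_head.
  exists (k *: n + n * m); first by rewrite memvD ?memvZ ?weil_nil_ideal.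
  by rewrite mulrDr -scalerAr mulrA.
have freeP t a : {in t, forall n, n \in weil_nil} -> a * \prod_(n <- t) n != 0 -> free (P 1 t a).
  elim: t a => /= [|n t IH] a tN aN; first by rewrite nil_free.
  have tN' : {in t, forall n, n \in weil_nil} by move=> z zt; apply: tN; rewrite inE zt orbT.
  rewrite big_cons mulrA in aN; rewrite free_cons IH// andbT.
  apply/negP => /(spanP _ _ tN')[m mN /esym e].
  by rewrite (weil_nil_sub1_inj mN e) mul0r eqxx in aN.
have subP t a : {in t, forall n, n \in weil_nil} -> {subset P 1 t a <= weil_nil}.
  elim: t a => //= n t IH a tN x; rewrite inE => /orP[/eqP ->|].
    by rewrite weil_nil_ideal// tN// mem_head.
  by apply: IH => z zt; apply: tN; rewrite inE zt orbT.
have := freeP s 1 sN; rewrite mul1r => /(_ pN); rewrite /free => /eqP e.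
rewrite -(sizeP s 1) -e; apply: dimvS; apply/span_subvP; exact: subP.
Qed.

Lemma weil_gen_prod0 A (j : seq 'I_(weil_dim A)) :
  (weil_dim A < size j)%N -> \prod_(i <- j) weil_gen i = 0.
Proof.
move=> hj; have := @weil_nil_prod0 A [seq weil_gen i | i <- j].
rewrite size_map big_map; apply => // n /mapP[i _ ->]; exact: weil_gen_nil.
Qed.

Definition nil_part A E (w : weil_tensor A E) : weil_tensor A E :=
  \sum_(j < weil_dim A) tensor (weil_gen j) (w (lift ord0 j)).

Lemma nil_partE A E (w : weil_tensor A E) : w = tensor 1 (w ord0) + nil_part w.
Proof. by rewrite {1}(tensor_basis w) big_ord_recl. Qed.

Lemma nil_part0 A E (w : weil_tensor A E) : nil_part w ord0 = 0.
Proof.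
have : w ord0 = tensor (1 : A) (w ord0) ord0 + nil_part w ord0.
  exact: (congr1 (fun z : weil_tensor A E => z ord0) (nil_partE w)).
rewrite -[tensor _ _ ord0]/(weil_pi 1 *: _) weil_pi1 scale1r.
by rewrite -[LHS]addr0 => /addrI.
Qed.

Lemma nil_part_id A E (w : weil_tensor A E) : w ord0 = 0 -> nil_part w = w.
Proof. by move=> w0; rewrite [RHS]nil_partE w0 tensor0r add0r. Qed.

Lemma tensor1E A E (y : E) (i : 'I_(weil_dim A).+1) : tensor (1 : A) y i = if i == ord0 then y else 0.
Proof.
rewrite tensorE -[1]/((weil_basis A)`_(ord0 : 'I_(weil_dim A).+1)).
by rewrite coord_free ?weil_basis_free// eq_sym; case: eqP => _; rewrite ?scale1r ?scale0r.
Qed.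

(* The [A]-multilinear extension of [phi], which maps the
   [a_i \otimes y_i] to [(\prod_i a_i) \otimes phi [:: y_1; ...; y_k]]. *)
Fixpoint multi A E F (phi : seq E -> F) (Zs : seq (weil_tensor A E)) : weil_tensor A F :=
  if Zs is Z :: Zs' then
    \sum_(i < (weil_dim A).+1) wmul (weil_basis A)`_i (multi (fun l => phi (Z i :: l)) Zs')
  else tensor 1 (phi [::]).

Lemma multi_cons A E F (phi : seq E -> F) (Z : weil_tensor A E) Zs :
  multi phi (Z :: Zs) =
  \sum_(i < (weil_dim A).+1) wmul (weil_basis A)`_i (multi (fun l => phi (Z i :: l)) Zs).
Proof. by []. Qed.

Definition multilinear E F (phi : seq E -> F) : Prop :=
  forall s1 s2 (k : R) u v,
    phi (s1 ++ (k *: u + v) :: s2) = k *: phi (s1 ++ u :: s2) + phi (s1 ++ v :: s2).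

(** Full symmetry, stated through the moves of one entry to the front, which generate all
    permutations. *)
Definition front_symmetric E (V : Type) (phi : seq E -> V) : Prop :=
  forall s1 v s2, phi (s1 ++ v :: s2) = phi (v :: s1 ++ s2).

Lemma multilinear_cons E F (phi : seq E -> F) z :
  multilinear phi -> multilinear (fun l => phi (z :: l)).
Proof. by move=> h s1; exact: (h (z :: s1)). Qed.

Lemma front_symmetric_cons E V (phi : seq E -> V) z :
  front_symmetric phi -> front_symmetric (fun l => phi (z :: l)).
Proof.
move=> h s1 v s2; rewrite (h (z :: s1) v s2).
exact: (esym (h [:: z] v (s1 ++ s2))).
Qed.

Lemma eq_multi A E F (phi phi' : seq E -> F) (Zs : seq (weil_tensor A E)) :
  phi =1 phi' -> multi phi Zs = multi phi' Zs.
Proof. by move=> /funext ->. Qed.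

Lemma multi_linear_fun A E F k (phi phi' : seq E -> F) (Zs : seq (weil_tensor A E)) :
  multi (fun l => k *: phi l + phi' l) Zs = k *: multi phi Zs + multi phi' Zs.
Proof.
elim: Zs phi phi' => [|Z Zs IH] phi phi' /=; first by rewrite tensorDr tensorZr.
rewrite scaler_sumr -big_split; apply: eq_bigr => i _.
by rewrite IH /wmul tensor_map_linear.
Qed.

Lemma multi_addf A E F (phi phi' : seq E -> F) (Zs : seq (weil_tensor A E)) :
  multi (fun l => phi l + phi' l) Zs = multi phi Zs + multi phi' Zs.
Proof.
rewrite -[X in X + _]scale1r -multi_linear_fun; apply: eq_multi => l.
by rewrite scale1r.
Qed.

Lemma multi_0f A E F (Zs : seq (weil_tensor A E)) : multi (fun=> 0 : F) Zs = 0.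
Proof.
apply: (addIr (multi (fun=> 0 : F) Zs)); rewrite -multi_addf.
by rewrite !add0r.
Qed.

Lemma multi_scalef A E F k (phi : seq E -> F) (Zs : seq (weil_tensor A E)) :
  multi (fun l => k *: phi l) Zs = k *: multi phi Zs.
Proof.
rewrite -[RHS]addr0 -(multi_0f F Zs) -multi_linear_fun; apply: eq_multi => l.
by rewrite addr0.
Qed.

Lemma multi_cons_linear A E F (phi : seq E -> F) k (Z Z' : weil_tensor A E) Zs :
  multilinear phi ->
  multi phi ((k *: Z + Z') :: Zs) = k *: multi phi (Z :: Zs) + multi phi (Z' :: Zs).
Proof.
move=> hphi /=; rewrite scaler_sumr -big_split; apply: eq_bigr => i _ /=.
rewrite -tensor_map_linear -multi_linear_fun; congr (wmul _ _); apply: eq_multi => l.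
exact: (hphi [::]).
Qed.

Lemma multilinear_multi A E F (phi : seq E -> F) :
  multilinear phi -> multilinear (@multi A E F phi).
Proof.
move=> hphi s1; elim: s1 phi hphi => [|Z s1 IH] phi hphi s2 k u v.
  exact: multi_cons_linear.
rewrite /= scaler_sumr -big_split; apply: eq_bigr => i _ /=.
by rewrite -tensor_map_linear -IH//; exact: multilinear_cons.
Qed.

Lemma multilinear_sum E F (phi : seq E -> F) (I : Type) (r : seq I) (P : pred I) s1 s2 (u : I -> E) :
  multilinear phi ->
  phi (s1 ++ (\sum_(i <- r | P i) u i) :: s2) = \sum_(i <- r | P i) phi (s1 ++ u i :: s2).
Proof.
move=> h; have h0 : phi (s1 ++ 0 :: s2) = 0.
  apply: (addIr (phi (s1 ++ 0 :: s2))); have := h s1 s2 1 0 0.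
  by rewrite !scale1r addr0 add0r => <-.
apply: (big_morph (fun u => phi (s1 ++ u :: s2))) => // u' v.
by have := h s1 s2 1 u' v; rewrite !scale1r.
Qed.

Lemma multilinear0 E F (phi : seq E -> F) s1 s2 :
  multilinear phi -> phi (s1 ++ 0 :: s2) = 0.
Proof.
move=> h; have := multilinear_sum [::] xpredT s1 s2 (fun _ : unit => 0) h.
by rewrite !big_nil.
Qed.

Lemma multi_tensor A E F (phi : seq E -> F) (a : A) y (Zs : seq (weil_tensor A E)) :
  multilinear phi ->
  multi phi (tensor a y :: Zs) = wmul a (multi (fun l => phi (y :: l)) Zs).
Proof.
move=> hphi /=; rewrite [in RHS](weil_coord a) wmul_suml; apply: eq_bigr => i _.
rewrite wmulZl /wmul -tensor_mapZ; congr (tensor_map _ _); rewrite -multi_scalef.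
apply: eq_multi => l; have := hphi [::] l (coord (weil_basis A) i a) y 0.
by rewrite /= addr0 (multilinear0 [::] l hphi) addr0.
Qed.

Lemma multi_wmul A E F (phi : seq E -> F) (a : A) s1 Z s2 :
  multilinear phi ->
  multi phi (s1 ++ wmul a Z :: s2) = wmul a (multi phi (s1 ++ Z :: s2)).
Proof.
elim: s1 phi => [|Y s1 IH] phi hphi /=.
  rewrite -[LHS]/(multi phi (wmul a Z :: s2)).
  rewrite (multilinear_sum _ _ [::] s2 _ (multilinear_multi hphi)) wmul_sum.
  by apply: eq_bigr => i _; rewrite [LHS]multi_tensor// -wmulA.
rewrite wmul_sum; apply: eq_bigr => i _.
rewrite IH; last exact: multilinear_cons.
exact: wmulC.
Qed.

Lemma multi_front A E F (phi : seq E -> F) :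
  front_symmetric phi -> front_symmetric (@multi A E F phi).
Proof.
move=> hphi s1; elim: s1 phi hphi => [//|Y s1 IH] phi hphi v s2 /=.
transitivity (\sum_(i < (weil_dim A).+1) \sum_(k < (weil_dim A).+1)
    wmul (weil_basis A)`_i (wmul (weil_basis A)`_k (multi (fun l => phi (Y i :: v k :: l)) (s1 ++ s2)))).
  apply: eq_bigr => i _; rewrite IH /=; last exact: front_symmetric_cons.
  by rewrite wmul_sum.
rewrite exchange_big; apply: eq_bigr => k _; rewrite /= wmul_sum.
apply: eq_bigr => i _; rewrite wmulC.
do 2 congr (wmul _ _); apply: eq_multi => l.
exact: (hphi [:: Y i] (v k) l).
Qed.

Lemma multi_rcons_tensor A E F (phi : seq E -> F) v (Zs : seq (weil_tensor A E)) :
  multilinear phi ->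
  multi phi (Zs ++ [:: tensor 1 v]) = multi (fun l => phi (l ++ [:: v])) Zs.
Proof.
elim: Zs phi => [|Z Zs IH] phi hphi; first by rewrite /= -/(multi phi [:: tensor 1 v]) multi_tensor// wmul1.
by rewrite /=; apply: eq_bigr => i _; rewrite IH//; exact: multilinear_cons.
Qed.

Lemma multi_tensor1 A E F (phi : seq E -> F) vs :
  multilinear phi -> multi phi [seq tensor (1 : A) v | v <- vs] = tensor 1 (phi vs).
Proof.
elim: vs phi => [//|v vs IH] phi hphi.
by rewrite [LHS]multi_tensor// wmul1 IH//; exact: multilinear_cons.
Qed.

(** Each argument without a component along 1 contributes a generator of the ideal. The induction
    collects these generators in [j], until the product is too long not to vanish. *)
Lemma multi_nil A E F (phi : seq E -> F) (j : seq 'I_(weil_dim A))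
    (Ns Zs : seq (weil_tensor A E)) :
  multilinear phi -> (forall i, (i < size Ns)%N -> nth 0 Ns i ord0 = 0) ->
  (weil_dim A < size j + size Ns)%N ->
  wmul (\prod_(i <- j) weil_gen i) (multi phi (Ns ++ Zs)) = 0.
Proof.
elim: Ns phi j => [|N Ns IH] phi j hphi hN; first by rewrite addn0 => hj; rewrite weil_gen_prod0// wmul0l.
move=> hj; have -> : N = nil_part N by rewrite nil_part_id//; exact: (hN 0%N).
rewrite cat_cons (multilinear_sum _ _ [::] _ _ (multilinear_multi hphi)).
rewrite wmul_sum big1// => k _.
rewrite [in LHS]multi_tensor// wmulA mulrC.
have := IH (fun l => phi (N (lift ord0 k) :: l)) (k :: j) (multilinear_cons _ hphi).
rewrite big_cons; apply; first by move=> i hi; exact: (hN i.+1).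
by rewrite /= addSnnS.
Qed.

Lemma tensor_map_multi A B (psi : {lrmorphism A -> B}) E F (phi : seq E -> F) Zs :
  multilinear phi ->
  tensor_map psi (multi phi Zs) = multi phi [seq tensor_map psi Z | Z <- Zs].
Proof.
elim: Zs phi => [|Z Zs IH] phi hphi; first by rewrite (tensor_map_tensor psi) rmorph1.
rewrite map_cons {2}/tensor_map (multilinear_sum _ _ [::] _ _ (multilinear_multi hphi)).
rewrite multi_cons tensor_map_sum; apply: eq_bigr => i _.
rewrite tensor_map_wmul IH; last exact: multilinear_cons.
by rewrite [RHS]multi_tensor.
Qed.
End WeilAlgebra.

(** * Curves in [A \otimes E] *)

Section WeilCurves.
Context (R : realType).
Implicit Types (A B : weilAlgType R) (E F G : tvsType R).

Lemma weil_tensor_proj A E (T : Type) (Fl : set_system T) {FF : Filter Fl}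
    (f : T -> weil_tensor A E) (l : weil_tensor A E) i :
  f @ Fl --> l -> (fun x => f x i) @ Fl --> l i.
Proof.
move=> fl; apply: (cvg_comp f (fun w : weil_tensor A E => w i) fl).
exact: (@proj_continuous _ (fun=> E) i l).
Qed.

Lemma curve_derivative_tensor A E (c : R -> weil_tensor A E) (t : R) (l : weil_tensor A E) :
  curve_derivative c t l <-> forall i, curve_derivative (fun s => c s i) t (l i).
Proof.
split=> [h i|h]; first exact: (@weil_tensor_proj A E R _ _ (tquot c (1 : R) t) l i h).
by apply: weil_tensor_cvg => i; exact: h.
Qed.

Lemma hausdorff_weil_tensor A E : hausdorff_space E -> hausdorff_space (weil_tensor A E).
Proof.
move=> hE w z h; apply: weil_tensor_eq => i; apply: hE => P Q hP hQ.
have pc (u : weil_tensor A E) (V : set E) : nbhs (u i) V -> nbhs u [set x : weil_tensor A E | V (x i)].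
  exact: (@proj_continuous _ (fun=> E) i u).
by have [x [Px Qx]] := h _ _ (pc w _ hP) (pc z _ hQ); exists (x i).
Qed.

Lemma dern_tensor A E (hE : hausdorff_space E) (c : R -> weil_tensor A E) n t i :
  smooth_curve c -> dern n c t i = dern n (fun s => c s i) t.
Proof.
move=> sc; elim: n t => [//|n IH] t.
rewrite -[RHS]/(tderive (dern n (fun s => c s i)) 1 t).
have -> : dern n (fun s => c s i) = fun s => dern n c s i by apply/funext => s; rewrite IH.
apply: esym; apply: (curve_derivativeE hE).
by have /(curve_derivative_tensor (dern n c)) := smooth_dern n t sc.
Qed.

Lemma smooth_tensor A E (c : R -> weil_tensor A E) : hausdorff_space E ->
  smooth_curve c <-> forall i, smooth_curve (fun s => c s i).
Proof.
move=> hE; split=> [sc i|h].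
  apply/smooth_curveP => n; elim: n c sc => // n IH c sc.
  apply: (ndiffS hE (c' := fun s => dern 1 c s i)).
    by move=> t; have /(curve_derivative_tensor c) := smooth_dern 0 t sc.
  by apply: IH; exact: smooth_curve_dern.
apply/smooth_curveP => n; elim: n c h => // n IH c h.
apply: (ndiffS (hausdorff_weil_tensor hE) (c' := fun s i => dern 1 (fun r => c r i) s)).
  by move=> t; apply/curve_derivative_tensor => i; exact: (smooth_dern 0 t (h i)).
by apply: IH => i; exact: (smooth_curve_dern 1 (h i)).
Qed.

Lemma smooth_tensor_map A B (psi : A -> B) E (c : R -> weil_tensor A E) :
  hausdorff_space E -> smooth_curve c -> smooth_curve (fun s => tensor_map psi (c s)).
Proof.
move=> hE /(smooth_tensor _ hE) sc; apply/(smooth_tensor _ hE) => i.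
rewrite (_ : (fun s => _) = fun s => \sum_(k < (weil_dim A).+1)
    coord (weil_basis B) i (psi (weil_basis A)`_k) *: c s k).
  by apply: smooth_sum => // k _; apply: smoothZ => //; exact: smooth_cst.
by apply/funext => s; rewrite tensor_mapE.
Qed.

Lemma curve_derivative_tensor_map A B (psi : A -> B) E (c : R -> weil_tensor A E) (t : R) (l : weil_tensor A E) :
  curve_derivative c t l ->
  curve_derivative (fun s => tensor_map psi (c s)) t (tensor_map psi l).
Proof.
move=> /curve_derivative_tensor h; apply/curve_derivative_tensor => i.
rewrite (_ : (fun s => _) = fun s => \sum_(k < (weil_dim A).+1)
    coord (weil_basis B) i (psi (weil_basis A)`_k) *: c s k); last first.
  by apply/funext => s; rewrite tensor_mapE.
rewrite tensor_mapE.
apply: (curve_derivative_sum (c := fun (k : 'I_(weil_dim A).+1) s =>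
  coord (weil_basis B) i (psi (weil_basis A)`_k) *: c s k)) => k _.
exact: curve_derivativeZr (h k).
Qed.

Lemma curve_derivative_tensorr A E (a : A) (c : R -> E) t l :
  curve_derivative c t l -> curve_derivative (fun s => tensor a (c s)) t (tensor a l).
Proof.
by move=> h; apply/curve_derivative_tensor => i; exact: curve_derivativeZr h.
Qed.

Lemma smooth_tensorr A E (a : A) (c : R -> E) : hausdorff_space E ->
  smooth_curve c -> smooth_curve (fun s => tensor a (c s)).
Proof.
move=> hE sc; apply/(smooth_tensor _ hE) => i.
by apply: smoothZ => //; exact: smooth_cst.
Qed.

Lemma convenient_weil_tensor A E : convenient E -> convenient (weil_tensor A E).
Proof.
move=> [hE cE]; split; first exact: hausdorff_weil_tensor.
move=> c /(smooth_tensor _ hE) sc a b ab.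
have /choice[J hJ] : forall i, exists J, is_riemann_integral (fun s => c s i) a b J.
  by move=> i; exact: cE.
exists (J : weil_tensor A E) => W /weil_tensor_nbhs[V hV sV].
have /choice[d hd] : forall i, exists d : R, 0 < d /\ forall (n : nat) (x xi : nat -> R), x 0%N = a -> x n = b ->
      (forall i, (i < n)%N -> x i <= xi i <= x i.+1) ->
      (forall i, (i < n)%N -> x i.+1 - x i < d) ->
      V i (\sum_(j < n) (x j.+1 - x j) *: c (xi j) i).
  by move=> i; have [d d0 hd] := hJ i _ (hV i); exists d.
exists (\big[Num.min/1]_i d i).
  by elim/big_ind: _ => // [u v u0 v0|i _]; [rewrite lt_min u0|case: (hd i)].
move=> n x xi xa xb xxi xd; apply: sV => i; rewrite weil_tensor_sumE.
have [_] := hd i; apply => // j /xd h; apply: lt_le_trans h _.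
exact: bigmin_le_cond.
Qed.
End WeilCurves.

(** * Formal rules for Leibniz sums *)

Section Leibniz.
Context (T : Type) (V : zmodType).
Implicit Types (Phi : seq T -> V) (l : seq T).

Lemma leibnizD Phi Psi l l' :
  leibniz (fun r => Phi r + Psi r) l l' = leibniz Phi l l' + leibniz Psi l l'.
Proof.
elim: l l' Phi Psi => [|v l IH] [|v' l'] Phi Psi /=; rewrite ?addr0//.
by rewrite IH addrACA.
Qed.

Lemma leibniz0 l l' : leibniz (fun=> 0 : V) l l' = 0.
Proof. by elim: l l' => [|v l IH] [|v' l'] //=; rewrite IH addr0. Qed.

Lemma leibniz_sum (I : Type) (r : seq I) (P : pred I) (Phi : I -> seq T -> V) l l' :
  leibniz (fun s => \sum_(i <- r | P i) Phi i s) l l' = \sum_(i <- r | P i) leibniz (Phi i) l l'.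
Proof.
elim: r => [|i r IH].
  by rewrite big_nil -[RHS](leibniz0 l l'); congr leibniz; apply/funext => s; rewrite big_nil.
rewrite big_cons -IH; case Pi: (P i).
  by rewrite -leibnizD; congr leibniz; apply/funext => s; rewrite big_cons Pi.
by congr leibniz; apply/funext => s; rewrite big_cons Pi.
Qed.

Lemma leibniz_morph (V' : zmodType) (h : V -> V') Phi l l' :
  (forall a b, h (a + b) = h a + h b) -> h (leibniz Phi l l') = leibniz (fun r => h (Phi r)) l l'.
Proof.
move=> hD; have h0 : h 0 = 0 by apply: (addIr (h 0)); rewrite -hD addr0 add0r.
by elim: l l' Phi => [|v l IH] [|v' l'] Phi //=; rewrite hD IH.
Qed.

Lemma leibniz_map (T' : Type) (e : T' -> T) Phi (l l' : seq T') :
  leibniz Phi (map e l) (map e l') = leibniz (fun r => Phi (map e r)) l l'.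
Proof. by elim: l l' Phi => [|v l IH] [|v' l'] Phi //=; rewrite IH. Qed.

Lemma leibniz_cat Phi l1 l2 l1' l2' : size l1 = size l1' ->
  leibniz Phi (l1 ++ l2) (l1' ++ l2') =
  leibniz (fun r => Phi (r ++ l2)) l1 l1' + leibniz (fun r => Phi (l1 ++ r)) l2 l2'.
Proof.
elim: l1 l1' Phi => [|v l IH] [|v' l'] Phi //=; first by rewrite add0r.
by move=> [] /IH ->; rewrite addrA.
Qed.
End Leibniz.

(** By symmetry the [k] summands are equal. For [k = 0] the list on the right is one entry too long,
    but its coefficient is 0. *)
Lemma leibniz_nseq (R : realType) (E : tvsType R) (V : lmodType R) (Phi : seq E -> V) k N N' s :
  front_symmetric Phi ->
  leibniz (fun r => Phi (r ++ s)) (nseq k N) (nseq k N') =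
  k%:R *: Phi (N' :: nseq k.-1 N ++ s).
Proof.
elim: k Phi => [|k IH] Phi hPhi /=; first by rewrite scale0r.
rewrite -[X in _ + X]/(leibniz (fun r => (fun l => Phi (N :: l)) (r ++ s)) _ _).
rewrite (IH (fun l => Phi (N :: l))); last exact: front_symmetric_cons.
case: k {IH} => [|k]; first by rewrite scale0r addr0 scale1r.
rewrite /= (hPhi [:: N] N' (nseq k N ++ s)) /=.
by rewrite -[X in X + _]scale1r -scalerDl nat1r.
Qed.

Arguments multi : simpl never.

(** * The Weil functor on maps between vector spaces *)

Section WeilDifferential.
Context (R : realType).
Implicit Types (A B : weilAlgType R) (E F G : tvsType R).

(* The iterated derivative of [weil_map f] at [w] in the directions [Zs], if
   [f] is smooth. *)
Definition weil_diff A E F (f : E -> F) (w : weil_tensor A E) (Zs : seq (weil_tensor A E)) :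
    weil_tensor A F :=
  \sum_(k < (weil_dim A).+1) (k`!%:R : R)^-1 *:
    multi (fun l => tderives f l (w ord0)) (nseq k (nil_part w) ++ Zs).

(** Expanding every copy of the nilpotent part over the generators turns [multi] into the sum over
    tuples that defines [weil_map]. *)
Lemma multi_nseq_nil A E F (phi : seq E -> F) (w : weil_tensor A E) k : multilinear phi ->
  multi phi (nseq k (nil_part w)) =
  \sum_(j : k.-tuple 'I_(weil_dim A))
    tensor (\prod_(i <- j) weil_gen i) (phi [seq w (lift ord0 i) | i <- j]).
Proof.
elim: k phi => [|k IH] phi hphi.
  rewrite (big_pred1 [tuple]); last by move=> t; apply/esym/eqP; exact: tuple0.
  by rewrite big_nil.
rewrite -[nseq k.+1 _]/([::] ++ nil_part w :: nseq k (nil_part w)).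
rewrite (multilinear_sum _ _ [::] _ _ (multilinear_multi hphi)).
under eq_bigr => i _.
  rewrite [multi _ _]multi_tensor// IH; last exact: multilinear_cons.
  rewrite wmul_sum; under eq_bigr do rewrite wmul_tensor.
  over.
rewrite pair_bigA /= (reindex (fun p : 'I_(weil_dim A) * k.-tuple 'I_(weil_dim A) =>
  [tuple of p.1 :: p.2])) /=.
  by apply: eq_bigr => -[i j] _; rewrite big_cons.
exists (fun t => (thead t, [tuple of behead t])) => [[i j] _|t _] /=.
  by congr (_, _); apply: val_inj.
by rewrite [RHS]tuple_eta.
Qed.

Section OneMap.
Context A E F (hE : hausdorff_space E) (hF : hausdorff_space F).
Context (U : set E) (oU : cinf_open U) (f : E -> F) (sf : smooth_on U f).
Implicit Types (w : weil_tensor A E).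

Lemma multilinear_tderives x : U x -> multilinear (fun l => tderives f l x).
Proof. by move=> Ux s1 s2 k u v; exact: (tderives_linear hE hF oU sf). Qed.

Lemma front_tderives x : U x -> front_symmetric (fun l => tderives f l x).
Proof. by move=> Ux s1 v s2; exact: (tderives_move hE hF oU sf). Qed.

Lemma weil_map_diff w : U (w ord0) -> weil_map f w = weil_diff f w [::].
Proof.
move=> Uw; rewrite /weil_map /weil_diff big_ord_recl fact0 invr1 scale1r; congr (_ + _).
rewrite big_add1 big_mkord; apply: eq_bigr => k _; congr (_ *: _).
by rewrite cats0 (multi_nseq_nil w k.+1); last exact: multilinear_tderives.
Qed.

Lemma multilinear_diff w : U (w ord0) -> multilinear (weil_diff f w).
Proof.
move=> Uw s1 s2 k u v; rewrite /weil_diff scaler_sumr -big_split; apply: eq_bigr => i _ /=.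
rewrite !catA (multilinear_multi (multilinear_tderives Uw)) scalerDr !scalerA.
by rewrite [k * _]mulrC.
Qed.

Lemma weil_diff_wmul w (a : A) s1 Z s2 : U (w ord0) ->
  weil_diff f w (s1 ++ wmul a Z :: s2) = wmul a (weil_diff f w (s1 ++ Z :: s2)).
Proof.
move=> Uw; rewrite /weil_diff wmul_sum; apply: eq_bigr => i _.
by rewrite !catA multi_wmul ?/wmul ?tensor_mapZ//; exact: multilinear_tderives.
Qed.

(** The last vector of a list is the innermost derivative, so the direction [1 \otimes v] at the end
    may be applied to [f] before the functor. *)
Lemma weil_diff_tensor1 w v : U (w ord0) ->
  weil_diff f w [:: tensor 1 v] = weil_map (tderive f v) w.
Proof.
move=> Uw; have sg := smooth_on_tderives hE hF oU sf [:: v].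
transitivity (weil_diff (tderive f v) w [::]).
  apply: eq_bigr => i _; rewrite multi_rcons_tensor; last exact: multilinear_tderives.
  rewrite cats0; congr (_ *: _); apply: eq_multi => l.
  by rewrite /tderives foldr_cat.
rewrite /weil_map /weil_diff big_ord_recl fact0 invr1 scale1r; congr (_ + _).
rewrite big_add1 big_mkord; apply: eq_bigr => k _; congr (_ *: _).
rewrite cats0 (multi_nseq_nil w k.+1)// => s1 s2 a u z.
exact: (tderives_linear hE hF oU sg).
Qed.

Lemma weil_diff_base (x : E) ys : U x ->
  weil_diff f (tensor (1 : A) x) [seq tensor 1 y | y <- ys] = tensor 1 (tderives f ys x).
Proof.
move=> Ux; rewrite /weil_diff.
have -> : tensor (1 : A) x ord0 = x by rewrite tensor1E eqxx.
have -> : nil_part (tensor (1 : A) x) = 0.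
  by rewrite /nil_part big1// => j _; rewrite tensor1E/= tensor0r.
rewrite big_ord_recl fact0 invr1 scale1r big1 ?addr0 => [|k _].
  by rewrite multi_tensor1//; exact: multilinear_tderives.
by rewrite (multilinear0 [::] _ (multilinear_multi (multilinear_tderives Ux))) scaler0.
Qed.

(* Terms with more than [weil_dim A] nilpotent arguments vanish, so that the
   truncation order of the Taylor sum is immaterial. *)
Lemma weil_map_trunc w m : U (w ord0) -> (weil_dim A < m)%N ->
  weil_map f w = \sum_(k < m) (k`!%:R : R)^-1 *:
    multi (fun l => tderives f l (w ord0)) (nseq k (nil_part w)).
Proof.
move=> Uw dm; rewrite weil_map_diff// /weil_diff.
under eq_bigr do rewrite cats0.
rewrite -!(big_mkord xpredT (fun k => (k`!%:R : R)^-1 *: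
    multi (fun l => tderives f l (w ord0)) (nseq k (nil_part w)))).
rewrite (big_cat_nat (n := (weil_dim A).+1) (p := m))//= [X in _ + X]big_nat_cond.
rewrite [X in _ + X]big1 ?addr0// => k; rewrite andbT => /andP[dk _].
have := @multi_nil R A E F (fun l => tderives f l (w ord0)) [::] (nseq k (nil_part w)) [::].
rewrite big_nil wmul1 cats0 size_nseq => ->//; first by rewrite scaler0.
  exact: multilinear_tderives.
by move=> i ik; rewrite nth_nseq ik nil_part0.
Qed.

Lemma nil_part_smooth (W : R -> weil_tensor A E) : smooth_curve W ->
  smooth_curve (fun t => nil_part (W t)).
Proof.
move=> /(smooth_tensor _ hE) sW; apply: smooth_sum => [|j _].
  exact: hausdorff_weil_tensor.
exact: smooth_tensorr.
Qed.

Lemma nil_part_derivative (W : R -> weil_tensor A E) t l : curve_derivative W t l ->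
  curve_derivative (fun t => nil_part (W t)) t (nil_part l).
Proof.
move=> /curve_derivative_tensor h.
apply: (curve_derivative_sum (c := fun (j : 'I_(weil_dim A)) s =>
  tensor (weil_gen j) (W s (lift ord0 j)))) => j _.
exact: curve_derivative_tensorr.
Qed.

(** The family [Phi] depends on time because the induction absorbs a moving coordinate of the first
    argument into it; [Phi'] stands for the time derivative of the family, and [Psi'] adds the
    velocity of that coordinate. *)
Lemma multi_derivative (Phi : R -> seq E -> F) (Phi' : seq E -> F) (t : R)
    (Zs : seq (R -> weil_tensor A E)) :
  (forall vs, smooth_curves vs ->
    curve_derivative (fun t => Phi t (seq_at vs t)) t
      (Phi' (seq_at vs t) + leibniz (Phi t) (seq_at vs t) (seq_at [seq dern 1 v | v <- vs] t))) ->
  smooth_curves Zs ->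
  curve_derivative (fun t => multi (Phi t) (seq_at Zs t)) t
    (multi Phi' (seq_at Zs t) +
     leibniz (multi (Phi t)) (seq_at Zs t) (seq_at [seq dern 1 Z | Z <- Zs] t)).
Proof.
elim: Zs Phi Phi' => [|Z Zs IH] Phi Phi' hPhi.
  move=> _; rewrite /= addr0; apply: curve_derivative_tensorr.
  by have := hPhi [::] I; rewrite /= addr0.
move=> [sZ sZs]; rewrite -[seq_at (Z :: Zs) t]/(Z t :: seq_at Zs t).
pose Psi (i : 'I_(weil_dim A).+1) r l := Phi r (Z r i :: l).
pose Psi' (i : 'I_(weil_dim A).+1) l := Phi' (Z t i :: l) + Phi t (dern 1 Z t i :: l).
have hZ i : smooth_curve (fun s => Z s i) by move: i; apply/(smooth_tensor _ hE).
have hPsi i vs : smooth_curves vs -> curve_derivative (fun t => Psi i t (seq_at vs t)) t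
      (Psi' i (seq_at vs t) + leibniz (Psi i t) (seq_at vs t) (seq_at [seq dern 1 v | v <- vs] t)).
  move=> svs; have := hPhi ((fun s => Z s i) :: vs) (conj (hZ i) svs).
  by rewrite /= /Psi' (dern_tensor hE _ _ _ sZ) addrA.
have d (i : 'I_(weil_dim A).+1) :
    curve_derivative (fun r => wmul (weil_basis A)`_i (multi (Psi i r) (seq_at Zs r))) t
      (wmul (weil_basis A)`_i (multi (Psi' i) (seq_at Zs t) +
        leibniz (multi (Psi i t)) (seq_at Zs t) (seq_at [seq dern 1 Z | Z <- Zs] t))).
  by apply: curve_derivative_tensor_map; exact: (IH (Psi i) (Psi' i) (hPsi i) sZs).
have := curve_derivative_sum (r := index_enum _) (P := xpredT) (fun i _ => d i).
congr curve_derivative.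
under eq_bigr do rewrite /wmul tensor_mapD multi_addf tensor_mapD.
rewrite !big_split /= -addrA; congr (_ + (_ + _)).
rewrite leibniz_sum; apply: eq_bigr => i _.
by apply: (leibniz_morph (h := fun z => tensor_map (fun b => (weil_basis A)`_i * b) z)) => a b; exact: tensor_mapD.
Qed.

(** The [k]-th Taylor term yields one term from the moving base point and, by symmetry, [k] equal
    terms from the nilpotent part. Together they form [weil_diff] with the velocity of [W], split
    into its component along 1 and its nilpotent part, as a new argument. *)
Lemma weil_diff_derivative (W : R -> weil_tensor A E) (Zs : seq (R -> weil_tensor A E)) (t : R) :
  smooth_curve W -> (forall t, U (W t ord0)) -> smooth_curves Zs ->
  curve_derivative (fun t => weil_diff f (W t) (seq_at Zs t)) t
    (weil_diff f (W t) (dern 1 W t :: seq_at Zs t) +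
     leibniz (weil_diff f (W t)) (seq_at Zs t) (seq_at [seq dern 1 Z | Z <- Zs] t)).
Proof.
move=> sW UW sZs; pose N r := nil_part (W r).
have sN : smooth_curve N by exact: nil_part_smooth.
have hWt : hausdorff_space (weil_tensor A E) by exact: hausdorff_weil_tensor.
have dN : dern 1 N t = nil_part (dern 1 W t).
  by apply: (curve_derivativeE hWt); apply: nil_part_derivative; exact: (smooth_dern 0 t sW).
have sW0 : smooth_curve (fun s => W s ord0) by move: (ord0); apply/(smooth_tensor _ hE).
pose phi r l := tderives f l (W r ord0).
have lphi : multilinear (phi t) by exact: multilinear_tderives.
have fphi : front_symmetric (phi t) by exact: front_tderives.
pose W' := dern 1 W t; pose N' := nil_part W'; pose Zt := seq_at Zs t.
pose Zt' := seq_at [seq dern 1 Z | Z <- Zs] t.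
have step k : curve_derivative (fun r => multi (phi r) (nseq k (N r) ++ seq_at Zs r)) t
   (multi (phi t) (tensor 1 (W' ord0) :: nseq k (N t) ++ Zt) +
    (k%:R *: multi (phi t) (N' :: nseq k.-1 (N t) ++ Zt) +
     leibniz (fun r => multi (phi t) (nseq k (N t) ++ r)) Zt Zt')).
  have hphi vs : smooth_curves vs -> curve_derivative (fun t => phi t (seq_at vs t)) t
      (phi t (W' ord0 :: seq_at vs t) + leibniz (phi t) (seq_at vs t) (seq_at [seq dern 1 v | v <- vs] t)).
    move=> svs; have := @product_rule R E F hE hF U oU f sf vs (fun s => W s ord0) t svs sW0 UW.
    by rewrite -(dern_tensor hE _ _ _ sW).
  have sL : smooth_curves (nseq k N ++ Zs).
    by apply: smooth_curves_cat => //; elim: k => //= k IH.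
  have := @multi_derivative phi (fun l => phi t (W' ord0 :: l)) t (nseq k N ++ Zs) hphi sL.
  have at_cat (r : R) : seq_at (nseq k N ++ Zs) r = nseq k (N r) ++ seq_at Zs r.
    by rewrite /seq_at map_cat map_nseq.
  rewrite (_ : (fun t => multi (phi t) (seq_at (nseq k N ++ Zs) t)) =
      fun r => multi (phi r) (nseq k (N r) ++ seq_at Zs r)); last first.
    by apply/funext => r; rewrite at_cat.
  congr curve_derivative; rewrite at_cat; congr (_ + _).
    by rewrite [RHS]multi_tensor// wmul1.
  rewrite map_cat map_nseq /seq_at !map_cat !map_nseq leibniz_cat ?size_nseq//.
  by rewrite dN (leibniz_nseq _ _ _ _ (multi_front fphi)).
have := curve_derivative_sum (r := index_enum _) (P := xpredT)
  (fun (k : 'I_(weil_dim A).+1) _ => @curve_derivativeZr R _ _ ((k`!%:R : R)^-1) t _ (step k)).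
congr curve_derivative; under eq_bigr do rewrite !scalerDr.
rewrite !big_split /= addrA; congr (_ + _); last first.
  rewrite /weil_diff leibniz_sum; apply: eq_bigr => k _.
  by apply: (leibniz_morph (h := fun z => (k`!%:R : R)^-1 *: z)) => a b; rewrite scalerDr.
have -> : weil_diff f (W t) (W' :: Zt) = \sum_(k < (weil_dim A).+1) (k`!%:R : R)^-1 *:
    multi (phi t) (tensor 1 (W' ord0) :: nseq k (N t) ++ Zt) +
    \sum_(k < (weil_dim A).+1) (k`!%:R : R)^-1 *: multi (phi t) (N' :: nseq k (N t) ++ Zt).
  rewrite -big_split; apply: eq_bigr => k _ /=; rewrite -scalerDr; congr (_ *: _).
  rewrite (multi_front fphi) {1}(nil_partE W').
  have := multilinear_multi lphi [::] (nseq k (N t) ++ Zt) 1 (tensor 1 (W' ord0)) N'.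
  by rewrite !scale1r.
(* Index shift with [k / k! = 1 / (k - 1)!]: the term [k = 0] on the left is 0, and the last term on
   the right has [weil_dim A + 1] nilpotent arguments. *)
congr (_ + _); rewrite [LHS]big_ord_recl scale0r scaler0 add0r.
rewrite [RHS]big_ord_recr /=.
have := @multi_nil R A E F (phi t) [::] (N' :: nseq (weil_dim A) (N t)) Zt lphi.
rewrite big_nil wmul1 => ->; first last.
- by rewrite /= size_nseq add0n.
-
  case=> [_|i]; first exact: nil_part0.
  by rewrite /= size_nseq ltnS => hi; rewrite nth_nseq hi; exact: nil_part0.
rewrite scaler0 addr0; apply: eq_bigr => k _.
rewrite scalerA; congr (_ *: _); rewrite /fintype.bump leq0n add1n factS natrM invfM mulrAC mulVf ?mul1r//.
Qed.
End OneMap.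
End WeilDifferential.

(** * Functoriality of [T_A] on open subsets and naturality in [A] *)

Section Functoriality.
Context (R : realType).
Implicit Types (A B : weilAlgType R) (E F G : tvsType R).

Lemma curve_constant E (c : R -> E) t : hausdorff_space E ->
  (forall s, curve_derivative c s 0) -> c t = c 0.
Proof.
move=> hE dc; apply/eqP; rewrite -subr_eq0; apply/eqP.
apply: (seminorm_eq0 hE) => p sp; apply/eqP; rewrite eq_le (seminorm_ge0 sp) andbT.
have := @mean_value_zero R E p c (fun=> 0) 0 t sp (fun r _ => dc r) _.
by rewrite mul0r; apply => r _; rewrite (seminorm0 sp).
Qed.

Lemma tderivesD E F (U : set E) (f g : E -> F) vs x :
  hausdorff_space E -> hausdorff_space F -> cinf_open U ->
  smooth_on U f -> smooth_on U g -> U x ->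
  tderives (fun y => f y + g y) vs x = tderives f vs x + tderives g vs x.
Proof.
move=> hE hF oU sf sg; elim: vs x => [//|v vs IH] x Ux /=.
rewrite (tderive_eq_on _ hE oU IH Ux) [LHS]tderive_line; apply: (curve_derivativeE hF).
apply: curve_derivativeD.
  exact: (smooth_on_line hE oU (smooth_on_tderives hE hF oU sf vs)).
exact: (smooth_on_line hE oU (smooth_on_tderives hE hF oU sg vs)).
Qed.

Lemma weil_mapD A E F (U : set E) (f g : E -> F) (w : weil_tensor A E) :
  hausdorff_space E -> hausdorff_space F -> cinf_open U ->
  smooth_on U f -> smooth_on U g -> U (w ord0) ->
  weil_map (fun y => f y + g y) w = weil_map f w + weil_map g w.
Proof.
move=> hE hF oU sf sg Uw; rewrite /weil_map addrACA -tensorDr; congr (_ + _).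
rewrite -big_split; apply: eq_bigr => k _ /=; rewrite -scalerDr; congr (_ *: _).
rewrite -big_split; apply: eq_bigr => j _ /=; rewrite -tensorDr.
by rewrite (tderivesD _ hE hF oU sf sg Uw).
Qed.

Lemma weil_map_eq_on A E F (U : set E) (f g : E -> F) (w : weil_tensor A E) :
  hausdorff_space E -> cinf_open U -> (forall y, U y -> f y = g y) -> U (w ord0) ->
  weil_map f w = weil_map g w.
Proof.
move=> hE oU fg Uw; rewrite /weil_map fg//; congr (_ + _).
apply: eq_bigr => k _; congr (_ *: _); apply: eq_bigr => j _.
by rewrite (tderives_eq_on _ hE oU fg Uw).
Qed.

Lemma smooth_on_weil_map A E F (U : set E) (f : E -> F) :
  hausdorff_space E -> hausdorff_space F -> cinf_open U -> smooth_on U f ->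
  smooth_on [set w : weil_tensor A E | U (w ord0)] (weil_map f).
Proof.
move=> hE hF oU sf c sc Uc; have hT : hausdorff_space (weil_tensor A F) by exact: hausdorff_weil_tensor.
have sci i : smooth_curve (fun s => c s i) by move: i; apply/(smooth_tensor _ hE).
apply: smoothD => //; first by apply: smooth_tensorr => //; exact: (sf _ (sci ord0)).
apply: smooth_sum => // k _; apply: smoothZ => //; first exact: smooth_cst.
apply: smooth_sum => // j _; apply: smooth_tensorr => //.
have sj : smooth_curves [seq (fun s => c s (lift ord0 i)) | i <- j] by elim: (val j) => //= i s IH; split.
have := smooth_tderives hE hF oU sf sj (sci ord0) Uc.
by congr smooth_curve; apply/funext => t; rewrite /seq_at -map_comp.
Qed.

Fixpoint smooth_ons E F (U : set E) (hs : seq (E -> F)) : Prop :=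
  if hs is h :: hs' then smooth_on U h /\ smooth_ons U hs' else True.

Lemma eq_leibniz_smooth E F (V : zmodType) (U : set E) (Phi Psi : seq (E -> F) -> V) hs hs' :
  (forall ks, smooth_ons U ks -> Phi ks = Psi ks) ->
  smooth_ons U hs -> smooth_ons U hs' -> leibniz Phi hs hs' = leibniz Psi hs hs'.
Proof.
elim: hs hs' Phi Psi => [|h hs IH] [|h' hs'] Phi Psi //= e [sh shs] [sh' shs'].
by rewrite e//; congr (_ + _); apply: IH => // ks sks; exact: e.
Qed.

Section Composition.
Context A E F G (hE : hausdorff_space E) (hF : hausdorff_space F) (hG : hausdorff_space G).
Context (U : set E) (V : set F) (oU : cinf_open U) (oV : cinf_open V).
Context (f : F -> G) (sf : smooth_on V f).

(* Derivatives of [fun y => f (g y)] are sums of such maps. *)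
Definition fields_map (g : E -> F) (hs : seq (E -> F)) (y : E) : G :=
  tderives f [seq h y | h <- hs] (g y).

Lemma smooth_ons_curves (hs : seq (E -> F)) (c : R -> E) : smooth_ons U hs ->
  smooth_curve c -> (forall t, U (c t)) -> smooth_curves [seq h \o c | h <- hs].
Proof. by move=> + sc Uc; elim: hs => //= h hs IH [sh /IH shs]; split=> //; exact: sh. Qed.

Lemma smooth_fields_map g hs : smooth_on U g -> (forall y, U y -> V (g y)) ->
  smooth_ons U hs -> smooth_on U (fields_map g hs).
Proof.
move=> sg gV shs c sc Uc.
have := smooth_tderives hF hG oV sf (smooth_ons_curves shs sc Uc) (sg c sc Uc) (fun t => gV _ (Uc t)).
by congr smooth_curve; apply/funext => t; rewrite /fields_map /seq_at -map_comp.
Qed.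

Lemma tderive_fields_map g hs v y : smooth_on U g -> (forall y, U y -> V (g y)) ->
  smooth_ons U hs -> U y ->
  tderive (fields_map g hs) v y = fields_map g (tderive g v :: hs) y +
    leibniz (fun r => fields_map g r y) hs [seq tderive h v | h <- hs].
Proof.
move=> sg gV shs Uy.
have sl : \forall s \near (0 : R), smooth_at (fun h : R => h *: v + y) s.
  exact: (@filterE _ (nbhs (0 : R)) _ _ (smooth_line v y hE)).
(* The line through [y] may leave [U], so it is replaced by a curve in [U] with the same germ at
   0. *)
have [|c [sc Uc lc]] := localize_curve hE oU sl; first by rewrite scale0r add0r.
have c0 : c 0 = y by rewrite -(nbhs_singleton lc) scale0r add0r.
have dc (h : E -> F) : dern 1 (h \o c) 0 = tderive h v y.
  rewrite [RHS]tderive_line; apply: dern_near_eq.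
  by apply: filterS lc => s /= <-.
have := product_rule hF hG oV sf (t := 0) (smooth_ons_curves shs sc Uc) (sg c sc Uc) (fun t => gV _ (Uc t)).
move=> /(curve_derivativeE hG) e.
rewrite [LHS]tderive_line.
transitivity (dern 1 (fun t => tderives f (seq_at [seq h \o c | h <- hs] t) ((g \o c) t)) 0).
  apply: dern_near_eq; apply: filterS lc => s /= ->.
  by rewrite /fields_map /seq_at -map_comp.
rewrite [LHS]e dc /fields_map /= c0 /seq_at -!map_comp; congr (_ + _).
  by congr (tderive (tderives f _) _ _); apply: eq_map => h /=; rewrite c0.
transitivity (leibniz (fun l => tderives f l (g y)) [seq h y | h <- hs]
    [seq k y | k <- [seq tderive h v | h <- hs]]).
  rewrite -map_comp; congr leibniz; first by apply: eq_map => h /=; rewrite c0.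
  by apply: eq_map => h /=; rewrite -dc.
exact: (leibniz_map (fun h : E -> F => h y)).
Qed.

(** The velocity is the sum of the [n_j \otimes w_j]. By [A]-linearity each [n_j] comes out as a
    factor, and the direction [1 \otimes w_j] differentiates [g] itself. *)
Lemma weil_map_derivative (H : tvsType R) (hH : hausdorff_space H) (g : E -> H) (w : weil_tensor A E) t :
  smooth_on U g -> U (w ord0) ->
  let W (t : R) := tensor 1 (w ord0) + t *: nil_part w in
  curve_derivative (fun t => weil_map g (W t)) t
    (\sum_(j < weil_dim A) wmul (weil_gen j) (weil_map (tderive g (w (lift ord0 j))) (W t))).
Proof.
move=> sg Uw W.
have hT : hausdorff_space (weil_tensor A E) by exact: hausdorff_weil_tensor.
have dW s : curve_derivative W s (nil_part w).
  rewrite -[X in curve_derivative _ _ X]add0r; apply: curve_derivativeD.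
    exact: curve_derivative_cst.
  by have := curve_derivativeZl (v := nil_part w) (@curve_derivative_id R s); rewrite scale1r.
have sW : smooth_curve W by apply: (smooth_derivative hT dW); exact: smooth_cst.
have W0 s : W s ord0 = w ord0.
  rewrite -[LHS]/(tensor (1 : A) (w ord0) ord0 + s *: nil_part w ord0).
  by rewrite nil_part0 scaler0 addr0 tensor1E eqxx.
have UW s : U (W s ord0) by rewrite W0.
have := weil_diff_derivative hE hH oU sg (Zs := [::]) (t := t) sW UW I.
rewrite (_ : (fun t => weil_diff g (W t) (seq_at [::] t)) = fun t => weil_map g (W t)); last first.
  by apply/funext => s; rewrite (weil_map_diff hE hH oU sg).
congr curve_derivative; rewrite /= addr0.
have -> : tderive W 1 t = nil_part w by exact: curve_derivativeE.
have lin := multilinear_diff hE hH oU sg (UW t).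
rewrite /nil_part (multilinear_sum _ _ [::] [::] _ lin); apply: eq_bigr => j _ /=.
rewrite -[weil_gen j in LHS]mulr1 -wmul_tensor.
rewrite [LHS](weil_diff_wmul hE hH oU sg _ [::] _ [::] (UW t)) /=.
by rewrite (weil_diff_tensor1 hE hH oU sg _ (UW t)).
Qed.

Lemma smooth_tderive_on (H : tvsType R) (hH : hausdorff_space H) (g : E -> H) v :
  smooth_on U g -> smooth_on U (tderive g v).
Proof. by move=> sg; exact: (smooth_on_tderives hE hH oU sg [:: v]). Qed.

Lemma smooth_ons_tderive (hs : seq (E -> F)) v : smooth_ons U hs ->
  smooth_ons U [seq tderive h v | h <- hs].
Proof. by elim: hs => //= h hs IH [sh /IH shs]; split=> //; exact: smooth_tderive_on. Qed.

Lemma weil_map_leibniz (w : weil_tensor A E) (Phi : seq (E -> F) -> E -> G) hs hs' :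
  (forall ks, smooth_ons U ks -> smooth_on U (Phi ks)) -> U (w ord0) ->
  smooth_ons U hs -> smooth_ons U hs' ->
  smooth_on U (fun y => leibniz (fun r => Phi r y) hs hs') /\
  weil_map (fun y => leibniz (fun r => Phi r y) hs hs') w =
  leibniz (fun r => weil_map (Phi r) w) hs hs'.
Proof.
move=> + Uw; elim: hs hs' Phi => [|h hs IH] [|h' hs'] Phi sPhi /=.
1-3: move=> _ _; have s0 : smooth_on U (fun=> 0 : G) by [move=> c _ _; exact: smooth_cst]; split => //.
1-3: have := weil_mapD hE hG oU s0 s0 Uw;
  rewrite (_ : (fun y : E => (fun=> 0 : G) y + (fun=> 0 : G) y) = fun=> 0); last by apply/funext => y; rewrite addr0.
1-3: by move=> /esym/eqP; rewrite -subr_eq0 addrK => /eqP.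
move=> [sh shs] [sh' shs'].
have [|s e] := IH hs' (fun r => Phi (h :: r)) _ shs shs'; first by move=> ks sks; exact: sPhi.
have s1 : smooth_on U (Phi (h' :: hs)) by exact: sPhi.
split; last by rewrite (weil_mapD hE hG oU s1 s Uw) e.
by move=> c sc Uc; apply: smoothD => //; [exact: s1|exact: s].
Qed.

(* Downward induction on the number of nilpotent factors: the derivative of the
   difference along [t |-> 1 \otimes w_0 + t n] has one more of them. *)
Lemma weil_map_fields m (js : seq 'I_(weil_dim A)) g hs (w : weil_tensor A E) :
  (weil_dim A < size js + m)%N ->
  smooth_on U g -> (forall y, U y -> V (g y)) -> smooth_ons U hs -> U (w ord0) ->
  wmul (\prod_(j <- js) weil_gen j)
    (weil_map (fields_map g hs) w - weil_diff f (weil_map g w) [seq weil_map h w | h <- hs]) = 0.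
Proof.
elim: m js g hs w => [|m IH] js g hs w hm sg gV shs Uw.
  by rewrite weil_gen_prod0 ?wmul0l//; rewrite addn0 in hm.
set nu := \prod_(j <- js) _.
have hTF : hausdorff_space (weil_tensor A F) by exact: hausdorff_weil_tensor.
have hTG : hausdorff_space (weil_tensor A G) by exact: hausdorff_weil_tensor.
have hTE : hausdorff_space (weil_tensor A E) by exact: hausdorff_weil_tensor.
pose W (t : R) := tensor 1 (w ord0) + t *: nil_part w.
have W0 s : W s ord0 = w ord0.
  rewrite -[LHS]/(tensor (1 : A) (w ord0) ord0 + s *: nil_part w ord0).
  by rewrite nil_part0 scaler0 addr0 tensor1E eqxx.
have UW s : U (W s ord0) by rewrite W0.
have sW : smooth_curve W.
  apply: smoothD => //; first exact: smooth_cst.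
  by apply: smoothZ => //; [exact: smooth_id|exact: smooth_cst].
have map0 (h : E -> F) (z : weil_tensor A E) : weil_map h z ord0 = h (z ord0).
  by rewrite -!tensor_piE tensor_pi_weil_map.
pose Gc t := weil_map g (W t).
have sGc : smooth_curve Gc by exact: (smooth_on_weil_map hE hF oU sg).
have VG t : V (Gc t ord0) by rewrite /Gc map0 W0; exact: gV.
pose Zs := [seq (fun t => weil_map h (W t)) | h <- hs].
have sZs : smooth_curves Zs.
  rewrite /Zs; elim: (hs) shs => //= h ks IHk [sh /IHk sks]; split => //.
  exact: (smooth_on_weil_map hE hF oU sh).
have at_Zs (ks : seq (E -> F)) (t : R) : seq_at [seq (fun t => weil_map h (W t)) | h <- ks] t = [seq weil_map h (W t) | h <- ks].
  by rewrite /seq_at -map_comp.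
pose D t := wmul nu (weil_map (fields_map g hs) (W t) - weil_diff f (Gc t) (seq_at Zs t)).
have dD t : curve_derivative D t 0.
  pose dv (j : 'I_(weil_dim A)) (h : E -> F) := tderive h (w (lift ord0 j)).
  have sL := smooth_fields_map sg gV shs.
  have d1 := @weil_map_derivative G hG _ w t sL Uw.
  have d2 := weil_diff_derivative hF hG oV sf (t := t) sGc VG sZs.
  have dG : dern 1 Gc t = \sum_(j < weil_dim A) wmul (weil_gen j) (weil_map (dv j g) (W t)).
    by apply: (curve_derivativeE hTF); exact: weil_map_derivative.
  have dZ : seq_at [seq dern 1 Z | Z <- Zs] t =
      [seq \sum_(j < weil_dim A) wmul (weil_gen j) (weil_map (dv j h) (W t)) | h <- hs].
    rewrite /Zs /seq_at -!map_comp; elim: (hs) shs => //= h ks IHk [sh /IHk ->].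
    congr (_ :: _); apply: (curve_derivativeE hTF); exact: weil_map_derivative.
  have lin := multilinear_diff hF hG oV sf (VG t).
  have wm (a : A) s1 Z s2 := weil_diff_wmul hF hG oV sf a s1 Z s2 (VG t).
  have := @curve_derivative_tensor_map _ A A (fun b => nu * b) _ _ _ _ (curve_derivativeB d1 d2).
  rewrite -/(wmul nu _) -/W; congr curve_derivative.
  (* The velocity of each argument is a combination of elements with factors [n_j], and
     [A]-multilinearity takes these factors out. *)
  have lsum : leibniz (weil_diff f (Gc t)) (seq_at Zs t) (seq_at [seq dern 1 Z | Z <- Zs] t) =
     \sum_(j < weil_dim A) wmul (weil_gen j)
       (leibniz (weil_diff f (Gc t)) [seq weil_map h (W t) | h <- hs] [seq weil_map (dv j h) (W t) | h <- hs]).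
    rewrite at_Zs dZ; move: (weil_diff f (Gc t)) lin wm => Phi lin wm.
    elim: (hs) Phi lin wm => [|h ks IHk] Phi lin wm /=.
      by rewrite big1// => j _; rewrite /wmul tensor_map0.
    rewrite (multilinear_sum _ _ [::] _ _ lin) IHk => [| |a s1 Z s2].
    - rewrite -big_split; apply: eq_bigr => j _ /=.
      by rewrite [Phi (wmul _ _ :: _)](wm _ [::]) /wmul tensor_mapD.
    - exact: multilinear_cons.
    - exact: (wm a (_ :: s1)).
  rewrite lsum dG at_Zs (multilinear_sum _ _ [::] _ _ lin) -big_split -sumrB wmul_sum.
  rewrite big1// => j _ /=.
  rewrite [weil_diff _ _ _](wm _ [::]) -tensor_mapD -tensor_mapB -/(wmul _ _) wmulA.
  have -> : nu * weil_gen j = \prod_(i <- j :: js) weil_gen i by rewrite big_cons mulrC.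
  have sdv : smooth_ons U [seq dv j h | h <- hs] by exact: smooth_ons_tderive.
  have sPhi ks : smooth_ons U ks -> smooth_on U (fields_map g ks) by exact: smooth_fields_map.
  have sdg : smooth_on U (dv j g) by exact: smooth_tderive_on.
  have [sl el] := weil_map_leibniz sPhi (UW t) shs sdv.
  have -> : weil_map (tderive (fields_map g hs) (w (lift ord0 j))) (W t) =
      weil_map (fields_map g (dv j g :: hs)) (W t) +
      leibniz (fun r => weil_map (fields_map g r) (W t)) hs [seq dv j h | h <- hs].
    rewrite -el -(weil_mapD hE hG oU _ sl (UW t)); last exact: sPhi.
    by apply: (weil_map_eq_on hE oU) (UW t) => y Uy; exact: tderive_fields_map.
  have hjs : (weil_dim A < size (j :: js) + m)%N by rewrite /= addSnnS.
  (* The coefficient of [n_j] is a sum of differences of the same kind, with the field [dv j g]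
     added ([e1]) or with one field differentiated ([e2]); each now carries one more nilpotent
     factor. *)
  have e1 := IH (j :: js) g (dv j g :: hs) (W t) hjs sg gV (conj sdg shs) (UW t).
  have e2 : wmul (\prod_(i <- j :: js) weil_gen i)
     (leibniz (fun r => weil_map (fields_map g r) (W t)) hs [seq dv j h | h <- hs] -
      leibniz (weil_diff f (Gc t)) [seq weil_map h (W t) | h <- hs]
        [seq weil_map (dv j h) (W t) | h <- hs]) = 0.
    have -> : [seq weil_map (dv j h) (W t) | h <- hs] =
        [seq weil_map h (W t) | h <- [seq dv j h | h <- hs]] by rewrite -map_comp.
    rewrite leibniz_map /wmul tensor_mapB !(leibniz_morph (h := tensor_map _ (E := G))); try by move=> a b; exact: tensor_mapD.
    apply/eqP; rewrite subr_eq0; apply/eqP.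
    apply: (eq_leibniz_smooth (U := U)) => // ks sks.
    apply/eqP; rewrite -subr_eq0 -tensor_mapB; apply/eqP.
    exact: (IH (j :: js) g ks (W t) hjs sg gV sks (UW t)).
  rewrite -[RHS]addr0 -{1}e1 -e2 -tensor_mapD; congr (tensor_map _ _).
  by rewrite opprD addrACA.
(* The value at 1 is the claim. At 0 the point is [1 \otimes w_0], where both terms reduce to
   [tderives f] at the base point. *)
have := curve_constant 1 hTG dD; rewrite /D.
have -> : W 1 = w by rewrite /W scale1r -nil_partE.
have -> : W 0 = tensor 1 (w ord0) by rewrite /W scale0r addr0.
have Mbase (H : tvsType R) (hH : hausdorff_space H) (h : E -> H) : smooth_on U h ->
    weil_map h (tensor (1 : A) (w ord0)) = tensor 1 (h (w ord0)).
  move=> sh; rewrite (weil_map_diff hE hH oU sh); last by rewrite tensor1E eqxx.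
  exact: (weil_diff_base A hE hH oU sh [::] Uw).
rewrite /Gc /Zs !at_Zs.
have -> : W 1 = w by rewrite /W scale1r -nil_partE.
have -> : W 0 = tensor 1 (w ord0) by rewrite /W scale0r addr0.
move=> ->; rewrite (Mbase G hG _ (smooth_fields_map sg gV shs)) (Mbase F hF _ sg).
have -> : [seq weil_map h (tensor (1 : A) (w ord0)) | h <- hs] =
    [seq tensor 1 y | y <- [seq h (w ord0) | h <- hs]].
  rewrite -map_comp; elim: (hs) shs => //= h ks IHk [sh /IHk ->].
  by rewrite (Mbase F hF _ sh).
by rewrite (weil_diff_base A hF hG oV sf _ (gV _ Uw)) subrr /wmul tensor_map0.
Qed.

Theorem weil_map_comp g (w : weil_tensor A E) : smooth_on U g ->
  (forall y, U y -> V (g y)) -> U (w ord0) ->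
  weil_map (fun y => f (g y)) w = weil_map f (weil_map g w).
Proof.
move=> sg gV Uw; have hm : (weil_dim A < size (Nil 'I_(weil_dim A)) + (weil_dim A).+1)%N by [].
have := weil_map_fields hm sg gV (hs := [::]) I Uw.
rewrite big_nil wmul1 => /eqP; rewrite subr_eq0 => /eqP ->.
rewrite (weil_map_diff hF hG oV sf)//.
by rewrite -tensor_piE tensor_pi_weil_map tensor_piE; exact: gV.
Qed.
End Composition.

(** The two Taylor sums stop at different orders, so both are first extended to a common one. They
    then agree term by term, since [psi \otimes E] preserves the base point and hence the nilpotent
    part. *)
Lemma tensor_map_weil_map A B (psi : {lrmorphism A -> B}) E F (U : set E) (f : E -> F)
    (w : weil_tensor A E) :
  hausdorff_space E -> hausdorff_space F -> cinf_open U -> smooth_on U f -> U (w ord0) ->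
  tensor_map psi (weil_map f w) = weil_map f (tensor_map psi w).
Proof.
move=> hE hF oU sf Uw; pose m := (maxn (weil_dim A) (weil_dim B)).+1.
have e0 : tensor_map psi w ord0 = w ord0 by have := tensor_pi_map psi w; rewrite !tensor_piE.
rewrite (weil_map_trunc hE hF oU sf (m := m) Uw) ?ltnS ?leq_maxl//.
rewrite (weil_map_trunc hE hF oU sf (m := m)) ?e0 ?ltnS ?leq_maxr//.
rewrite tensor_map_sum; apply: eq_bigr => k _; rewrite tensor_mapZ; congr (_ *: _).
rewrite tensor_map_multi; last exact: (multilinear_tderives hE hF oU sf).
rewrite map_nseq; congr (multi _ (nseq k _)).
have := tensor_map_linear psi (-1) (tensor 1 (w ord0)) w.
rewrite {2}(nil_partE w) scaleN1r addKr => ->.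
rewrite (tensor_map_tensor psi) rmorph1 -e0 {2}(nil_partE (tensor_map psi w)).
by rewrite scaleN1r addKr.
Qed.
End Functoriality.

(** * The Weil functor on affine maps and on the multiplication of reals *)

Section SpecialMaps.
Context (R : realType).
Implicit Types (A B : weilAlgType R) (E F G : tvsType R).
Let hR := @Rhausdorff R.

Lemma cinf_openT E : cinf_open [set: E].
Proof. by move=> c _; rewrite preimage_setT; exact: openT. Qed.

(** The last vector is differentiated first and leaves a constant. *)
Lemma tderives_affine E F (L : E -> F) (b : F) v vs x : hausdorff_space F ->
  (forall (a : R) u w, L (a *: u + w) = a *: L u + L w) ->
  tderives (fun y => L y + b) (rcons vs v) x = if vs is [::] then L v else 0.
Proof.
move=> hF lin; elim: vs x => [|w vs IH] x /=.
  rewrite tderive_line; apply: (curve_derivativeE hF).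
  rewrite (_ : (fun h : R => _) = fun h => h *: L v + (L x + b)); last first.
    by apply/funext => h; rewrite lin addrA.
  have := curve_derivativeD (curve_derivativeZl (v := L v) (@curve_derivative_id R 0))
    (curve_derivative_cst (L x + b) (0 : R)).
  by rewrite scale1r addr0.
rewrite tderive_line; apply: (curve_derivativeE hF).
rewrite (_ : (fun h : R => _) = fun=> if vs is [::] then L v else 0); last exact/funext.
exact: curve_derivative_cst.
Qed.

Lemma multi_base A E F (phi : seq E -> F) :
  multi phi (Nil (weil_tensor A E)) = tensor 1 (phi [::]).
Proof. by []. Qed.

Lemma multi_single A E F (phi : seq E -> F) (Z : weil_tensor A E) :
  multi phi [:: Z] = \sum_(i < (weil_dim A).+1) tensor (weil_basis A)`_i (phi [:: Z i]).
Proof. by rewrite multi_cons; apply: eq_bigr => i _; rewrite multi_base wmul_tensor mulr1. Qed.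

Lemma multi_zero A E F (phi : seq E -> F) (Zs : seq (weil_tensor A E)) :
  (forall l, size l = size Zs -> phi l = 0) -> multi phi Zs = 0.
Proof.
elim: Zs phi => [|Z Zs IH] phi h /=; first by rewrite multi_base h// tensor0r.
rewrite multi_cons big1// => i _; rewrite IH ?/wmul ?tensor_map0// => l sl.
by apply: h; rewrite /= sl.
Qed.

Lemma weil_map_affine A E F (L : E -> F) (b : F) (w : weil_tensor A E) :
  hausdorff_space E -> hausdorff_space F ->
  smooth_on setT L -> (forall (a : R) u v, L (a *: u + v) = a *: L u + L v) ->
  weil_map (fun y => L y + b) w = (fun i => L (w i) : F) + tensor 1 b.
Proof.
move=> hE hF sL lin.
have sLb : smooth_on setT (fun y => L y + b).
  by move=> c sc cT; apply: smoothD => //; [exact: sL|exact: smooth_cst].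
have L0 : L 0 = 0 by have := lin (-1) 0 0; rewrite scaler0 addr0 scaleN1r addNr.
(* The dimension of the ideal may be 0; this bound ensures that the orders 0 and 1 are present. *)
rewrite (weil_map_trunc hE hF (@cinf_openT E) sLb (m := (weil_dim A).+2))//.
rewrite !big_ord_recl big1 => [|k _]; last first.
  rewrite multi_zero ?scaler0// => l; rewrite size_nseq.
  case/lastP: l => [//|l v] /=; rewrite size_rcons => -[sl].
  by rewrite tderives_affine//; case: l sl.
rewrite addr0 /= multi_base multi_single fact0 factS fact0 muln1 invr1 !scale1r /=.
rewrite tensorDr addrAC; congr (_ + _).
rewrite [RHS]tensor_basis [LHS]addrC.
have -> : \sum_(i < (weil_dim A).+1) tensor (weil_basis A)`_i
    (tderive (fun y => L y + b) (nil_part w i) (w ord0)) =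
    \sum_(i < (weil_dim A).+1) tensor (weil_basis A)`_i (L (nil_part w i)).
  by apply: eq_bigr => i _; rewrite [tderive _ _ _](tderives_affine _ _ [::] _ hF lin).
rewrite 2!big_ord_recl nil_part0 L0 tensor0r add0r addrC; congr (_ + _).
apply: eq_bigr => j _; congr (tensor _ (L _)).
by rewrite {2}(nil_partE w) -[RHS]/(_ + _) tensor1E add0r.
Qed.

Lemma weil_map_linear A E F (L : E -> F) (w : weil_tensor A E) :
  hausdorff_space E -> hausdorff_space F ->
  smooth_on setT L -> (forall (a : R) u v, L (a *: u + v) = a *: L u + L v) ->
  weil_map L w = (fun i => L (w i)).
Proof.
move=> hE hF sL lin; have := weil_map_affine 0 w hE hF sL lin.
rewrite tensor0r addr0 => <-; congr (weil_map _ w).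
by apply/funext => y; rewrite addr0.
Qed.

Lemma weil_map_id A E (w : weil_tensor A E) : hausdorff_space E -> weil_map id w = w.
Proof. by move=> hE; rewrite weil_map_linear// => c. Qed.

Lemma weil_map_cst A E F (b : F) (w : weil_tensor A E) :
  hausdorff_space E -> hausdorff_space F -> weil_map (fun=> b) w = tensor 1 b.
Proof.
move=> hE hF; have := weil_map_affine (L := fun=> 0) b w hE hF.
rewrite (_ : (fun _ : E => 0 + b) = fun=> b); last by apply/funext => y; rewrite add0r.
move=> ->; first by rewrite -[RHS]add0r.
  by move=> c _ _; exact: smooth_cst.
by move=> a u v; rewrite scaler0 addr0.
Qed.

Lemma multi_pair A E F (phi : seq E -> F) (a b : A) y z : multilinear phi ->
  multi phi [:: tensor a y; tensor b z] = tensor (a * b) (phi [:: y; z]).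
Proof.
move=> lin; rewrite multi_tensor// multi_tensor; last exact: multilinear_cons.
by rewrite multi_base !wmul_tensor mulr1.
Qed.

Let mulf (z : R * R) : R := z.1 * z.2.
Let hRR : hausdorff_space (R * R)%type := hausdorff_prod hR hR.

Lemma smooth_fst_snd (c : R -> R * R) : smooth_curve c ->
  smooth_curve (fst \o c) /\ smooth_curve (snd \o c).
Proof.
by move=> /smooth_curveP sc; split; apply/smooth_curveP => n;
  case: (ndiff_prod hR hR (sc n)).
Qed.

Lemma smooth_on_mul : smooth_on setT mulf.
Proof. by move=> c /smooth_fst_snd[s1 s2] _; exact: smoothM. Qed.

Lemma tderive_mul v z : tderive mulf v z = v.1 * z.2 + v.2 * z.1.
Proof.
rewrite tderive_line; apply: (curve_derivativeE hR).
have d (a b : R) : curve_derivative (fun h : R => h * a + b) 0 a.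
  have := curve_derivativeD (curve_derivativeZl (v := a) (@curve_derivative_id R 0))
    (curve_derivative_cst b (0 : R)).
  by rewrite scale1r addr0.
have := curve_derivativeZ (d v.1 z.1) (d v.2 z.2).
congr curve_derivative; rewrite !mul0r !add0r /GRing.scale /=; ring.
Qed.

Lemma tderives_mul3 vs u v w z : tderives mulf (vs ++ [:: u; v; w]) z = 0.
Proof.
rewrite -!cat_rcons cats0 /tderives foldr_rcons.
rewrite (_ : tderive mulf w = fun z => (w.1 * z.2 + w.2 * z.1) + 0); last first.
  by apply/funext => y; rewrite tderive_mul addr0.
rewrite [LHS](@tderives_affine _ _ (fun z : R * R => w.1 * z.2 + w.2 * z.1)) //; first by case: vs.
move=> a x y; rewrite -[(a *: x + y).2]/(a * x.2 + y.2) -[(a *: x + y).1]/(a * x.1 + y.1).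
by rewrite /GRing.scale /=; ring.
Qed.

(** For [a = x + n] and [b = y + m] the Taylor sum is the expansion [x y + (x m + y n) + n m], as
    the third derivatives of the multiplication vanish. *)
Lemma weil_map_mul A (a b : A) :
  weil_map mulf (fun i => (tensor a (1 : R) i, tensor b (1 : R) i)) = tensor (a * b) (1 : R).
Proof.
set w : weil_tensor A _ := fun i => _.
pose e1 : R * R := (1, 0); pose e2 : R * R := (0, 1).
pose x := weil_pi a; pose y := weil_pi b.
have wE : w = tensor a e1 + tensor b e2.
  apply: weil_tensor_eq => i; rewrite -[RHS]/(tensor a e1 i + tensor b e2 i) /w !tensorE.
  move: (coord _ i a) (coord _ i b) => s t.
  rewrite -[RHS]/(s * 1 + t * 0, s * 0 + t * 1) -[s%:A]/(s * 1) -[t%:A]/(t * 1).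
  by rewrite !mulr0 add0r addr0.
have w0 : w ord0 = (x, y) by rewrite /w !tensorE /x /y /weil_pi /GRing.scale /= !mulr1.
have NE : nil_part w = tensor (a - x *: 1) e1 + tensor (b - y *: 1) e2.
  have /eqP := nil_partE w; rewrite addrC -subr_eq => /eqP <-.
  rewrite w0 wE; apply: weil_tensor_eq => i.
  rewrite -[LHS]/(tensor a e1 i + tensor b e2 i - tensor 1 (x, y) i).
  rewrite -[RHS]/(tensor _ e1 i + tensor _ e2 i) !tensorE !linearB /= !linearZ /=.
  move: (coord _ i a) (coord _ i b) (coord _ i 1) => s t u.
  rewrite -[LHS]/(s * 1 + t * 0 + u * - x, s * 0 + t * 1 + u * - y).
  rewrite -[RHS]/((s + x * - u) * 1 + (t + y * - u) * 0, (s + x * - u) * 0 + (t + y * - u) * 1).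
  by congr (_, _); ring.
have lin := multilinear_tderives hRR hR (@cinf_openT _) smooth_on_mul (I : setT (w ord0)).
have linA := multilinear_multi (A := A) lin.
rewrite (weil_map_trunc hRR hR (@cinf_openT _) smooth_on_mul (m := (weil_dim A).+3))//; last by rewrite ltnW.
rewrite 3!big_ord_recl big1 => [|k _]; last first.
  rewrite multi_zero ?scaler0// => l; rewrite size_nseq.
  case/lastP: l => [//|l l1]; case/lastP: l => [//|l l2]; case/lastP: l => [//|l l3] _.
  by rewrite -!cats1 -!catA tderives_mul3.
rewrite addr0 /= multi_base NE !factS fact0 !muln1 invr1 !scale1r.
move: (a - x *: 1) (b - y *: 1) (subrK (x *: 1) a) (subrK (y *: 1) b) => n m <- <-.
have linD s1 s2 u v : multi (fun l => tderives mulf l (w ord0)) (s1 ++ (u + v) :: s2) =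
    multi (fun l => tderives mulf l (w ord0)) (s1 ++ u :: s2) +
    multi (fun l => tderives mulf l (w ord0)) (s1 ++ v :: s2) :> weil_tensor A R.
  by have := linA s1 s2 1 u v; rewrite !scale1r.
have m1 (c : A) v : multi (fun l => tderives mulf l (w ord0)) [:: tensor c v] =
    tensor c (v.1 * y + v.2 * x).
  by rewrite multi_tensor// multi_base wmul_tensor mulr1 /= tderive_mul w0.
have m2 (c d : A) u v : multi (fun l => tderives mulf l (w ord0)) [:: tensor c u; tensor d v] =
    tensor (c * d) (u.1 * v.2 + u.2 * v.1).
  rewrite multi_pair//= (_ : tderive mulf v = fun z => v.1 * z.2 + v.2 * z.1); last first.
    by apply/funext => z; rewrite tderive_mul.
  congr tensor.
  rewrite (tderive_linear (L := fun z : R * R => v.1 * z.2 + v.2 * z.1))//; first by rewrite addrC mulrC [v.1 * _]mulrC.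
  move=> k p q; rewrite -[(k *: p + q).2]/(k * p.2 + q.2) -[(k *: p + q).1]/(k * p.1 + q.1).
  by rewrite /GRing.scale /=; ring.
rewrite (linD [::] [::]) (linD [::] [:: _]) (linD [:: _] [::]) (linD [:: _] [::]) /=.
rewrite !m1 !m2 w0 /= !(mulr0, mul0r, mulr1, mul1r, addr0, add0r) !tensor0r !add0r !addr0.
have tz (c : A) (k : R) : tensor c k = tensor (k *: c) (1 : R).
  by rewrite tensorZl -tensorZr [k *: _]mulr1.
(* The product [n m] occurs twice in the second-order term, which is divided by 2!. *)
have half (T : weil_tensor A R) : (2%:R : R)^-1 *: (T + T) = T.
  by rewrite -{1 2}[T]scale1r -scalerDl scalerA mulVf ?scale1r// pnatr_eq0.
rewrite [m * n]mulrC half.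
rewrite ![tensor _ y]tz ![tensor _ x]tz [tensor 1 (mulf _)]tz -!tensorDl; congr tensor.
rewrite mulrDl !mulrDr -!scalerAl -!scalerAr !mulr1 !mul1r scalerA /mulf /=.
move: (x * y)%:A (y *: n) (x *: m) (n * m) => p q r s.
by rewrite [s + q]addrC addrACA [s + p]addrC addrACA [q + p]addrC -!addrA.
Qed.

End SpecialMaps.

(** * Charts *)

Section ManifoldCurves.
Context (R : realType).
Implicit Types (E F : tvsType R) (M N P : manifold R).

Lemma chart_hausdorff (T : Type) (u : chart R T) : is_chart u -> hausdorff_space (chart_model u).
Proof. by case=> -[]. Qed.

Lemma chart_inj (T : Type) (u : chart R T) p q : is_chart u ->
  chart_dom u p -> chart_dom u q -> chart_map u p = chart_map u q -> p = q.
Proof. by case=> _ inj _; exact: inj. Qed.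

Lemma atlas_chart M u : atlas M u -> is_chart u.
Proof. by have [h _ _ _] := manifoldP M; exact: h. Qed.

Lemma atlas_change M u v : atlas M u -> atlas M v -> smooth_change u v.
Proof. by have [_ _ h _] := manifoldP M; move=> hu hv; have [] := h u v hu hv. Qed.

(** The domain of the chart changing is c-infinity-open, so the curve stays in it near [t];
    injectivity of [u] brings this back to the points [c s]. *)
Lemma change_chart (T : Type) (u v : chart R T) (c : R -> T) t :
  is_chart u -> is_chart v -> smooth_change v u ->
  (\forall s \near t, chart_dom u (c s) /\ smooth_at (chart_map u \o c) s) ->
  chart_dom v (c t) ->
  \forall s \near t, chart_dom v (c s) /\ smooth_at (chart_map v \o c) s.
Proof.
move=> cu cv [od sd] cs vt; have hu := chart_hausdorff cu.
have [ut _] := nbhs_singleton cs.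
have sc : \forall s \near t, smooth_at (chart_map u \o c) s by apply: filterS cs => s [].
have dt : local_dom u id v ((chart_map u \o c) t) by exists (c t).
have [c1 [_ c1d ec]] := localize_curve hu od sc dt.
have vn : \forall s \near t, chart_dom u (c s) /\ chart_dom v (c s).
  apply: filterS (filterI cs ec) => s [[us _] es]; split => //.
  have [p [up vp] pE] := c1d s; suff <- : p = c s by [].
  by apply: (chart_inj cu up us); rewrite pE -es.
have sv := smooth_on_local hu od sd sc dt.
apply: filterS (filterI (near_nearby vn) (filterI sv vn)) => s [ns [ss [_ vs]]]; split=> //.
apply: smooth_at_near ss; apply: filterS ns => r [ur vr] /=.
by rewrite local_repE.
Qed.

Lemma msmooth_curve_chart M (c : R -> M) v t : msmooth_curve c -> atlas M v ->
  chart_dom v (c t) ->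
  \forall s \near t, chart_dom v (c s) /\ smooth_at (chart_map v \o c) s.
Proof.
move=> sc hv vt; have [u hu cs] := sc t.
exact: (change_chart (atlas_chart hu) (atlas_chart hv) (atlas_change hv hu) cs vt).
Qed.

Lemma chart_msmooth_curve (M : chartedSet R) (c : R -> M) u : atlas M u ->
  (forall t, chart_dom u (c t)) -> smooth_curve (chart_map u \o c) -> msmooth_curve c.
Proof.
by move=> hu uc sc t; exists u => //; apply: (@filterE _ (nbhs t)) => s; split.
Qed.

Lemma smooth_onW E F (U V : set E) (f : E -> F) : (forall x, U x -> V x) ->
  smooth_on V f -> smooth_on U f.
Proof. by move=> UV sf c sc Uc; apply: sf => // t; exact: UV. Qed.

Lemma cinf_openI E (U V : set E) : cinf_open U -> cinf_open V -> cinf_open (U `&` V).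
Proof. by move=> oU oV c sc; rewrite preimage_setI; apply: openI; [exact: oU|exact: oV]. Qed.

(** A curve in the model space lifts to [M] only while it stays in the image of [u], so openness is
    tested on reparametrizations with values there, through [open_reparam]. *)
Lemma local_dom_open M N (f : M -> N) u v : msmooth f -> atlas M u -> atlas N v ->
  cinf_open (local_dom u f v).
Proof.
move=> sf hu hv c sc; have cu := atlas_chart hu.
have [[hE _] _ ou] := cu.
have -> : c @^-1` local_dom u f v =
    (c @^-1` chart_cod u) `&` (c @^-1` local_dom u f v).
  by rewrite eqEsubset; split=> t //=; [move=> [p [up vp] <-]; split; exists p|case].
apply: open_reparam => [|k sk hk]; first exact: ou.
have /choice[p pP] : forall s, exists p, chart_dom u p /\ chart_map u p = c (k s).
  by move=> s; have [p up pE] := hk s; exists p.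
have sp : msmooth_curve p.
  apply: (chart_msmooth_curve hu) => [s|]; first by case: (pP s).
  rewrite (_ : _ \o p = c \o k); first exact: smooth_curve_comp.
  by apply/funext => s /=; case: (pP s).
rewrite openE => s [q [uq vq] qE]; have [us sE] := pP s.
have eq : q = p s by apply: (chart_inj cu uq us); rewrite sE.
rewrite eq in vq; have := msmooth_curve_chart (sf _ sp) hv vq.
apply: filterS => r [vr _]; have [ur rE] := pP r.
by exists (p r).
Qed.

Lemma smooth_local_rep M N (f : M -> N) u v : msmooth f -> atlas M u -> atlas N v ->
  smooth_on (local_dom u f v) (local_rep u f v).
Proof.
move=> sf hu hv c sc hc; have cu := atlas_chart hu.
have /choice[p pP] : forall s, exists p, [/\ chart_dom u p, chart_dom v (f p) & chart_map u p = c s].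
  by move=> s; have [p [up vp] pE] := hc s; exists p.
have sp : msmooth_curve p.
  apply: (chart_msmooth_curve hu) => [s|]; first by case: (pP s).
  by rewrite (_ : _ \o p = c)//; apply/funext => s /=; case: (pP s).
move=> t; have [ut vt tE] := pP t.
have [_ h] := nbhs_singleton (msmooth_curve_chart (sf _ sp) hv vt).
apply: smooth_at_near h; apply: (@filterE _ (nbhs t)) => s /=.
by have [us vs <-] := pP s; rewrite local_repE.
Qed.

Lemma vs_msmooth_curve E (hE : convenient E) (c : R -> E) :
  msmooth_curve (c : R -> vs_manifold hE) <-> smooth_curve c.
Proof.
split=> sc.
  move=> t; have := msmooth_curve_chart (t := t) sc (id_chart_atlas hE) I.
  by move=> /nbhs_singleton[].
by apply: (chart_msmooth_curve (M := vs_manifold hE) (id_chart_atlas hE)).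
Qed.

Lemma vs_msmooth E F (hE : convenient E) (hF : convenient F) (f : E -> F) :
  smooth_on setT f -> msmooth (f : vs_manifold hE -> vs_manifold hF).
Proof. by move=> sf c /vs_msmooth_curve sc; apply/vs_msmooth_curve; exact: sf. Qed.

Lemma msmooth_id M : msmooth (id : M -> M).
Proof. by move=> c. Qed.

Lemma msmooth_comp M N P (f : M -> N) (g : N -> P) : msmooth f -> msmooth g -> msmooth (g \o f).
Proof. by move=> sf sg c sc; apply: (sg (f \o c)); exact: sf. Qed.

End ManifoldCurves.

(** * Points of [T_A M] and the maps [T_A f] on representatives *)

Section WeilPoints.
Context (R : realType).
Implicit Types (A B : weilAlgType R) (E F : tvsType R) (M N P : manifold R).

Lemma weil_map_local_comp A M N P (f : M -> N) (g : N -> P) u v w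
    (z : weil_tensor A (chart_model u)) :
  msmooth f -> msmooth g -> atlas M u -> atlas N v -> atlas P w ->
  local_dom u f v (z ord0) -> local_dom u (g \o f) w (z ord0) ->
  weil_map (local_rep u (g \o f) w) z = weil_map (local_rep v g w) (weil_map (local_rep u f v) z).
Proof.
move=> sf sg hu hv hw dfz dgz.
have sgf : msmooth (g \o f) by exact: msmooth_comp.
have cu := atlas_chart hu; have cv := atlas_chart hv; have cw := atlas_chart hw.
have hE (T : Type) (a : chart R T) (ca : is_chart a) := chart_hausdorff ca.
pose U := local_dom u f v `&` local_dom u (g \o f) w.
have oU : cinf_open U by apply: cinf_openI; exact: local_dom_open.
have UP x : U x -> exists p, [/\ chart_dom u p, chart_dom v (f p), chart_dom w (g (f p)) & chart_map u p = x].
  move=> [[p [up vp] px] [q [uq wq] qx]]; exists p; split => //.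
  by rewrite (chart_inj cu up uq) ?px ?qx.
rewrite -(weil_map_comp (hE _ _ cu) (hE _ _ cv) (hE _ _ cw) oU (local_dom_open sg hv hw)).
- apply: (weil_map_eq_on (hE _ _ cu) oU); last by split.
  move=> x /UP[p [up vp wp <-]].
  by rewrite (local_repE (f := g \o f))// (local_repE (f := f))// (local_repE (f := g)).
- exact: smooth_local_rep.
- by apply: (smooth_onW (V := local_dom u f v)); [move=> x []|exact: smooth_local_rep].
- by move=> x /UP[p [up vp wp <-]]; rewrite local_repE//; exists (f p).
- by split.
Qed.

(** [T_A f] on representatives. Since [weil_glue p q] is [weil_rel id q p], gluing and the action of
    maps obey the same rules of composition. *)
Definition weil_rel A M N (f : M -> N) (x : weil_point A M) (y : weil_point A N) : Prop :=
  local_dom (wp_chart x) f (wp_chart y) (tensor_pi (wp_vec x)) /\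
  wp_vec y = weil_map (local_rep (wp_chart x) f (wp_chart y)) (wp_vec x).

Lemma weil_rel_base A M N (f : M -> N) (x : weil_point A M) (y : weil_point A N) : weil_rel f x y ->
  exists p, [/\ chart_dom (wp_chart x) p, chart_dom (wp_chart y) (f p),
    chart_map (wp_chart x) p = tensor_pi (wp_vec x) &
    chart_map (wp_chart y) (f p) = tensor_pi (wp_vec y)].
Proof.
move=> [[p [up vp] px] ->]; exists p; split => //.
by rewrite tensor_pi_weil_map -px local_repE//; exact: (atlas_chart (wp_atlas x)).
Qed.

Lemma weil_rel_comp A M N P (f : M -> N) (g : N -> P) (x : weil_point A M) y z :
  msmooth f -> msmooth g -> weil_rel f x y -> weil_rel g y z -> weil_rel (g \o f) x z.
Proof.
move=> sf sg fxy gyz; have [p [xp yp px py]] := weil_rel_base fxy.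
have [q [yq zq qy qz]] := weil_rel_base gyz.
have eq : q = f p by apply: (chart_inj (atlas_chart (wp_atlas y)) yq yp); rewrite qy py.
have d : local_dom (wp_chart x) (g \o f) (wp_chart z) (tensor_pi (wp_vec x)).
  by exists p => //; rewrite /= -eq.
split=> //; case: gyz => _ ->; case: fxy => dxy ->.
by rewrite (weil_map_local_comp sf sg (wp_atlas x) (wp_atlas y) (wp_atlas z))//; rewrite -tensor_piE.
Qed.

(** With [f] or [g] the identity, this gives the symmetry of gluing and the independence of [T_A f]
    from representatives. *)
Lemma weil_rel_factor A M N P (f : M -> N) (g : N -> P) (x : weil_point A M) y z :
  msmooth f -> msmooth g -> weil_rel f x y -> weil_rel (g \o f) x z -> weil_rel g y z.
Proof.
move=> sf sg fxy gxz; have [p [xp yp px py]] := weil_rel_base fxy.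
have [q [xq zq qx qz]] := weil_rel_base gxz.
have eq : q = p by apply: (chart_inj (atlas_chart (wp_atlas x)) xq xp); rewrite qx px.
split; first by exists (f p) => //; split=> //; rewrite -eq.
case: gxz => dxz ->; case: fxy => dxy ->.
by rewrite (weil_map_local_comp sf sg (wp_atlas x) (wp_atlas y) (wp_atlas z))//; rewrite -tensor_piE.
Qed.

Lemma weil_map_local_id A M u (z : weil_tensor A (chart_model u)) : atlas M u ->
  chart_cod u (z ord0) -> weil_map (local_rep u id u) z = z.
Proof.
move=> hu uz; have cu := atlas_chart hu; have hE := chart_hausdorff cu.
rewrite -[RHS](weil_map_id z hE); have [_ _ ou] := cu.
by apply: (weil_map_eq_on hE ou) uz => x [p up <-]; rewrite local_repE.
Qed.

Lemma weil_rel_id A M (x : weil_point A M) : weil_rel id x x.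
Proof.
split; first by have [p up px] := wp_dom x; exists p.
by rewrite (weil_map_local_id (wp_atlas x))// -tensor_piE; exact: wp_dom.
Qed.

Lemma weil_rel_id_sym A M (x y : weil_point A M) : weil_rel id x y -> weil_rel id y x.
Proof.
move=> xy; apply: (weil_rel_factor (P := M) (@msmooth_id _ M) (@msmooth_id _ M) xy).
exact: weil_rel_id.
Qed.

(** Functoriality on chart changings makes gluing reflexive, symmetric and transitive, so the
    generated equivalence adds nothing to it. *)
Lemma weil_in_eq A M (x y : weil_point A M) : weil_in x = weil_in y <-> weil_rel id x y.
Proof.
split=> [|h].
  move=> /(congr1 sval) /= e; have : weil_class x y by rewrite e; exact: rst_refl.
  elim=> {x y e} [x y [d e]|x|x y _ /weil_rel_id_sym//|x y z _ xy _ yz].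
  - exact: (weil_rel_id_sym (conj d e)).
  - exact: weil_rel_id.
  - exact: (weil_rel_comp (f := id) (g := id) (@msmooth_id _ M) (@msmooth_id _ M) xy yz).
apply: eq_exist; apply/funext => z; apply/propext.
have xy : clos_refl_sym_trans _ (@weil_glue R A M) y x by apply: rst_step; exact: h.
by split=> hz; apply: rst_trans hz => //; exact: rst_sym.
Qed.

(** [weil_fmap] chooses a chart and representatives; for smooth [f] any other choice differs by
    gluing at both ends. *)
Lemma weil_fmapE A M N (f : M -> N) (x : weil_point A M) (y : weil_point A N) : msmooth f ->
  weil_fmap f (weil_in x) = weil_in y <-> weil_rel f x y.
Proof.
move=> sf; rewrite /weil_fmap; case: cid => q [x' [y' [/= ex -> d e]]].
have xx' := (weil_in_eq _ _).1 ex.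
have xy' : weil_rel f x y' := weil_rel_comp (f := id) (g := f) (@msmooth_id _ M) sf xx' (conj d e).
rewrite weil_in_eq; split=> h.
  exact: (weil_rel_comp (f := f) (g := id) sf (@msmooth_id _ N) xy' h).
exact: (weil_rel_factor (f := f) (g := id) sf (@msmooth_id _ N) xy' h).
Qed.

Lemma weil_rel_chart A M N (f : M -> N) (x : weil_point A M) v : atlas N v ->
  local_dom (wp_chart x) f v (tensor_pi (wp_vec x)) ->
  exists (w : weil_tensor A (chart_model v)) h (hv : atlas N v), weil_rel f x (@WeilPoint R A N v hv w h).
Proof.
move=> hv [p [up vp] px]; have cx := atlas_chart (wp_atlas x).
have h : chart_cod v (tensor_pi (weil_map (local_rep (wp_chart x) f v) (wp_vec x))).
  by rewrite tensor_pi_weil_map -px local_repE//; exists (f p).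
by exists (weil_map (local_rep (wp_chart x) f v) (wp_vec x)), h, hv; split=> //; exists p.
Qed.

Lemma weil_rel_map A B (psi : {lrmorphism A -> B}) M N (f : M -> N) (x : weil_point A M) y :
  msmooth f -> weil_rel f x y -> weil_rel f (weil_point_map psi x) (weil_point_map psi y).
Proof.
move=> sf [d e]; split; first by rewrite /= tensor_pi_map.
rewrite /= e; apply: tensor_map_weil_map.
- exact: chart_hausdorff (atlas_chart (wp_atlas x)).
- exact: chart_hausdorff (atlas_chart (wp_atlas y)).
- exact: local_dom_open sf (wp_atlas x) (wp_atlas y).
- exact: smooth_local_rep sf (wp_atlas x) (wp_atlas y).
- by rewrite -tensor_piE.
Qed.

Lemma weil_trans_in A B (psi : {lrmorphism A -> B}) M (x : weil_point A M) :
  weil_trans psi (weil_in x : weil_functor A M) = weil_in (weil_point_map psi x).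
Proof.
rewrite /weil_trans; case: cid => y /= e; apply/weil_in_eq/weil_rel_map => //.
by apply/weil_in_eq/esym/eq_exist.
Qed.

Lemma weil_trans_fmap A B (psi : {lrmorphism A -> B}) M N (f : M -> N) (p : weil_functor A M) :
  msmooth f -> weil_trans psi (weil_fmap f p) = weil_fmap f (weil_trans psi p).
Proof.
move=> sf; have [x ->] := weil_in_ex p; have [y ey] := weil_in_ex (weil_fmap f (weil_in x)).
rewrite ey !weil_trans_in; apply/esym/weil_fmapE => //; apply: weil_rel_map => //.
exact/weil_fmapE.
Qed.

End WeilPoints.

(** * The charts of [T_A M] *)

Section WeilCharts.
Context (R : realType).
Implicit Types (A B : weilAlgType R) (E F : tvsType R) (M N P : manifold R).

Lemma weil_in_inj A M u (hu : atlas M u) (w w' : weil_tensor A (chart_model u))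
    (h : chart_cod u (tensor_pi w)) (h' : chart_cod u (tensor_pi w')) :
  weil_in (WeilPoint hu h) = weil_in (WeilPoint hu h') -> w = w'.
Proof.
move=> /weil_in_eq[_ /= ->]; rewrite (weil_map_local_id hu)// -tensor_piE.
exact: h.
Qed.

Lemma weil_chartE A M u (hu : atlas M u) (w : weil_tensor A (chart_model u))
    (h : chart_cod u (tensor_pi w)) :
  chart_map (weil_chart A hu) (weil_in (WeilPoint hu h)) = w.
Proof.
rewrite /=; case: xgetP => [w' _ [h' /weil_in_inj ->//]|/(_ w)[]].
by exists h.
Qed.

Lemma weil_chart_cod A M u (hu : atlas M u) (w : weil_tensor A (chart_model u)) :
  chart_cod (weil_chart A hu) w <-> chart_cod u (w ord0).
Proof.
rewrite -tensor_piE; split=> [[p [w' [h ->]] <-]|h]; first by rewrite weil_chartE.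
by exists (weil_in (WeilPoint hu h)); [exists w, h|exact: weil_chartE].
Qed.

Lemma weil_chart_is_chart A M u (hu : atlas M u) : is_chart (weil_chart A hu).
Proof.
have cu := atlas_chart hu; have [hE _ ou] := cu; split.
- exact: convenient_weil_tensor.
- by move=> p q [w [h ->]] [w' [h' ->]]; rewrite !weil_chartE => e; move: h; rewrite e => h; congr (weil_in (WeilPoint _ _)).
- move=> c sc; have s0 := (smooth_tensor c hE.1).1 sc ord0.
  rewrite (_ : _ @^-1` _ = (fun s => c s ord0) @^-1` chart_cod u); first exact: ou.
  by rewrite eqEsubset; split=> s /= /(weil_chart_cod hu).
Qed.

Lemma weil_chart_local_dom A M u v (hu : atlas M u) (hv : atlas M v) (w : weil_tensor A (chart_model u)) :
  local_dom (weil_chart A hu) id (weil_chart A hv) w <-> local_dom u id v (w ord0).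
Proof.
rewrite -tensor_piE; split.
  move=> [p [[w1 [h1 e1]] [w2 [h2 e2]]] <-]; rewrite e1 weil_chartE.
  by have /weil_in_eq[] := etrans (esym e1) e2.
move=> d; have h : chart_cod u (tensor_pi w) by have [p [up _] px] := d; exists p.
have [z [hz [hv' r]]] := @weil_rel_chart R A M M id (WeilPoint hu h) v hv d.
exists (weil_in (WeilPoint hu h)); last exact: weil_chartE.
split; first by exists w, h.
by exists z, hz; rewrite (Prop_irrelevance hv hv'); apply/weil_in_eq.
Qed.

Lemma weil_chart_local_rep A M u v (hu : atlas M u) (hv : atlas M v) (w : weil_tensor A (chart_model u)) :
  local_dom u id v (w ord0) ->
  local_rep (weil_chart A hu) id (weil_chart A hv) w = weil_map (local_rep u id v) w.
Proof.
move=> d; have [p [pu pv] <-] := (weil_chart_local_dom hu hv w).2 d.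
rewrite local_repE//; last exact: weil_chart_is_chart.
case: pu => w1 [h1 e1]; case: pv => w2 [h2 e2].
rewrite {1}e2 e1 !weil_chartE.
by have /weil_in_eq[] := etrans (esym e1) e2.
Qed.

Lemma weil_chart_change A M u v (hu : atlas M u) (hv : atlas M v) :
  smooth_change (weil_chart A hu) (weil_chart A hv).
Proof.
have [od sd] := atlas_change hu hv.
have [hE _ _] := atlas_chart hu; have [hF _ _] := atlas_chart hv.
have s0 (c : R -> weil_tensor A (chart_model v)) : smooth_curve c -> smooth_curve (fun s => c s ord0).
  by move=> sc; exact: (smooth_tensor c hF.1).1 sc ord0.
split=> c sc.
  rewrite (_ : _ @^-1` _ = (fun s => c s ord0) @^-1` local_dom v id u); first exact: od (s0 c sc).
  by rewrite eqEsubset; split=> s /= /(weil_chart_local_dom hv hu).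
move=> hc.
have hc' t : local_dom v id u (c t ord0) by apply/weil_chart_local_dom.
have := smooth_on_weil_map hF.1 hE.1 od sd sc hc'.
by congr smooth_curve; apply/funext => t /=; rewrite weil_chart_local_rep.
Qed.

Lemma weil_chart_atlas A M u (hu : atlas M u) : atlas (weil_functor A M) (weil_chart A hu).
Proof.
split; first exact: weil_chart_is_chart.
by move=> _ [v [hv ->]]; split; exact: weil_chart_change.
Qed.

(** The chart that witnesses smoothness is any member of the maximal atlas, hence compatible with
    [T_A u] by definition. *)
Lemma weil_functor_curve A M u (hu : atlas M u) (c : R -> weil_functor A M) t :
  msmooth_curve c -> chart_dom (weil_chart A hu) (c t) ->
  \forall s \near t, chart_dom (weil_chart A hu) (c s) /\ smooth_at (chart_map (weil_chart A hu) \o c) s.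
Proof.
move=> sc ut; have [v [cv hv] cs] := sc t.
apply: (change_chart cv (weil_chart_is_chart A hu) _ cs ut).
by case: (hv (weil_chart A hu)) => //; exists u, hu.
Qed.

Lemma weil_trans_msmooth A B (psi : {lrmorphism A -> B}) M : msmooth (@weil_trans R A B psi M).
Proof.
move=> c sc t; have [[u hu w h] ct] := weil_in_ex (c t).
exists (weil_chart B hu); first exact: weil_chart_atlas.
have ut : chart_dom (weil_chart A hu) (c t) by exists w, h.
have [hE _ _] := atlas_chart hu.
have key p : chart_dom (weil_chart A hu) p -> chart_dom (weil_chart B hu) (weil_trans psi p) /\
    chart_map (weil_chart B hu) (weil_trans psi p) = tensor_map psi (chart_map (weil_chart A hu) p).
  move=> [z [hz ->]]; rewrite weil_trans_in weil_chartE weil_chartE; split=> //.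
  by exists (tensor_map psi z), (weil_point_map_subproof psi (WeilPoint hu hz)).
have cs := weil_functor_curve sc ut.
apply: filterS (filterI cs (near_nearby cs)) => s [[us ss] ns].
split; first by case: (key _ us).
have : smooth_at (fun r => tensor_map psi (chart_map (weil_chart A hu) (c r))) s.
  apply: nbhs_singleton; apply: (smooth_on_local (hausdorff_weil_tensor hE.1) (@cinf_openT _ _)) => //.
    by move=> c1 sc1 _; exact: (smooth_tensor_map psi hE.1 sc1).
  by apply: filterS ns => r [].
apply: smooth_at_near; apply: filterS ns => r [ur _] /=.
by case: (key _ ur).
Qed.

End WeilCharts.

(** * Vector spaces as manifolds *)

Section VectorSpaces.
Context (R : realType).
Implicit Types (A B : weilAlgType R) (E F : tvsType R) (M N P : manifold R).

Definition vs_in A E (hE : convenient E) (w : weil_tensor A E) : weil_functor A (vs_manifold hE) :=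
  weil_in (@WeilPoint R A (vs_manifold hE) (id_chart E) (id_chart_atlas hE) w (id_chart_codT _)).

Lemma vs_in_inj A E (hE : convenient E) : injective (@vs_in A E hE).
Proof. by move=> w z /weil_in_inj. Qed.

Lemma vs_in_ex A E (hE : convenient E) (p : weil_functor A (vs_manifold hE)) :
  exists w, p = vs_in hE w.
Proof.
have [x ->] := weil_in_ex p; have [q xq qx] := wp_dom x.
have [w [h [hv r]]] := @weil_rel_chart R A (vs_manifold hE) (vs_manifold hE) id x (id_chart E)
  (id_chart_atlas hE) (ex_intro2 _ _ q (conj xq I) qx).
exists w; apply/weil_in_eq; move: r; congr (weil_rel _ _ _).
by rewrite (Prop_irrelevance hv (id_chart_atlas hE)) (Prop_irrelevance h (id_chart_codT _)).
Qed.

Lemma weil_fmap_chart A E (hE : convenient E) M (f : vs_manifold hE -> M) u (hu : atlas M u)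
    (w : weil_tensor A E) (z : weil_tensor A (chart_model u)) (h : chart_cod u (tensor_pi z)) :
  msmooth f -> chart_dom u (f (w ord0)) -> weil_map (local_rep (id_chart E) f u) w = z ->
  weil_fmap f (vs_in hE w) = weil_in (WeilPoint hu h).
Proof.
move=> sf uf e; apply/weil_fmapE => //; split=> //=.
by rewrite tensor_piE; exists (w ord0).
Qed.

Lemma weil_fmap_vs A E F (hE : convenient E) (hF : convenient F) (f : E -> F) (w : weil_tensor A E) :
  smooth_on setT f ->
  weil_fmap (f : vs_manifold hE -> vs_manifold hF) (vs_in hE w) = vs_in hF (weil_map f w).
Proof.
move=> sf; apply: weil_fmap_chart => //; first exact: vs_msmooth.
congr (weil_map _ w); apply/funext => x.
exact: (local_repE (a := id_chart E) (b := id_chart F) (f := f) (p := x) (id_chart_is_chart hE) I I).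
Qed.

Lemma weil_line_vs A (a : A) : weil_line a = vs_in (convenient_R R) (tensor a (1 : R)).
Proof. by []. Qed.

Lemma tensor_line_ex A (w : weil_tensor A R) : exists a : A, w = tensor a (1 : R).
Proof.
exists (\sum_i w i *: (weil_basis A)`_i); rewrite {1}(tensor_basis w) tensor_suml.
by apply: eq_bigr => i _; rewrite tensorZl -tensorZr [_ *: _]mulr1.
Qed.

Lemma tensor_line_inj A : injective (fun a : A => tensor a (1 : R)).
Proof.
move=> a b e; rewrite (weil_coord a) (weil_coord b); apply: eq_bigr => i _.
by have := congr1 (fun w : weil_tensor A R => w i) e; rewrite !tensorE ![_ *: _]mulr1 => ->.
Qed.

Lemma weil_line_inj A : injective (@weil_line R A).
Proof. by move=> a b /vs_in_inj/tensor_line_inj. Qed.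

Lemma weil_line_ex A (p : weil_functor A (line R)) : exists a, p = weil_line a.
Proof.
by have [w ->] := vs_in_ex p; have [a ->] := tensor_line_ex w; exists a.
Qed.

Lemma weil_lineK A : cancel (@weil_line R A) (@weil_unline R A).
Proof.
by move=> a; apply: weil_line_inj; rewrite /weil_unline; case: xgetP => [b _ ->|/(_ a)[]].
Qed.

Lemma weil_unlineK A : cancel (@weil_unline R A) (@weil_line R A).
Proof. by move=> p; have [a ->] := weil_line_ex p; rewrite weil_lineK. Qed.

Lemma inj_surj_bij (S T : Type) (f : S -> T) : injective f -> (forall y, exists x, y = f x) -> bijective f.
Proof.
by move=> fi /choice[g gP]; exists g => x; [apply: fi; rewrite -gP|rewrite -gP].
Qed.

Let hR := @Rhausdorff R.

Lemma smooth_plane_fst : smooth_on setT (fst : R * R -> R).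
Proof. by move=> c /smooth_fst_snd[]. Qed.

Lemma smooth_plane_snd : smooth_on setT (snd : R * R -> R).
Proof. by move=> c /smooth_fst_snd[]. Qed.

Lemma smooth_plane_add : smooth_on setT (fun z : R * R => z.1 + z.2).
Proof. by move=> c /smooth_fst_snd[s1 s2] _; exact: smoothD. Qed.

Lemma smooth_line_scale t : smooth_on setT (fun x : R => t * x).
Proof. by move=> c sc _; apply: smoothM => //; exact: smooth_cst. Qed.

Lemma weil_plane_linear A (L : R * R -> R) (w : weil_tensor A (R * R)%type) : smooth_on setT L ->
  (forall (a : R) u v, L (a *: u + v) = a *: L u + L v) ->
  weil_fmap (L : plane R -> line R) (vs_in (convenient_prod (convenient_R R) (convenient_R R)) w : weil_functor A (plane R)) =
  vs_in (convenient_R R) (fun i => L (w i) : R).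
Proof. by move=> sL lin; rewrite [LHS](weil_fmap_vs _ _ _ sL) weil_map_linear. Qed.

Lemma weil_plane_ex A (a b : A) : exists w : weil_functor A (plane R),
  weil_fmap (@plane_fst R) w = weil_line a /\ weil_fmap (@plane_snd R) w = weil_line b.
Proof.
exists (vs_in (convenient_prod (convenient_R R) (convenient_R R)) (fun i => (tensor a (1 : R) i, tensor b (1 : R) i))).
by split; rewrite [LHS]weil_plane_linear//; [exact: smooth_plane_fst|exact: smooth_plane_snd].
Qed.

Lemma weil_planeP A (w : weil_functor A (plane R)) (a b : A) :
  weil_fmap (@plane_fst R) w = weil_line a -> weil_fmap (@plane_snd R) w = weil_line b ->
  w = vs_in (convenient_prod (convenient_R R) (convenient_R R)) (fun i => (tensor a (1 : R) i, tensor b (1 : R) i)).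
Proof.
have [z ->] := vs_in_ex w.
rewrite [X in X = _ -> _]weil_plane_linear//; last exact: smooth_plane_fst.
rewrite [X in _ -> X = _ -> _]weil_plane_linear//; last exact: smooth_plane_snd.
move=> /vs_in_inj ea /vs_in_inj eb; congr (vs_in _ _); apply: weil_tensor_eq => i.
by rewrite -ea -eb; case: (z i).
Qed.

Lemma weil_plane_bij A : bijective (fun w : weil_functor A (plane R) =>
  (weil_fmap (@plane_fst R) w, weil_fmap (@plane_snd R) w)).
Proof.
apply: inj_surj_bij => [w w' [e1 e2]|[p q]].
  have [a ea] := weil_line_ex (weil_fmap (@plane_fst R) w).
  have [b eb] := weil_line_ex (weil_fmap (@plane_snd R) w).
  by rewrite (weil_planeP ea eb); apply/esym/weil_planeP; rewrite -?e1 -?e2.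
have [a ->] := weil_line_ex p; have [b ->] := weil_line_ex q.
by have [w [e1 e2]] := weil_plane_ex a b; exists w; rewrite e1 e2.
Qed.

Lemma weil_fmap_add A (w : weil_functor A (plane R)) (a b : A) :
  weil_fmap (@plane_fst R) w = weil_line a -> weil_fmap (@plane_snd R) w = weil_line b ->
  weil_fmap (@line_add R) w = weil_line (a + b).
Proof.
move=> ea eb; rewrite (weil_planeP ea eb) [LHS]weil_plane_linear; first 1 last.
- exact: smooth_plane_add.
- move=> k u v; rewrite -[LHS]/((k * u.1 + v.1) + (k * u.2 + v.2)) /line_add.
  by rewrite /GRing.scale /= mulrDr addrACA.
by rewrite weil_line_vs tensorDl.
Qed.

Lemma weil_fmap_mul A (w : weil_functor A (plane R)) (a b : A) :
  weil_fmap (@plane_fst R) w = weil_line a -> weil_fmap (@plane_snd R) w = weil_line b ->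
  weil_fmap (@line_mul R) w = weil_line (a * b).
Proof.
move=> ea eb; rewrite (weil_planeP ea eb) [LHS](weil_fmap_vs _ _ _ (@smooth_on_mul R)).
by rewrite weil_map_mul.
Qed.

Lemma weil_fmap_scale A t (a : A) : weil_fmap (line_scale t) (weil_line a) = weil_line (t *: a).
Proof.
rewrite weil_line_vs [LHS](weil_fmap_vs _ _ _ (@smooth_line_scale t)).
rewrite weil_map_linear//; first 1 last.
- exact: smooth_line_scale.
- by move=> k u v; rewrite /GRing.scale /=; ring.
by rewrite weil_line_vs tensorZl.
Qed.

Lemma weil_fmap_cst A (b : R) (p : weil_functor A (line R)) :
  weil_fmap ((fun=> b) : line R -> line R) p = weil_line (b *: 1).
Proof.
have [w ->] := vs_in_ex p.
have sb : smooth_on setT (fun _ : R => b) by move=> c _ _; exact: smooth_cst.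
rewrite [LHS](weil_fmap_vs _ _ _ sb) weil_map_cst// weil_line_vs.
by rewrite tensorZl -tensorZr [b *: _]mulr1.
Qed.

End VectorSpaces.

(** * Natural transformations *)

Section NaturalTransformations.
Context (R : realType) (A B : weilAlgType R).
Implicit Types (E F : tvsType R) (M N P : manifold R).
Implicit Types phi : forall M : manifold R, weil_functor A M -> weil_functor B M.

Lemma weil_at_lineE phi a : weil_line (weil_at_line phi a) = phi (line R) (weil_line a).
Proof. exact: weil_unlineK. Qed.

Lemma weil_at_line_morph phi : weil_natural phi ->
  exists psi : {lrmorphism A -> B}, weil_at_line phi =1 psi.
Proof.
move=> [_ nat]; pose f := weil_at_line phi.
(* By naturality for the two projections, [phi] sends the point of [T_A (R * R)] with coordinates
   [a], [b] to the point of [T_B (R * R)] with coordinates [f a], [f b]; naturality for [op] then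
   compares the induced operations. *)
have binary (op : plane R -> line R) (opA : A -> A -> A) (opB : B -> B -> B) : msmooth op ->
    (forall w a b, weil_fmap (@plane_fst R) w = weil_line a ->
      weil_fmap (@plane_snd R) w = weil_line b -> weil_fmap op w = weil_line (opA a b)) ->
    (forall w a b, weil_fmap (@plane_fst R) w = weil_line a ->
      weil_fmap (@plane_snd R) w = weil_line b -> weil_fmap op w = weil_line (opB a b)) ->
    forall a b, f (opA a b) = opB (f a) (f b).
  move=> sop hA hB a b; have [w [e1 e2]] := weil_plane_ex a b.
  apply: weil_line_inj; rewrite -(hB (phi _ w)).
  - by rewrite /f weil_at_lineE -(hA w a b e1 e2) nat.
  - by rewrite -nat ?e1 /f ?weil_at_lineE//; apply: vs_msmooth; exact: smooth_plane_fst.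
  - by rewrite -nat ?e2 /f ?weil_at_lineE//; apply: vs_msmooth; exact: smooth_plane_snd.
have fD : {morph f : a b / a + b}.
  apply: (binary (@line_add R)); [apply: vs_msmooth; exact: smooth_plane_add|exact: weil_fmap_add|exact: weil_fmap_add].
have fM : {morph f : a b / a * b}.
  apply: (binary (@line_mul R)); [apply: vs_msmooth; exact: smooth_on_mul|exact: weil_fmap_mul|exact: weil_fmap_mul].
have f1 : f 1 = 1.
  have sc : msmooth ((fun=> 1) : line R -> line R).
    by apply: vs_msmooth => c _ _; apply: smooth_cst; exact: Rhausdorff.
  apply: weil_line_inj; rewrite /f weil_at_lineE.
  have := weil_fmap_cst 1 (weil_line (0 : A)); rewrite scale1r => <-.
  by rewrite nat// weil_fmap_cst scale1r.
have fZ t a : f (t *: a) = t *: f a.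
  apply: weil_line_inj; rewrite /f weil_at_lineE -!weil_fmap_scale nat ?weil_at_lineE//.
  apply: vs_msmooth; exact: smooth_line_scale.
have fB : {morph f : a b / a - b}.
  by move=> a b; rewrite fD -scaleN1r fZ scaleN1r.
pose psi : {lrmorphism A -> B} := HB.pack f
  (GRing.isZmodMorphism.Build A B f fB)
  (GRing.isMonoidMorphism.Build A B f (conj f1 fM))
  (GRing.isScalable.Build R A B *:%R f fZ).
by exists psi.
Qed.

Lemma weil_trans_natural (psi : {lrmorphism A -> B}) :
  weil_natural (fun M : manifold R => weil_trans psi (M := M)).
Proof. by split=> [M|M N f sf p]; [exact: weil_trans_msmooth|exact: weil_trans_fmap]. Qed.

Lemma weil_trans_vs (psi : {lrmorphism A -> B}) E (hE : convenient E) (w : weil_tensor A E) :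
  weil_trans psi (vs_in hE w) = vs_in hE (tensor_map psi w).
Proof.
rewrite weil_trans_in /vs_in /weil_point_map /=; congr weil_in.
by congr (@WeilPoint R B (vs_manifold hE) _ _ _ _); exact: Prop_irrelevance.
Qed.

Lemma weil_at_line_trans (psi : {lrmorphism A -> B}) :
  weil_at_line (fun M : manifold R => weil_trans psi (M := M)) =1 psi.
Proof.
by move=> a; apply: weil_line_inj; rewrite weil_at_lineE weil_line_vs weil_trans_vs tensor_map_tensor.
Qed.

End NaturalTransformations.

(** * A universal point over a real coordinate space *)

Section Cube.
Context (R : realType) (A : weilAlgType R) (M : manifold R).
Let hR := @Rhausdorff R.

(** [A \otimes R] serves as the coordinate space because it is already known to be convenient. *)
Let cube : manifold R := vs_manifold (convenient_weil_tensor A (convenient_R R)).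

Lemma smooth_on_coord i : smooth_on setT (fun r : weil_tensor A R => r i).
Proof. by move=> c sc _; exact: (smooth_tensor c hR).1 sc i. Qed.

(* The cube is [R^d], with a superfluous coordinate of index [ord0]. *)
Lemma weil_versal (p : weil_functor A M) :
  exists2 gamma : cube -> M, msmooth gamma & exists q : weil_functor A cube, p = weil_fmap gamma q.
Proof.
have [[u hu w h] ->] := weil_in_ex p.
have cu := atlas_chart hu; have hE := chart_hausdorff cu; have [_ _ ou] := cu.
pose E := chart_model u.
pose L (r : weil_tensor A R) : E := \sum_(j < weil_dim A) r (lift ord0 j) *: w (lift ord0 j).
pose X (r : 'I_(weil_dim A) -> R) : E := \sum_(j < weil_dim A) r j *: w (lift ord0 j) + w ord0.
have [||d d0 dX] := @cinf_open_box R E 'I_(weil_dim A) _ X ou.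
- move=> sg ssg; apply: smoothD => //; last exact: smooth_cst.
  by apply: smooth_sum => // i _; apply: smoothZ => //; exact: smooth_cst.
- by rewrite /X big1 ?add0r -?tensor_piE// => j _; rewrite scale0r.
pose g (r : weil_tensor A R) := X (fun j => cutoff d (r (lift ord0 j))).
have gU r : chart_cod u (g r) by apply: dX => i; apply: ltW; exact: cutoff_lt.
have sg : smooth_on setT g.
  move=> c sc _; apply: smoothD => //; last exact: smooth_cst.
  apply: smooth_sum => // i _; apply: smoothZ => //; last exact: smooth_cst.
  apply: (smooth_curve_comp hR (k := fun t => c t (lift ord0 i))); last exact: smooth_cutoff.
  exact: (smooth_tensor c hR).1 sc _.
have /choice[gamma gammaP] : forall r, exists p, chart_dom u p /\ chart_map u p = g r.
  by move=> r; have [q uq qE] := gU r; exists q.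
have sgamma : msmooth (gamma : cube -> M).
  move=> c /vs_msmooth_curve sc; apply: (chart_msmooth_curve hu) => [s|].
    by case: (gammaP (c s)).
  rewrite (_ : _ \o _ = g \o c); first exact: sg.
  by apply/funext => s /=; case: (gammaP (c s)).
(* The universal point: its base point is 0, and the coefficient of each nilpotent basis element is
   the corresponding unit vector. *)
pose N : weil_tensor A (weil_tensor A R) := fun i => if i == ord0 then 0 else fun k => (k == i)%:R.
exists gamma => //; exists (vs_in _ N); apply/esym; apply: weil_fmap_chart => //.
  by case: (gammaP (N ord0)).
have hT : hausdorff_space (weil_tensor A R) by exact: hausdorff_weil_tensor.
transitivity (weil_map g N).
  congr (weil_map _ N); apply/funext => r; have [ur <-] := gammaP r.
  exact: (local_repE (id_chart_is_chart (convenient_weil_tensor A (convenient_R R))) I ur).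
have sL : smooth_on setT L.
  move=> c sc _; apply: smooth_sum => // i _; apply: smoothZ => //; last exact: smooth_cst.
  exact: (smooth_tensor c hR).1 sc _.
have linL (k : R) r s : L (k *: r + s) = k *: L r + L s.
  rewrite /L scaler_sumr -big_split; apply: eq_bigr => j _ /=.
  by rewrite scalerA -scalerDl.
(* On [O] the cutoffs are the identity and [g] is affine. Since [O] is c-infinity-open and contains
   the base point of [N], this determines [T_A g] at [N]. *)
pose O := [set r : weil_tensor A R | forall j : 'I_(weil_dim A), `|r (lift ord0 j)| < d / 2].
have oO : cinf_open O.
  move=> c sc; rewrite openE => t Ot.
  apply: (@filter_forall _ _ (fun j s => `|c s (lift ord0 j)| < d / 2) _ (nbhs_filter t)) => j.
  apply: (cvgr_lt _ (cvg_norm (smooth_curve_continuous (t := t) ((smooth_tensor c hR).1 sc (lift ord0 j))))).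
  exact: Ot.
rewrite (@weil_map_eq_on _ _ _ _ O g (fun r => L r + w ord0) N hT oO); first 1 last.
- by move=> r Or; congr (_ + _); apply: eq_bigr => j _; rewrite cutoff_id// ltW//; exact: Or.
- by move=> j /=; rewrite normr0 divr_gt0.
rewrite weil_map_affine//; apply: weil_tensor_eq => i.
rewrite -[LHS]/(L (N i) + tensor 1 (w ord0) i) tensor1E.
case: (unliftP ord0 i) => [j ->|->].
  rewrite addr0 /N /L (bigD1 j)//= eqxx scale1r big1 ?addr0// => k kj.
  by rewrite (inj_eq lift_inj) (negbTE kj) scale0r.
by rewrite eqxx /L big1 ?add0r// => j _; rewrite /N eqxx scale0r.
Qed.

End Cube.

(** * Natural transformations are determined by their value on the line *)

Section Uniqueness.
Context (R : realType) (A B : weilAlgType R).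
Implicit Types phi : forall M : manifold R, weil_functor A M -> weil_functor B M.

Lemma weil_natural_eq phi phi' : weil_natural phi -> weil_natural phi' ->
  (forall p, phi (line R) p = phi' (line R) p) ->
  forall (M : manifold R) (p : weil_functor A M), phi M p = phi' M p.
Proof.
move=> [_ nat] [_ nat'] e M p; have [gamma sgamma [q ->]] := weil_versal p.
rewrite nat// nat'//; congr weil_fmap.
have [z ez] := vs_in_ex (phi _ q); have [z' ez'] := vs_in_ex (phi' _ q).
rewrite ez ez'; congr (vs_in _ _); apply: weil_tensor_eq => i; apply/funext => k.
have hT : hausdorff_space (weil_tensor A R) by apply: hausdorff_weil_tensor; exact: Rhausdorff.
have sk := smooth_on_coord (A := A) k.
have coordE (C : weilAlgType R) (w : weil_tensor C (weil_tensor A R)) :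
    weil_fmap ((fun r : weil_tensor A R => r k) : vs_manifold (convenient_weil_tensor A (convenient_R R)) -> line R)
      (vs_in (convenient_weil_tensor A (convenient_R R)) w) = vs_in (convenient_R R) (fun i => w i k).
  rewrite [LHS](weil_fmap_vs _ _ _ sk) weil_map_linear//; exact: Rhausdorff.
have : vs_in (convenient_R R) (fun i => z i k) = vs_in (convenient_R R) (fun i => z' i k).
  by rewrite -!coordE -ez -ez' -nat ?e ?nat'//; apply: vs_msmooth.
by move=> /vs_in_inj/(congr1 (fun w : weil_tensor B R => w i)).
Qed.

End Uniqueness.

Theorem theorem3p6 (R : realType) (A B : weilAlgType R) :
  [/\ bijective (fun a : A => weil_line a),
      bijective (fun w : weil_functor A (plane R) =>
        (weil_fmap (@plane_fst R) w, weil_fmap (@plane_snd R) w)),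
      forall (w : weil_functor A (plane R)) (a b : A),
        weil_fmap (@plane_fst R) w = weil_line a ->
        weil_fmap (@plane_snd R) w = weil_line b ->
        weil_fmap (@line_add R) w = weil_line (a + b) /\
        weil_fmap (@line_mul R) w = weil_line (a * b) &
      forall (t : R) (a : A),
        weil_fmap (line_scale t) (weil_line a) = weil_line (t *: a)] /\
  [/\ forall phi : (forall M : manifold R,
                      weil_functor A M -> weil_functor B M),
        weil_natural phi ->
        exists psi : {lrmorphism A -> B}, weil_at_line phi =1 psi,
      forall psi : {lrmorphism A -> B},
        weil_natural (fun M : manifold R => weil_trans psi (M := M)),
      forall psi : {lrmorphism A -> B},
        weil_at_line (fun M : manifold R => weil_trans psi (M := M)) =1 psi &
      forall phi : (forall M : manifold R,
                      weil_functor A M -> weil_functor B M),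
        weil_natural phi ->
        forall psi : {lrmorphism A -> B}, weil_at_line phi =1 psi ->
        forall (M : manifold R) (p : weil_functor A M),
          phi M p = weil_trans psi p].
Proof.
split; split.
- exact: (Bijective (@weil_lineK R A) (@weil_unlineK R A)).
- exact: weil_plane_bij.
- by move=> w a b ea eb; split; [exact: weil_fmap_add|exact: weil_fmap_mul].
- exact: weil_fmap_scale.
- exact: weil_at_line_morph.
- exact: weil_trans_natural.
- exact: weil_at_line_trans.
- move=> phi nphi psi e; apply: (weil_natural_eq nphi (weil_trans_natural psi)) => p.
  have [a ->] := weil_line_ex p.
  by rewrite -weil_at_lineE e -(weil_at_line_trans psi a) weil_at_lineE.
Qed.
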